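(* Let $n\ge 1$ and $0\le a\le 12$ be integers, and let $a_0,\dots,a_n$ be integers with $a_0a_n=\pm1$ and $a_1=a_2=\cdots=a_{n-1}=1$. Then $f_{n,a}(x)$ is either irreducible over $\mathbb{Q}$ or is the product of a linear polynomial and a polynomial of degree $n-1$ in $\mathbb{Q}[x]$.
   Context: For integers $n\ge 1$, $a\ge 0$ and integers $a_0,a_1,\dots,a_n$, the generalised Schur polynomial is $f_{n,a}(x)=\sum_{j=0}^{n} a_j\frac{x^j}{(j+a)!}$. *)

(* Defs.v *)
From HB Require Import structures.
From mathcomp Require Import all_boot all_order all_algebra.
Set Implicit Arguments. Unset Strict Implicit. Unset Printing Implicit Defensive.
Import Order.TTheory GRing.Theory Num.Theory.
Local Open Scope ring_scope.

Definition schur_poly (n a : nat) (c : nat -> int) : {poly rat} :=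
  \sum_(j < n.+1) (((c j)%:~R / ((j + a)`!)%:R) *: 'X^j).

(* Main.v *)
(** Let [N = n + a] and suppose that the polynomial, scaled to have constant term 1,
splits as [G * H] with [deg G = k] and [2 <= k <= n / 2]. The Newton polygons at a prime
[p > k + a] leave no room for [p] to divide one of [N, N - 1, ..., N - k + 1]; hence these
[k] consecutive integers are [(k + a)]-smooth.

For [k >= 10] this is impossible, by Erdos's proof of the Sylvester-Schur theorem: smoothness
bounds the prime factorisation of [C(N, k)], which is too small once [N >= 2 k].
For [3 <= k <= 9] assign to each prime the term in which it has the largest exponent. Some
term then carries at most one prime, so [c * p ^ x] and [c * (p ^ x +- 1)] are both smooth
with [c < k]; the multiplicative order of [p] modulo powers of the other primes bounds [x].
The finitely many surviving [(a, k, n)] are excluded by a steep edge of a Newton polygon or,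
for three cubic cases, by a finite search.
For [k = 2] the Newton polygons bound the denominators of [G], a bound on the roots leaves
finitely many candidates for [G], and the recurrence for the coefficients of the quotient
excludes them: modulo a prime [l] it restarts whenever [l] divides [j + a]. *)

Require Import Defs.
From HB Require Import structures.
From Stdlib Require Import ZArith Znumtheory Classical.
From mathcomp Require Import all_boot all_order all_algebra all_field.
From mathcomp Require Import ssrZ zify ring lra.
Set Implicit Arguments. Unset Strict Implicit. Unset Printing Implicit Defensive.
Import Order.TTheory GRing.Theory Num.Theory.
Local Open Scope ring_scope.

(** * Valuations and weights *)

(** The signs of the coefficients do not affect valuations, so the Newton polygons are those of the
    factorials and depend on [n] and [a] alone; the equality of the interior coefficients enters
    through the recurrences in degrees 2 and 3. The bound [k + a] comes from Legendre's formula: for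
    [p > k + a] the polygon lies above a line that keeps the coefficient of index [k] integral at
    [p], whereas a prime dividing one of the top [k] integers must occur in the denominator of the
    leading coefficient of [G]. The hypothesis [a <= 12] fixes the primes concerned: [k <= 9] gives
    [k + a <= 21], hence primes up to 19, and the estimates for large [k] are made with [k + 12].
    Degree 2 needs an argument of its own because the pigeonhole on two terms tolerates only three
    primes, while [k + a] reaches 14. What replaces it is arithmetic: the leading coefficient of [G]
    is the inverse of an integer dividing an explicit bound, and the quotient must stop at degree
    [n - 2]. *)

HB.lock Definition vq (p : nat) (x : rat) : int :=
  (logn p `|numq x|)%:Z - (logn p `|denq x|)%:Z.

Lemma vq_frac p (a b : int) : a != 0 -> b != 0 ->
  vq p (a%:~R / b%:~R) = (logn p `|a|)%:Z - (logn p `|b|)%:Z.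
Proof.
move=> a0 b0; rewrite vq.unlock; set x := a%:~R / b%:~R.
have bQ : b%:~R != 0 :> rat by rewrite intr_eq0.
have x0 : x != 0 by rewrite mulf_neq0 ?invr_eq0 ?intr_eq0.
have E : numq x * b = a * denq x.
  apply: (@intr_inj rat); rewrite !intrM.
  have := divq_num_den x; set u := (numq x)%:~R; set v := (denq x)%:~R => h.
  have v0 : v != 0 by rewrite intr_eq0 denq_neq0.
  by rewrite (canRL (divfK v0) h) /x mulrAC divfK.
have n0 : (0 < `|numq x|)%N by rewrite absz_gt0 numq_eq0.
have d0 : (0 < `|denq x|)%N by rewrite absz_gt0 denq_neq0.
have := congr1 (fun z => logn p `|z|) E.
by rewrite /= !abszM !lognM ?absz_gt0 //; lia.
Qed.

Lemma rat_frac (x : rat) : exists a b : int, b != 0 /\ x = a%:~R / b%:~R.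
Proof. by exists (numq x), (denq x); rewrite denq_neq0 divq_num_den. Qed.

Lemma vq_nat p n : vq p n%:R = (logn p n)%:Z.
Proof.
case: (posnP n) => [->|n0]; first by rewrite vq.unlock /= !logn0 logn1.
have := @vq_frac p n%:Z 1; rewrite divr1 /= logn1 subr0 => <- //.
by rewrite eqz_nat -lt0n.
Qed.

Lemma vq1 p : vq p 1 = 0.
Proof. by rewrite (vq_nat p 1) logn1. Qed.

Lemma vqM p x y : x != 0 -> y != 0 -> vq p (x * y) = vq p x + vq p y.
Proof.
have [a [b [b0 ->]]] := rat_frac x; have [c [d [d0 ->]]] := rat_frac y.
rewrite !mulf_eq0 !invr_eq0 !intr_eq0 !negb_or => /andP[a0 _] /andP[c0 _].
have -> : a%:~R / b%:~R * (c%:~R / d%:~R) = (a * c)%:~R / (b * d)%:~R :> rat.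
  by rewrite !intrM mulf_div.
rewrite !vq_frac ?mulf_neq0 //.
rewrite !abszM !lognM ?absz_gt0 //; lia.
Qed.

Lemma vqV p x : x != 0 -> vq p x^-1 = - vq p x.
Proof.
move=> x0; have := @vqM p x x^-1 x0; rewrite invr_eq0 => /(_ x0).
by rewrite divff // vq1; lia.
Qed.

Lemma vqN p x : vq p (- x) = vq p x.
Proof. by rewrite vq.unlock numqN denqN abszN. Qed.

(** [vq p 0] evaluates to 0; the disjunct [x == 0] restores the infinite valuation of zero, so that
    the ultrametric inequality holds without nonvanishing conditions. *)
Definition vge (p : nat) (t : int) (x : rat) := (x == 0) || (t <= vq p x).

Lemma vgeD p t x y : prime p -> vge p t x -> vge p t y -> vge p t (x + y).
Proof.
move=> pp; rewrite /vge.
have [->|x0] := eqVneq x 0; first by rewrite add0r.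
have [->|y0] := eqVneq y 0; first by rewrite addr0 (negbTE x0).
have [//|s0] := eqVneq (x + y) 0; rewrite /=.
move: x0 y0 s0.
have [a [b [b0 ->]]] := rat_frac x; have [c [d [d0 ->]]] := rat_frac y.
have -> : a%:~R / b%:~R + c%:~R / d%:~R = (a * d + c * b)%:~R / (b * d)%:~R :> rat.
  by rewrite intrD !intrM addf_div ?intr_eq0.
rewrite !mulf_eq0 !invr_eq0 !intr_eq0 !negb_or => /andP[a0 _] /andP[c0 _] /andP[s0 _].
rewrite !vq_frac ?mulf_neq0 // => h1 h2.
have key : (minn (logn p `|(a * d)%R|) (logn p `|(c * b)%R|) <= logn p `|(a * d + c * b)%R|)%N.
  set m := minn _ _.
  rewrite -pfactor_dvdn ?absz_gt0 //.
  have D1 : (p ^ m %| `|(a * d)%R|)%N.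
    by rewrite pfactor_dvdn ?absz_gt0 ?mulf_neq0 // geq_minl.
  have D2 : (p ^ m %| `|(c * b)%R|)%N.
    by rewrite pfactor_dvdn ?absz_gt0 ?mulf_neq0 // geq_minr.
  have : ((p ^ m)%N%:Z %| a * d + c * b)%Z by rewrite rpredD // dvdzE.
  by rewrite dvdzE.
move: key; rewrite !abszM !lognM ?absz_gt0 //; lia.
Qed.

Lemma vge_sum p t (I : Type) (r : seq I) (P : pred I) (F : I -> rat) :
  prime p -> (forall i, P i -> vge p t (F i)) -> vge p t (\sum_(i <- r | P i) F i).
Proof.
move=> pp h; elim/big_ind: _ => [|x y|//]; first by rewrite /vge eqxx.
exact: vgeD.
Qed.

(** If the valuation of the sum exceeded that of [x], then [x = (x + y) - y] would have a valuation
    above its own. *)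
Lemma vqD_eq p x y : prime p -> x != 0 -> vge p (vq p x + 1) y ->
  x + y != 0 /\ vq p (x + y) = vq p x.
Proof.
move=> pp x0 hy.
have [y0|y0] := eqVneq y 0; first by rewrite y0 addr0.
move: (hy); rewrite /vge (negbTE y0) /= => hy'.
have s0 : x + y != 0.
  apply/eqP => /eqP; rewrite addr_eq0 => /eqP E; move: hy'; rewrite E vqN; lia.
split=> //.
have : vge p (vq p x) (x + y).
  by apply: vgeD; rewrite /vge ?lexx ?orbT //; apply/orP; right; lia.
rewrite /vge (negbTE s0) /= => h1.
case: (ltP (vq p x) (vq p (x + y))) => h2; last lia.
have : vge p (vq p x + 1) ((x + y) + (- y)).
  apply: vgeD => //; rewrite /vge ?(negbTE s0) /=; first lia.
  by rewrite oppr_eq0 vqN.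
by rewrite addrK /vge (negbTE x0) /=; lia.
Qed.

(** Together with [last_min] this finds the two ends of an edge of a Newton polygon: [A] will mark
    the nonzero coefficients and [f] will be a weight that is constant along the edge. *)
Lemma first_min (A : pred nat) (f : nat -> int) n : (exists2 i, (i < n)%N & A i) ->
  exists i, [/\ (i < n)%N, A i, forall j, (j < n)%N -> A j -> f i <= f j &
                 forall j, (j < i)%N -> A j -> f i < f j].
Proof.
elim: n => [[i]//|n IH] [i0 i0n Ai0].
case: (boolP [exists i : 'I_n, A i]) => [/existsP [i Ai]|/existsPn nA].
  have [k [kn Ak h1 h2]] := IH (ex_intro2 _ _ (i : nat) (ltn_ord i) Ai).
  case: (boolP (A n && (f n < f k))) => [/andP[An fn]|hn].
    exists n; split=> // [j jn Aj|j jn Aj].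
      by move: jn; rewrite ltnS leq_eqVlt => /orP[/eqP->//|jn]; move: (h1 _ jn Aj); lia.
    by move: (h1 _ jn Aj); lia.
  exists k; split=> //; first exact: ltnW.
  move=> j; rewrite ltnS leq_eqVlt => /orP[/eqP-> An|jn]; last exact: h1.
  by move: hn; rewrite An /= -leNgt.
have i0E : i0 = n.
  move: i0n; rewrite ltnS leq_eqVlt => /orP[/eqP//|i0n].
  by have := nA (Ordinal i0n); rewrite Ai0.
exists n; rewrite -i0E; split=> // j; rewrite i0E.
  rewrite ltnS leq_eqVlt => /orP[/eqP->//|jn Aj].
  by have := nA (Ordinal jn); rewrite Aj.
by move=> jn Aj; have := nA (Ordinal jn); rewrite Aj.
Qed.

Lemma last_min (A : pred nat) (f : nat -> int) n : (exists2 i, (i < n)%N & A i) ->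
  exists i, [/\ (i < n)%N, A i, forall j, (j < n)%N -> A j -> f i <= f j &
                 forall j, (i < j < n)%N -> A j -> f i < f j].
Proof.
elim: n => [[i]//|n IH] [i0 i0n Ai0].
case: (boolP [exists i : 'I_n, A i]) => [/existsP [i Ai]|/existsPn nA].
  have [k [kn Ak h1 h2]] := IH (ex_intro2 _ _ (i : nat) (ltn_ord i) Ai).
  case: (boolP (A n && (f n <= f k))) => [/andP[An fn]|hn].
    exists n; split=> // [j jn Aj|j /andP[nj]]; last by rewrite ltnS leqNgt nj.
    by move: jn; rewrite ltnS leq_eqVlt => /orP[/eqP->//|jn]; move: (h1 _ jn Aj); lia.
  exists k; split=> //; first exact: ltnW.
    move=> j; rewrite ltnS leq_eqVlt => /orP[/eqP-> An|jn]; last exact: h1.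
    by move: hn; rewrite An /= -ltNge; lia.
  move=> j /andP[kj]; rewrite ltnS leq_eqVlt => /orP[/eqP-> An|jn] //.
    by move: hn; rewrite An /= -ltNge.
  by apply: h2; rewrite kj.
have i0E : i0 = n.
  move: i0n; rewrite ltnS leq_eqVlt => /orP[/eqP//|i0n].
  by have := nA (Ordinal i0n); rewrite Ai0.
exists n; rewrite -i0E; split=> // j; rewrite i0E.
  rewrite ltnS leq_eqVlt => /orP[/eqP->//|jn Aj].
  by have := nA (Ordinal jn); rewrite Aj.
by move=> /andP[nj]; rewrite ltnS leqNgt nj.
Qed.

(** Minimising this weight over the nonzero coefficients selects the edge of slope [- s / d] of the
    Newton polygon; the factor [d] keeps rational slopes inside [int]. *)
Definition wt (p d : nat) (s : int) (P : {poly rat}) (i : nat) : int :=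
  d%:Z * vq p P`_i + s * i%:Z.

Lemma wt_firstP p d s (P : {poly rat}) : P != 0 ->
  exists i, [/\ P`_i != 0, forall j, P`_j != 0 -> wt p d s P i <= wt p d s P j &
                forall j, (j < i)%N -> P`_j != 0 -> wt p d s P i < wt p d s P j].
Proof.
move=> P0.
have [|i [_ Ai h1 h2]] := @first_min (fun i => P`_i != 0) (wt p d s P) (size P).
  exists (size P).-1; first by rewrite ltn_predL size_poly_gt0.
  by rewrite -lead_coefE lead_coef_eq0.
exists i; split=> [//|j Pj|j ji Pj]; last exact: h2.
by apply: h1 => //; rewrite ltnNge; apply: contra Pj => /(nth_default 0) ->.
Qed.

Lemma wt_lastP p d s (P : {poly rat}) : P != 0 ->
  exists i, [/\ P`_i != 0, forall j, P`_j != 0 -> wt p d s P i <= wt p d s P j &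
                forall j, (i < j)%N -> P`_j != 0 -> wt p d s P i < wt p d s P j].
Proof.
move=> P0.
have [|i [_ Ai h1 h2]] := @last_min (fun i => P`_i != 0) (wt p d s P) (size P).
  exists (size P).-1; first by rewrite ltn_predL size_poly_gt0.
  by rewrite -lead_coefE lead_coef_eq0.
have sz j : P`_j != 0 -> (j < size P)%N.
  by move=> Pj; rewrite ltnNge; apply: contra Pj => /(nth_default 0) ->.
exists i; split=> [//|j Pj|j ij Pj]; first by apply: h1 => //; apply: sz.
by apply: h2 => //; rewrite ij sz.
Qed.

Lemma wt_coef_ge p d s (G H : {poly rat}) (b : int) r : prime p -> (0 < d)%N ->
  (forall i j, (i + j)%N = r -> G`_i != 0 -> H`_j != 0 ->
     b <= wt p d s G i + wt p d s H j) ->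
  (G * H)`_r != 0 -> b <= wt p d s (G * H) r.
Proof.
move=> pp d0 hGH; rewrite /wt coefM => nz.
rewrite leNgt; apply/negP => lt.
move ES: (\sum_(i < r.+1) _) nz lt => S nz lt.
suff : vge p (vq p S + 1) S by rewrite /vge (negbTE nz) /= gerDl.
rewrite -{2}ES.
apply: vge_sum => // i _; rewrite /vge mulf_eq0.
have [//|g0] := eqVneq G`_i 0; have [//|h0] := eqVneq H`_(r - i) 0.
rewrite /= vqM //.
have := ltn_ord i; rewrite ltnS => ir.
have := hGH i (r - i)%N (subnKC ir) g0 h0; rewrite /wt -subzn // => e1.
have : d%:Z * vq p S < d%:Z * (vq p G`_i + vq p H`_(r - i)).
  by rewrite mulrBr in e1; rewrite mulrDr; lia.
by rewrite ltr_pM2l // lezD1.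
Qed.

(* The only product [G_i H_j] of minimal weight with [i + j = i0 + j0] is
   [G_i0 H_j0], so it cannot cancel. *)
Lemma wt_mul_vertex p d s (G H : {poly rat}) i0 j0 : prime p -> (0 < d)%N ->
  G`_i0 != 0 -> H`_j0 != 0 ->
  (forall i j, (i + j = i0 + j0)%N -> i != i0 -> G`_i != 0 -> H`_j != 0 ->
     wt p d s G i0 + wt p d s H j0 < wt p d s G i + wt p d s H j) ->
  (G * H)`_(i0 + j0) != 0 /\
  wt p d s (G * H) (i0 + j0) = wt p d s G i0 + wt p d s H j0.
Proof.
move=> pp d0 g0 h0 hlt.
have lti0 : (i0 < (i0 + j0).+1)%N by rewrite ltnS leq_addr.
have E : (G * H)`_(i0 + j0) = G`_i0 * H`_j0 +
   \sum_(i < (i0 + j0).+1 | i != Ordinal lti0) G`_i * H`_(i0 + j0 - i).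
  by rewrite coefM (bigD1 (Ordinal lti0)) //= addKn.
have [||n0 v0] := @vqD_eq p (G`_i0 * H`_j0)
  (\sum_(i < (i0 + j0).+1 | i != Ordinal lti0) G`_i * H`_(i0 + j0 - i)) pp.
- by rewrite mulf_neq0.
- apply: vge_sum => // i ni; rewrite /vge mulf_eq0.
  have [//|gi] := eqVneq G`_i 0; have [//|hi] := eqVneq H`_(i0 + j0 - i) 0.
  have ir : (i <= i0 + j0)%N by rewrite -ltnS.
  have := hlt i (i0 + j0 - i)%N (subnKC ir) _ gi hi.
  rewrite -val_eqE /= in ni => /(_ ni); rewrite !vqM // /wt => e.
  rewrite /=; have : d%:Z * (vq p G`_i0 + vq p H`_j0) <
             d%:Z * (vq p G`_i + vq p H`_(i0 + j0 - i)).
    by move: e; rewrite -subzn // mulrBr PoszD !mulrDr; lia.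
  by rewrite ltr_pM2l // lezD1.
rewrite E; split=> //; rewrite /wt E v0 vqM //.
by rewrite PoszD !mulrDr; lia.
Qed.

(** Dumas: the left ends of the edges of a given slope add up. If [i + j = i0 + j0] and [i != i0],
    then [i < i0] or [j < j0], and strictness on that side makes [(i0, j0)] the only minimal
    pair. *)
Lemma wt_mul_first p d s (G H : {poly rat}) i0 j0 : prime p -> (0 < d)%N ->
  G`_i0 != 0 -> (forall j, G`_j != 0 -> wt p d s G i0 <= wt p d s G j) ->
  (forall j, (j < i0)%N -> G`_j != 0 -> wt p d s G i0 < wt p d s G j) ->
  H`_j0 != 0 -> (forall j, H`_j != 0 -> wt p d s H j0 <= wt p d s H j) ->
  (forall j, (j < j0)%N -> H`_j != 0 -> wt p d s H j0 < wt p d s H j) ->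
  (G * H)`_(i0 + j0) != 0 /\
  wt p d s (G * H) (i0 + j0) = wt p d s G i0 + wt p d s H j0.
Proof.
move=> pp d0 g0 gm gs h0 hm hs; apply: wt_mul_vertex => // i j ij ni gi hj.
have := gm _ gi; have := hm _ hj.
case: (ltnP i i0) => lt.
  by have := gs _ lt gi; lia.
by have := hs j _ hj; rewrite -(ltn_add2l i) ij ltn_add2r ltn_neqAle eq_sym ni lt => /(_ isT); lia.
Qed.

Lemma wt_mul_last p d s (G H : {poly rat}) i0 j0 : prime p -> (0 < d)%N ->
  G`_i0 != 0 -> (forall j, G`_j != 0 -> wt p d s G i0 <= wt p d s G j) ->
  (forall j, (i0 < j)%N -> G`_j != 0 -> wt p d s G i0 < wt p d s G j) ->
  H`_j0 != 0 -> (forall j, H`_j != 0 -> wt p d s H j0 <= wt p d s H j) ->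
  (forall j, (j0 < j)%N -> H`_j != 0 -> wt p d s H j0 < wt p d s H j) ->
  (G * H)`_(i0 + j0) != 0 /\
  wt p d s (G * H) (i0 + j0) = wt p d s G i0 + wt p d s H j0.
Proof.
move=> pp d0 g0 gm gs h0 hm hs; apply: wt_mul_vertex => // i j ij ni gi hj.
have := gm _ gi; have := hm _ hj.
case: (ltnP i0 i) => lt.
  by have := gs _ lt gi; lia.
by have := hs j _ hj; rewrite -(ltn_add2l i) ij ltn_add2r ltn_neqAle ni lt => /(_ isT); lia.
Qed.

(** * Newton polygons of a factor *)

(** The original polynomial divided by its constant term; each [e j] will be a sign and thus
    disappears from valuations. *)
Definition nform (n a : nat) (e : nat -> rat) : {poly rat} :=
  \poly_(j < n.+1) (e j * (a`!%:R / (j + a)`!%:R)).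

Definition splits (n a k : nat) (e : nat -> rat) (G H : {poly rat}) : Prop :=
  [/\ [/\ forall j, `|e j| = 1, e 0%N = 1 & (k <= n)%N],
      nform n a e = G * H, G`_0 = 1 /\ H`_0 = 1, size G = k.+1 & size H = (n - k).+1].

Lemma vq_fact_ratio p a j : vq p (a`!%:R / (j + a)`!%:R) =
  (logn p a`!)%:Z - (logn p (j + a)`!)%:Z.
Proof.
have nz m : m`!%:R != 0 :> rat by rewrite pnatr_eq0 -lt0n fact_gt0.
by rewrite vqM ?invr_eq0 // vqV // !vq_nat.
Qed.

Lemma coef_nform n a (e : nat -> rat) j : (nform n a e)`_j =
  if (j <= n)%N then e j * (a`!%:R / (j + a)`!%:R) else 0.
Proof. by rewrite coef_poly ltnS. Qed.

Lemma coef_nform_neq0 n a (e : nat -> rat) j : (forall j, `|e j| = 1) ->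
  ((nform n a e)`_j != 0) = (j <= n)%N.
Proof.
move=> he; rewrite coef_nform; case: ifP => _; last by rewrite eqxx.
by rewrite !mulf_neq0 ?invr_eq0 ?pnatr_eq0 -?lt0n ?fact_gt0 // -normr_eq0 he oner_eq0.
Qed.

Lemma vq_nform p n a (e : nat -> rat) j : (forall j, `|e j| = 1) -> (j <= n)%N ->
  vq p (nform n a e)`_j = (logn p a`!)%:Z - (logn p (j + a)`!)%:Z.
Proof.
move=> he jn; rewrite coef_nform jn -vq_fact_ratio.
have : e j = 1 \/ e j = -1.
  have h1 := he j; case: (ger0P (e j)) h1 => _ h1; first by left.
  by right; rewrite -h1 opprK.
by case=> ->; rewrite ?mul1r ?mulN1r ?vqN.
Qed.

Lemma logn_fact_mono p i j : (i <= j)%N -> (logn p i`! <= logn p j`!)%N.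
Proof.
move=> /subnK <-; elim: (j - i)%N => [|d IH] //.
by rewrite addSn factS lognM ?fact_gt0 //; lia.
Qed.

Section Splits.
Variables (n a k : nat) (e : nat -> rat) (G H : {poly rat}).
Hypothesis S : splits n a k e G H.

Let he : forall j, `|e j| = 1. Proof. by case: S => [[]]. Qed.
Let kn : (k <= n)%N. Proof. by case: S => [[]]. Qed.
Let FE : nform n a e = G * H. Proof. by case: S. Qed.
Let G0 : G`_0 = 1. Proof. by case: S => _ _ []. Qed.
Let H0 : H`_0 = 1. Proof. by case: S => _ _ []. Qed.
Let sG : size G = k.+1. Proof. by case: S. Qed.
Let sH : size H = (n - k).+1. Proof. by case: S. Qed.
Let Gn0 : G != 0. Proof. by rewrite -size_poly_eq0 sG. Qed.
Let Hn0 : H != 0. Proof. by rewrite -size_poly_eq0 sH. Qed.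

Lemma split_lead_neq0 : G`_k != 0.
Proof. by rewrite -[k]/(k.+1.-1) -sG -lead_coefE lead_coef_eq0. Qed.

Lemma split_colead_neq0 : H`_(n - k) != 0.
Proof. by rewrite -[(n - k)%N]/((n - k).+1.-1) -sH -lead_coefE lead_coef_eq0. Qed.

Lemma split_coefG_le i : G`_i != 0 -> (i <= k)%N.
Proof. by apply: contraR; rewrite -ltnNge => h; rewrite nth_default // sG. Qed.

Lemma split_coefH_le i : H`_i != 0 -> (i <= n - k)%N.
Proof. by apply: contraR; rewrite -ltnNge => h; rewrite nth_default // sH. Qed.

(** The hypothesis puts a line below the Newton polygon of the product. Since [H_0 = 1], the least
    weight of [H] is at most 0, so the least weight of [G] is at least that of the product, and the
    same line lies below the polygon of [G]. *)
Lemma split_hull p d beta sigma : prime p -> (0 < d)%N ->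
  (forall j, (j <= n)%N ->
     (d * logn p (j + a)`! <= d * logn p a`! + beta + sigma * j)%N) ->
  forall i, G`_i != 0 -> - (beta + sigma * i)%N%:Z <= d%:Z * vq p G`_i.
Proof.
move=> pp d0 line i Gi.
have [i0 [gi0 gm gs]] := wt_firstP p d sigma%:Z Gn0.
have [j0 [hj0 hm hs]] := wt_firstP p d sigma%:Z Hn0.
have [nz E] := wt_mul_first pp d0 gi0 gm gs hj0 hm hs.
rewrite -FE in nz E.
have ijn : (i0 + j0 <= n)%N by rewrite -(@coef_nform_neq0 n a e).
have := hm 0%N; rewrite H0 oner_eq0 => /(_ isT).
have := gm i Gi; move: E; rewrite /wt vq_nform // H0 vq1.
have := line (i0 + j0)%N ijn.
by rewrite !mulrBr; lia.
Qed.

(** This is the weight of slope 0. The valuations of the coefficients of the product never increase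
    with the index, so they are least at [n]; comparison with the first minima of [G] and [H] forces
    equality throughout, and both leading coefficients have least valuation. *)
Lemma split_min p : prime p ->
  exists i0 j0, [/\ G`_i0 != 0 /\ H`_j0 != 0, (i0 + j0 <= n)%N,
   [/\ vq p G`_i0 = vq p G`_k, vq p H`_j0 = vq p H`_(n - k) &
    logn p (i0 + j0 + a)`! = logn p (n + a)`!],
   forall j, G`_j != 0 -> vq p G`_k <= vq p G`_j &
   forall j, (j < i0)%N -> G`_j != 0 -> vq p G`_i0 < vq p G`_j].
Proof.
move=> pp.
have [i0 [gi0 gm gs]] := wt_firstP p 1 0 Gn0.
have [j0 [hj0 hm hs]] := wt_firstP p 1 0 Hn0.
have [nz E] := wt_mul_first pp (ltn0Sn 0) gi0 gm gs hj0 hm hs.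
rewrite -FE in nz E.
have ijn : (i0 + j0 <= n)%N by rewrite -(@coef_nform_neq0 n a e).
have := gm _ split_lead_neq0; have := hm _ split_colead_neq0.
have En : vq p (nform n a e)`_n = vq p G`_k + vq p H`_(n - k).
  rewrite -vqM ?split_lead_neq0 ?split_colead_neq0 // FE; congr (vq p _).
  have := lead_coefM G H; rewrite /lead_coef size_mul // sG sH /= -FE => <-.
  by rewrite addnS /= subnKC.
move: E En; rewrite /wt !mul0r !addr0 !mul1r !vq_nform //.
have := @logn_fact_mono p (i0 + j0 + a) (n + a); rewrite leq_add2r => /(_ ijn).
move=> h1 h2 h3 h4 h5.
exists i0, j0; split=> //; first by split; lia.
  by move=> j Gj; have := gm j Gj; rewrite /wt !mul0r !addr0 !mul1r; lia.
by move=> j ji Gj; have := gs j ji Gj; rewrite /wt !mul0r !addr0 !mul1r.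
Qed.

Lemma split_lead_min p i : prime p -> G`_i != 0 -> vq p G`_k <= vq p G`_i.
Proof. by move=> pp Gi; have [i0 [j0 [_ _ _ h _]]] := split_min pp; apply: h. Qed.

Lemma split_lead_le0 p : prime p -> vq p G`_k <= 0.
Proof. by move=> pp; rewrite -(vq1 p) -G0 split_lead_min // G0 oner_eq0. Qed.

(** Otherwise [G] attains its minimum at index 0 and the product attains its own at some
    [j0 <= n - k], although the factor [j + a] of the last factorial still lowers the valuation
    after [j0]. *)
Lemma split_top p j : prime p -> (n - k < j <= n)%N -> (p %| j + a)%N -> vq p G`_k < 0.
Proof.
move=> pp /andP[nkj jn] pj; rewrite ltNge; apply/negP => ge0.
have v0 : vq p G`_k = 0 by apply/eqP; rewrite eq_le ge0 split_lead_le0.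
have [i0 [j0 [[gi0 hj0] ijn [e1 e2 e3] _ h]]] := split_min pp.
have i00 : i0 = 0%N.
  apply/eqP; rewrite -leqn0 leqNgt; apply/negP => i0p.
  by have := h 0%N i0p; rewrite G0 oner_eq0 => /(_ isT); rewrite e1 v0 vq1 ltxx.
have := split_coefH_le hj0; move: e3; rewrite i00 add0n => e3 j0le.
have ja : (0 < j + a)%N by lia.
have h1 : (logn p (j + a)`! <= logn p (n + a)`!)%N by rewrite logn_fact_mono ?leq_add2r.
have h2 : (logn p (j0 + a)`! <= logn p (j + a).-1`!)%N by rewrite logn_fact_mono //; lia.
have h3 : (logn p (j + a)`! = logn p (j + a) + logn p (j + a).-1`!)%N.
  by rewrite -{1}(prednK ja) factS prednK // lognM ?fact_gt0.
have : (0 < logn p (j + a))%N by rewrite logn_gt0 mem_primes pp ja pj.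
lia.
Qed.

(** The points [j1] and [j2] lie on an edge of steepness [sigma / d] in lowest terms. An edge of [G]
    with that slope has a width divisible by [d > k], hence width 0; the whole edge comes from [H],
    whose degree is [n - k]. *)
Lemma split_edge p d sigma j1 j2 : prime p -> (k < d)%N -> coprime d sigma ->
  (j1 <= n)%N -> (j2 <= n)%N ->
  (forall j, (j <= n)%N ->
     (d * logn p (j + a)`! + sigma * j1 <= d * logn p (j1 + a)`! + sigma * j)%N) ->
  (d * logn p (j2 + a)`! + sigma * j1 = d * logn p (j1 + a)`! + sigma * j2)%N ->
  (k + j2 <= n + j1)%N.
Proof.
move=> pp kd co j1n j2n line eqj.
have d0 : (0 < d)%N by lia.
have [i0 [gi0 gm gs]] := wt_firstP p d sigma%:Z Gn0.
have [i1 [gi1 gm1 gs1]] := wt_lastP p d sigma%:Z Gn0.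
have [h0 [hh0 hm hs]] := wt_firstP p d sigma%:Z Hn0.
have [h1 [hh1 hm1 hs1]] := wt_lastP p d sigma%:Z Hn0.
have [nz0 E0] := wt_mul_first pp d0 gi0 gm gs hh0 hm hs.
have [nz1 E1] := wt_mul_last pp d0 gi1 gm1 gs1 hh1 hm1 hs1.
have Fge r b : (forall i j, (i + j)%N = r -> G`_i != 0 -> H`_j != 0 ->
     b <= wt p d sigma%:Z G i + wt p d sigma%:Z H j) -> (r <= n)%N ->
     b <= wt p d sigma%:Z (nform n a e) r.
  by move=> h rn; rewrite FE; apply: wt_coef_ge => //; rewrite -FE coef_nform_neq0.
rewrite -FE in nz0 E0 nz1 E1.
rewrite !coef_nform_neq0 // in nz0 nz1.
have Geq : wt p d sigma%:Z G i0 = wt p d sigma%:Z G i1 by apply/eqP; rewrite eq_le gm ?gm1.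
have Heq : wt p d sigma%:Z H h0 = wt p d sigma%:Z H h1 by apply/eqP; rewrite eq_le hm ?hm1.
have i01 : i0 = i1.
  have i0k := split_coefG_le gi0; have i1k := split_coefG_le gi1.
  have : (d%:Z %| i0%:Z - i1%:Z)%Z.
    rewrite -(@Gauss_dvdzr d%:Z sigma%:Z) //.
    apply/dvdzP; exists (vq p G`_i1 - vq p G`_i0).
    by move: Geq; rewrite /wt mulrBr mulrBl; lia.
  move/dvdzP => [c Ec].
  have [c0|c0] := eqVneq c 0; first by move: Ec; rewrite c0 mul0r; lia.
  have : (d <= `|(c * d%:Z)%R|)%N by rewrite abszM leq_pmull // absz_gt0.
  by rewrite -Ec; lia.
have minF : wt p d sigma%:Z (nform n a e) j1 <= wt p d sigma%:Z G i0 + wt p d sigma%:Z H h0.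
  by rewrite -E0 /wt !vq_nform // !mulrBr; have := line _ nz0; lia.
have eqF : wt p d sigma%:Z (nform n a e) j2 = wt p d sigma%:Z (nform n a e) j1.
  by rewrite /wt !vq_nform // !mulrBr; lia.
have h1le := split_coefH_le hh1.
(* Below [i0 + h0] every pair of indices has a member strictly to the left of its vertex, so the
   minimal weight, which [j1] attains, is out of reach there. *)
have firstle : (i0 + h0 <= j1)%N.
  rewrite leqNgt; apply/negP => lt.
  have : wt p d sigma%:Z G i0 + wt p d sigma%:Z H h0 + 1 <= wt p d sigma%:Z (nform n a e) j1.
    apply: Fge => // i h ih gi hh.
    have := gm _ gi; have := hm _ hh.
    case: (ltnP i i0) => ii; first by have := gs _ ii gi; clear; lia.
    have hlt : (h < h0)%N by move: ih ii lt; clear; lia.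
    by have := hs _ hlt hh; clear; lia.
  by move: minF; lia.
have lastle : (j2 <= i1 + h1)%N.
  rewrite leqNgt; apply/negP => lt.
  have : wt p d sigma%:Z G i0 + wt p d sigma%:Z H h0 + 1 <= wt p d sigma%:Z (nform n a e) j2.
    apply: Fge => // i h ih gi hh.
    rewrite Geq Heq.
    have := gm1 _ gi; have := hm1 _ hh.
    case: (ltnP i1 i) => ii; first by have := gs1 _ ii gi; clear; lia.
    have hlt : (h1 < h)%N by move: ih ii lt; clear; lia.
    by have := hs1 _ hlt hh; clear; lia.
  by move: minF eqF; lia.
lia.
Qed.
End Splits.

(** * Legendre's formula and lines below a Newton polygon *)

Lemma logn_fact_div p m : prime p -> (logn p m`! = m %/ p + logn p (m %/ p)`!)%N.
Proof.
move=> pp; have p1 := prime_gt1 pp.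
case: (posnP m) => [->|m0]; first by rewrite div0n.
rewrite !logn_fact // big_nat_recl //= expn1; congr addn.
have qm : (m %/ p <= m.-1)%N by have := ltn_Pdiv p1 m0; lia.
rewrite [RHS](_ : _ = \sum_(1 <= i < m) (m %/ p) %/ p ^ i)%N; last first.
  rewrite [RHS](@big_cat_nat _ _ _ (m %/ p).+1) //=; last by lia.
  rewrite [X in (_ = _ + X)%N]big1_seq ?addn0 // => i /andP[_].
  rewrite mem_index_iota => /andP[h _].
  by rewrite divn_small //; apply: leq_trans h _; apply: ltnW; apply: ltn_expl.
by rewrite !big_add1; apply: eq_big_nat => i _; rewrite -divnMA -expnS.
Qed.

(** By Legendre the left side is [m] minus the digit sum of [m] in base [p], and the digit sum is
    positive. *)
Lemma logn_fact_lt p m : prime p -> (0 < m)%N -> (p.-1 * logn p m`! < m)%N.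
Proof.
move=> pp; have p1 := prime_gt1 pp.
elim/ltn_ind: m => m IH m0; rewrite logn_fact_div //.
have := leq_divM m p; set q := (m %/ p)%N => qm.
case: (posnP q) => [->|q0]; first by rewrite /= logn1 muln0.
have /IH/(_ q0) : (q < m)%N by rewrite ltn_Pdiv.
by nia.
Qed.

(** Adds up the valuations without ever forming the factorial, which as a unary number would be out
    of reach of the table checks. *)
Fixpoint lfact (p m : nat) : nat :=
  if m is m'.+1 then (logn p m + lfact p m')%N else 0%N.

Lemma lfactE p m : lfact p m = logn p m`!.
Proof.
by elim: m => [|m IH]; rewrite ?logn1 //= IH factS lognM ?fact_gt0.
Qed.

(** Indices below [J] are checked one by one. From [J] on the bound of [logn_fact_lt] takes over: it
    grows with slope [1 / (p - 1)], at most [sigma / d], and is below the line at [j = J]. *)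
Definition linecheck (p a d beta sigma J : nat) : bool :=
  [&& all (fun j => d * lfact p (j + a) <= d * lfact p a + beta + sigma * j)%N (iota 0 J),
      (d <= p.-1 * sigma)%N &
      (d * (J + a).-1 <= p.-1 * (d * lfact p a + beta + sigma * J))%N].

Lemma linecheckP p a d beta sigma J : prime p -> linecheck p a d beta sigma J ->
  forall j, (d * logn p (j + a)`! <= d * logn p a`! + beta + sigma * j)%N.
Proof.
move=> pp /and3P[/allP h1 h2 h3] j.
case: (ltnP j J) => jJ.
  by have := h1 j; rewrite mem_iota leq0n add0n jJ !lfactE => /(_ isT).
case: (posnP (j + a)) => ja0; first by rewrite ja0 fact0 logn1 muln0.
have h4 := logn_fact_lt pp ja0; have p1 := prime_gt1 pp.
rewrite !lfactE in h3.
rewrite -(leq_pmul2l (_ : 0 < p.-1)%N); last lia.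
have [r Er] : exists r, j = (r + J)%N by exists (j - J)%N; lia.
move: h4 h3; rewrite Er; move: (logn p (r + J + a)`!) (logn p a`!) (p.-1) h2 => X A q h2 h4 h3.
have : (d * (q * X) <= d * (r + (J + a).-1))%N by rewrite leq_mul2l; apply/orP; right; lia.
have : (d * r <= q * sigma * r)%N by rewrite leq_mul2r h2 orbT.
by lia.
Qed.

Section SplitPrimes.
Variables (n a k : nat) (e : nat -> rat) (G H : {poly rat}).
Hypothesis S : splits n a k e G H.

(** At index [k] the line is above -1, so [G_k] is integral at [p] by [split_hull], against
    [split_top]. *)
Lemma split_prime_line p d beta sigma l : prime p -> (0 < k)%N -> (l < k)%N ->
  (p %| n + a - l)%N -> (0 < d)%N -> (beta + sigma * k < d)%N ->
  ~ (forall j, (j <= n)%N ->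
     (d * logn p (j + a)`! <= d * logn p a`! + beta + sigma * j)%N).
Proof.
move=> pp k0 lk pl d0 lt line.
have kn : (k <= n)%N by case: S => [[]].
have := split_hull S pp d0 line (split_lead_neq0 S).
have : vq p G`_k < 0.
  apply: (@split_top _ _ _ _ _ _ S p (n - l)%N) => //; first lia.
  by rewrite (_ : n - l + a = n + a - l)%N //; lia.
move: (vq p G`_k) => v v0 h.
have v1 : v <= -1 by lia.
have : d%:Z * v <= d%:Z * -1 by rewrite ler_wpM2l.
by rewrite mulrN1; lia.
Qed.

(** For [p > k + a] Legendre's bound [(j + a - 1) / (p - 1)] stays below 1 at [j = k]. *)
Lemma split_prime_le p l : prime p -> (0 < k)%N -> (l < k)%N ->
  (p %| n + a - l)%N -> (p <= k + a)%N.
Proof.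
move=> pp k0 lk pl; rewrite leqNgt; apply/negP => pk.
have p1 := prime_gt1 pp.
(* For [a = 0] the intercept [a - 1] would be negative. A line through the origin of slope
   [n / ((p - 1) * (n + 1))] is used instead; it suffices because [j - 1 <= j * n / (n + 1)] for
   [j <= n]. *)
case: (posnP a) => [a0|a0].
  apply: (@split_prime_line p (p.-1 * n.+1) 0 n l) => //; first by rewrite muln_gt0; lia.
    by rewrite add0n; nia.
  move=> j jn; rewrite a0 !addn0 fact0 logn1 muln0 add0n.
  case: (posnP j) => [->|j0]; first by rewrite fact0 logn1 muln0.
  have := logn_fact_lt pp j0; set L := logn _ _ => h.
  have : (p.-1 * L * n.+1 <= j.-1 * n.+1)%N by rewrite leq_mul2r; lia.
  nia.
apply: (@split_prime_line p p.-1 a.-1 1 l) => //; [lia|lia|].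
move=> j jn.
have ja0 : (0 < j + a)%N by lia.
have := logn_fact_lt pp ja0; rewrite mul1n; move: (p.-1 * logn p a`!)%N => M; lia.
Qed.

(* The slope [100 / (100 k + 1) < 1 / k] is too small for [p] to occur in the leading coefficient of a
   factor of degree [k]. *)
Definition excluded (p : nat) := linecheck p a (100 * k + 1) 0 100 60.

Lemma split_excluded p l : prime p -> (0 < k)%N -> (l < k)%N ->
  (p %| n + a - l)%N -> ~~ excluded p.
Proof.
move=> pp k0 lk pl; apply/negP => /(linecheckP pp) h.
apply: (@split_prime_line p (100 * k + 1) 0 100 l) => //; lia.
Qed.
End SplitPrimes.

Lemma dvdn_of_logn m n : (0 < m)%N -> (0 < n)%N ->
  (forall p, prime p -> (logn p m <= logn p n)%N) -> (m %| n)%N.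
Proof.
move=> m0 n0 h; apply/dvdn_partP => // p; rewrite mem_primes => /and3P[pp _ _].
by rewrite p_part pfactor_dvdn // h.
Qed.

Lemma int_of_vq (x : rat) (C : nat) : (0 < C)%N ->
  (forall p, prime p -> x != 0 -> - (logn p C)%:Z <= vq p x) ->
  exists z : int, C%:R * x = z%:~R.
Proof.
move=> C0 h.
have [->|x0] := eqVneq x 0; first by exists 0; rewrite mulr0.
have d0 : (0 < `|denq x|)%N by rewrite absz_gt0 denq_neq0.
have /dvdnP [q E] : (`|denq x| %| C)%N.
  apply: dvdn_of_logn => // p pp.
  case: (posnP (logn p `|denq x|)) => [->//|l0].
  have pd : (p %| `|denq x|)%N by move: l0; rewrite logn_gt0 mem_primes => /and3P[].
  have := h p pp x0; rewrite vq.unlock.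
  have -> : logn p `|numq x| = 0%N.
    apply: logn_coprime; have := coprime_num_den x.
    by rewrite coprime_sym => /(coprime_dvdl pd).
  lia.
exists (q%:Z * numq x); rewrite E natrM intrM -mulrA; congr (_ * _).
by rewrite numqE mulrC -absz_denq.
Qed.

Section SplitDenom.
Variables (n a k : nat) (e : nat -> rat) (G H : {poly rat}).
Hypothesis S : splits n a k e G H.

Lemma split_big_prime p i : (0 < a)%N -> prime p -> (k + a < p)%N -> G`_i != 0 ->
  0 <= vq p G`_i.
Proof.
move=> a0 pp pk Gi; have p1 := prime_gt1 pp.
have ik := split_coefG_le S Gi.
have p10 : (0 < p.-1)%N by lia.
have line j : (j <= n)%N ->
    (p.-1 * logn p (j + a)`! <= p.-1 * logn p a`! + a.-1 + 1 * j)%N.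
  have ja0 : (0 < j + a)%N by lia.
  have := logn_fact_lt pp ja0; rewrite mul1n; move: (p.-1 * logn p a`!)%N => M; lia.
have := split_hull S pp p10 line Gi.
move: (vq p G`_i) => v h; rewrite leNgt; apply/negP => v0.
have v1 : v <= -1 by lia.
have : (p.-1)%:Z * v <= (p.-1)%:Z * -1 by rewrite ler_wpM2l.
by rewrite mulrN1; lia.
Qed.

(** The leading coefficient has the least valuation at every prime. For [i = 0] this says that [G_k]
    is the inverse of an integer. *)
Lemma split_coprime_lead_int i : exists z : int, G`_i / G`_k = z%:~R.
Proof.
have Gk := split_lead_neq0 S.
have [|z Ez] := @int_of_vq (G`_i / G`_k) 1 isT; last by exists z; rewrite -Ez mul1r.
move=> p pp; rewrite mulf_eq0 invr_eq0 negb_or => /andP[Gi _].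
rewrite logn1 vqM ?invr_eq0 // vqV //.
by have := split_lead_min S pp Gi; lia.
Qed.
End SplitDenom.

(* A row [(p, (d, b, s, J))] certifies that [logn p ((j + a)`! / a`!) <= (b + s * j) / d] for
   all [j]; this bounds the power of [p] in the denominator of the [i]-th coefficient. *)
Definition tabcheck (k a i C : nat) (tab : seq (nat * (nat * nat * nat * nat))) : bool :=
  (0 < C)%N && all (fun p => prime p ==> has (fun t => let: (q, (d, b, s, J)) := t in
     [&& q == p, (0 < d)%N, linecheck p a d b s J & (b + s * i < d * (logn p C).+1)%N]) tab)
   (iota 0 (k + a).+1).

Lemma split_denom n a k e G H i C tab : splits n a k e G H -> (0 < a)%N ->
  tabcheck k a i C tab -> exists z : int, C%:R * G`_i = z%:~R.
Proof.
move=> S a0 /andP[C0 /allP chk]; apply: int_of_vq => // p pp Gi.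
case: (leqP p (k + a)) => pk; last first.
  by have := split_big_prime S a0 pp pk Gi; lia.
have := chk p; rewrite mem_iota leq0n add0n ltnS pk pp => /(_ isT).
move=> /hasP [[q [[[d b] s] J]] _ /and4P[_ d0 lc lt]].
have := @split_hull _ _ _ _ _ _ S p d b s pp d0 (fun j _ => linecheckP pp lc j) i Gi.
move: (vq p G`_i) lt => v lt h; rewrite leNgt; apply/negP => v0.
have v1 : v <= - (logn p C).+1%:Z by lia.
have : d%:Z * v <= d%:Z * - (logn p C).+1%:Z by rewrite ler_wpM2l.
by rewrite mulrN; lia.
Qed.

(** * Bounds on the coefficients of a factor *)

(* All roots of the scaled polynomial have absolute value at least [rho a]. *)
Definition rho (a : nat) : rat := ((a.+1 * a.+2)%:R / (2 * a + 3)%:R).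

Lemma rho_gt0 a : 0 < rho a.
Proof. by rewrite divr_gt0 ?ltr0n // addn_gt0 orbT. Qed.

Lemma fact_ratio_le (R : numFieldType) a j : (a`!%:R / (j.+1 + a)`!%:R : R) <=
  a.+1%:R^-1 * a.+2%:R^-1 ^+ j.
Proof.
have nz (m : nat) : m`!%:R != 0 :> R by rewrite pnatr_eq0 -lt0n fact_gt0.
have step m : m`!%:R / m.+1`!%:R = m.+1%:R^-1 :> R.
  by rewrite factS natrM invfM mulrCA divff // mulr1.
elim: j => [|j IH]; first by rewrite expr0 mulr1 add1n step.
have -> : a`!%:R / (j.+2 + a)`!%:R = (a`!%:R / (j.+1 + a)`!%:R) * (j.+2 + a)%:R^-1 :> R.
  by rewrite -(step (j.+1 + a)%N) mulrA divfK.
rewrite exprSr mulrA; apply: ler_pM => //.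
- by rewrite divr_ge0 ?ler0n.
- by rewrite invr_ge0 ler0n.
- by rewrite lef_pV2 ?posrE ?ltr0n // ler_nat; lia.
Qed.

Lemma size_nform n a (e : nat -> rat) : (forall j, `|e j| = 1) ->
  size (nform n a e) = n.+1.
Proof.
move=> he; rewrite size_poly_eq //.
by have := coef_nform_neq0 n a n he; rewrite coef_nform leqnn.
Qed.

(** For [|x| = r] the nonconstant terms are dominated by the geometric series with first term
    [u = r / (a + 1)] and ratio [v = r / (a + 2)]. At [r = rho a] one has [u + v = 1]; below it the
    series sums to less than 1 and cannot cancel the constant term 1. *)
Lemma nform_root_ge n a (e : nat -> rat) (x : algC) :
  (forall j, `|e j| = 1) -> e 0%N = 1 ->
  root (map_poly ratr (nform n a e)) x -> ratr (rho a) <= `|x|.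
Proof.
move=> he e0 /rootP.
rewrite horner_coef size_map_poly size_nform // => rx.
rewrite real_leNgt ?realE ?normr_ge0 ?ler0q ?(ltW (rho_gt0 a)) //.
apply/negP; move Er: `|x| => r; rewrite /rho fmorph_div /= !ratr_nat => xlt.
have r0 : 0 <= r by rewrite -Er normr_ge0.
pose t (j : nat) : algC := a`!%:R / (j + a)`!%:R * r ^+ j.
pose u := r / a.+1%:R; pose v := r / a.+2%:R.
have u0 : 0 <= u by rewrite divr_ge0 ?ler0n.
have v0 : 0 <= v by rewrite divr_ge0 ?ler0n.
have uv : u < 1 - v.
  rewrite ltrBrDr -mulrDr -lter_pdivlMr; last first.
    by rewrite addr_gt0 // invr_gt0 ltr0n.
  apply: lt_le_trans xlt _; rewrite le_eqVlt; apply/orP; left.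
  have n1 : a.+1%:R != 0 :> algC by rewrite pnatr_eq0.
  have n2 : a.+2%:R != 0 :> algC by rewrite pnatr_eq0.
  have n3 : (2 * a + 3)%:R != 0 :> algC by rewrite pnatr_eq0 addn_eq0 andbF.
  have -> : (2 * a + 3)%:R = a.+1%:R + a.+2%:R :> algC.
    by rewrite -natrD; congr _%:R; lia.
  have -> : a.+1%:R^-1 + a.+2%:R^-1 = (a.+1%:R + a.+2%:R) / (a.+1%:R * a.+2%:R) :> algC.
    by rewrite mulrDl invfM mulrA divff // mul1r mulrCA divff // mulr1 addrC.
  by rewrite natrM mul1r invf_div.
have v1 : 0 <= 1 - v by rewrite (le_trans u0) // ltW.
have bound m : (1 - v) * \sum_(1 <= j < m.+1) t j <= u * (1 - v ^+ m).
  elim: m => [|m IH]; first by rewrite big_geq // mulr0 expr0 subrr mulr0.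
  rewrite big_nat_recr //= mulrDr.
  have -> : u * (1 - v ^+ m.+1) = u * (1 - v ^+ m) + (1 - v) * (u * v ^+ m).
    by rewrite exprS; ring.
  apply: lerD => //; apply: ler_wpM2l => //.
  have -> : u * v ^+ m = (a.+1%:R^-1 * a.+2%:R^-1 ^+ m) * r ^+ m.+1.
    by rewrite /u /v exprMn exprS; ring.
  by rewrite /t ler_wpM2r ?exprn_ge0 // fact_ratio_le.
have sumlt m : \sum_(1 <= j < m.+1) t j < 1.
  have v2 : 0 < 1 - v by apply: le_lt_trans uv.
  rewrite -(ltr_pM2l v2) mulr1; apply: le_lt_trans (bound m) (le_lt_trans _ uv).
  by rewrite ler_piMr // gerBl exprn_ge0.
have := sumlt n; apply/negP; rewrite -real_leNgt ?real1 //; last first.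
  by apply: rpred_sum => j _; rewrite realM ?realX ?ger0_real // divr_ge0 ?ler0n.
move: rx; rewrite big_ord_recl /= expr0 mulr1 coef_map coef_nform leq0n e0 mul1r add0n.
rewrite divff ?pnatr_eq0 -?lt0n ?fact_gt0 //= rmorph1 => /eqP.
rewrite addr_eq0 => /eqP E.
rewrite -[X in X <= _](normr1 algC) E normrN; apply: le_trans (ler_norm_sum _ _ _) _.
rewrite big_add1 big_mkord; apply: ler_sum => i _.
rewrite normrM normrX Er coef_map coef_nform /= ltn_ord -ratr_norm normrM he mul1r.
by rewrite ger0_norm ?divr_ge0 ?ler0n // fmorph_div /= !ratr_nat.
Qed.

(** Reversing [G] gives a polynomial that is monic, because [G_0 = 1], and whose roots are the
    inverses of those of [G]. Up to sign the coefficients of [G] are thus elementary symmetric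
    functions of numbers bounded by [1 / rho a]. *)
Lemma split_recip_roots n a k e G H : splits n a k e G H ->
  exists ys : seq algC, [/\ size ys = k,
    forall y, y \in ys -> `|y| <= ratr (rho a)^-1 &
    \poly_(i < k.+1) (ratr G`_(k - i) : algC) = \prod_(y <- ys) ('X - y%:P)].
Proof.
move=> S; have [[he e0 kn] FE [G0 H0] sG sH] := S.
pose R := \poly_(i < k.+1) (ratr G`_(k - i) : algC).
have Rk : R`_k = 1 by rewrite coef_poly ltnSn subnn G0 rmorph1.
have sR : size R = k.+1.
  by rewrite size_poly_eq // subnn G0 rmorph1 oner_eq0.
have lR : lead_coef R = 1 by rewrite lead_coefE sR.
have [ys E] := closed_field_poly_normal R.
rewrite lR scale1r in E.
exists ys; split=> //.
  by have := size_prod_XsubC ys id; rewrite -E sR => -[].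
move=> y yin.
have /rootP Ry : root R y by rewrite E root_prod_XsubC.
have [->|y0] := eqVneq y 0.
  by rewrite normr0 ler0q invr_ge0 ltW // rho_gt0.
have rG : (map_poly ratr G).[y^-1] = 0.
  apply: (@mulfI _ (y ^+ k)); first by rewrite expf_neq0.
  rewrite mulr0 -[RHS]Ry !horner_coef size_map_poly sG sR mulr_sumr.
  rewrite (reindex_inj rev_ord_inj) /=; apply: eq_bigr => i _.
  have ik : (i <= k)%N by rewrite -ltnS.
  rewrite coef_map coef_poly ltnS ik subSS /= mulrC -mulrA; congr (_ * _).
  rewrite -[X in _ * y ^+ X](subnKC ik) exprD exprVn mulrC -mulrA divff ?mulr1 //.
  by rewrite expf_neq0.
have : root (map_poly ratr (nform n a e)) y^-1.
  by rewrite FE rmorphM /= rootM; apply/orP; left; apply/rootP.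
move=> /(nform_root_ge he e0); rewrite normfV fmorphV => h.
rewrite -[X in X <= _]invrK lef_pV2 //.
  by rewrite posrE invr_gt0 normr_gt0.
by rewrite posrE ltr0q rho_gt0.
Qed.

Lemma split_coef_recip n a k e G H i (ys : seq algC) : splits n a k e G H ->
  \poly_(i < k.+1) (ratr G`_(k - i) : algC) = \prod_(y <- ys) ('X - y%:P) ->
  (i <= k)%N -> ratr G`_(k - i) = (\prod_(y <- ys) ('X - y%:P))`_i.
Proof. by move=> S <- ik; rewrite coef_poly ltnS ik. Qed.

(** With [r = 1 / rho a] and inverse roots [y1], [y2], this is [(r - |y1|) * (r - |y2|) >= 0]
    expanded and divided by [r]; it sharpens the obvious bound [2 * r]. *)
Lemma split2_bound n a e G H : splits n a 2 e G H ->
  `|G`_1| <= (rho a)^-1 + rho a * `|G`_2|.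
Proof.
move=> S; have r0 := rho_gt0 a.
have [ys [sy hy E]] := split_recip_roots S.
case: ys sy hy E => [|y1 [|y2 [|y3 ys]]] //= _ hy E.
have h1 := @split_coef_recip _ _ _ _ _ _ 1 _ S E isT.
have h2 := @split_coef_recip _ _ _ _ _ _ 0 _ S E isT.
have b1 : `|y1| <= ratr (rho a)^-1 by rewrite hy // !inE eqxx.
have b2 : `|y2| <= ratr (rho a)^-1 by rewrite hy // !inE eqxx orbT.
have PE : \prod_(y <- [:: y1; y2]) ('X - y%:P) = 'X^2 - (y1 + y2) *: 'X + (y1 * y2)%:P.
  by rewrite !big_cons big_nil mulr1 -mul_polyC polyCD polyCM; ring.
move: h1 h2; rewrite PE /= !coefE /= !(mulr1, mulr0, subr0, oppr0, addr0, add0r, sub0r) => h1 h2.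
rewrite -(ler_rat algC) rmorphD rmorphM /= !ratr_norm h1 h2 normrN normrM.
apply: le_trans (ler_normD _ _) _.
set r : algC := ratr (rho a)^-1 in b1 b2 *.
have rr : ratr (rho a) = r^-1 by rewrite /r fmorphV invrK.
have rp : 0 < r by rewrite /r ltr0q invr_gt0.
rewrite rr -(ler_pM2l rp) [X in _ <= X](_ : _ = r * r + `|y1| * `|y2|); last first.
  by rewrite mulrDr [r * (r^-1 * _)]mulrA divff ?gt_eqF // mul1r.
rewrite -subr_ge0.
have -> : r * r + `|y1| * `|y2| - r * (`|y1| + `|y2|) = (r - `|y1|) * (r - `|y2|) by ring.
by rewrite mulr_ge0 // subr_ge0.
Qed.

Lemma split3_bound n a e G H : splits n a 3 e G H ->
  [/\ `|G`_1| <= 3%:R * (rho a)^-1, `|G`_2| <= 3%:R * (rho a)^-1 ^+ 2 &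
      `|G`_3| <= (rho a)^-1 ^+ 3].
Proof.
move=> S; have r0 := rho_gt0 a.
have [ys [sy hy E]] := split_recip_roots S.
case: ys sy hy E => [|y1 [|y2 [|y3 [|y4 ys]]]] //= _ hy E.
have h1 := @split_coef_recip _ _ _ _ _ _ 2 _ S E isT.
have h2 := @split_coef_recip _ _ _ _ _ _ 1 _ S E isT.
have h3 := @split_coef_recip _ _ _ _ _ _ 0 _ S E isT.
have b1 : `|y1| <= ratr (rho a)^-1 by rewrite hy // !inE eqxx.
have b2 : `|y2| <= ratr (rho a)^-1 by rewrite hy // !inE eqxx orbT.
have b3 : `|y3| <= ratr (rho a)^-1 by rewrite hy // !inE eqxx !orbT.
have PE : \prod_(y <- [:: y1; y2; y3]) ('X - y%:P) = 'X^3 - (y1 + y2 + y3) *: 'X^2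
   + (y1 * y2 + y1 * y3 + y2 * y3) *: 'X - (y1 * y2 * y3)%:P.
  by rewrite !big_cons big_nil mulr1 -!mul_polyC !polyCD !polyCM; ring.
move: h1 h2 h3; rewrite PE /= !coefE /= !(mulr1, mulr0, subr0, oppr0, addr0, add0r, sub0r) => h1 h2 h3.
set r : algC := ratr (rho a)^-1 in b1 b2 b3 *.
have rp : 0 <= r by rewrite /r ler0q invr_ge0 ltW.
have n3 (x y z : algC) c : `|x| <= c -> `|y| <= c -> `|z| <= c -> `|x + y + z| <= 3%:R * c.
  move=> hx hz hz'; apply: le_trans (ler_normD _ _) _.
  have -> : 3%:R * c = c + c + c by ring.
  by rewrite lerD // (le_trans (ler_normD _ _)) // lerD.
have m2 (x y : algC) : `|x| <= r -> `|y| <= r -> `|x * y| <= r ^+ 2.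
  by move=> hx hyy; rewrite normrM expr2 ler_pM.
split; rewrite -(ler_rat algC) ratr_norm.
- by rewrite h1 normrN rmorphM /= ratr_nat; apply: n3.
- by rewrite h2 rmorphM rmorphXn /= ratr_nat; apply: n3; apply: m2.
- by rewrite h3 normrN normrM rmorphXn exprSr; apply: ler_pM => //; apply: m2.
Qed.

(** * Quadratic factors *)

Definition zq (z : Z) : rat := (int_of_Z z)%:~R.

Lemma zqD x y : zq (Z.add x y) = zq x + zq y.
Proof. by rewrite /zq -intrD -(rmorphD int_of_Z). Qed.
Lemma zqM x y : zq (Z.mul x y) = zq x * zq y.
Proof. by rewrite /zq -intrM -(rmorphM int_of_Z). Qed.
Lemma zqN x : zq (Z.opp x) = - zq x.
Proof. by rewrite /zq -intrN -(rmorphN int_of_Z). Qed.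
Lemma zqB x y : zq (Z.sub x y) = zq x - zq y.
Proof. by rewrite -zqN -zqD; congr zq; lia. Qed.
Lemma zq_nat n : zq (Z.of_nat n) = n%:R.
Proof. by rewrite /zq (_ : int_of_Z (Z.of_nat n) = n%:Z) //; lia. Qed.
Lemma zq_le x y : (zq x <= zq y) = Z.leb x y.
Proof. by rewrite /zq ler_int; lia. Qed.
Lemma zq_eq x y : (zq x == zq y) = Z.eqb x y.
Proof. by rewrite /zq eqr_int; lia. Qed.
Lemma zq_abs x : zq (Z.abs x) = `|zq x|.
Proof. by rewrite /zq -intr_norm; congr (_%:~R); lia. Qed.
Lemma zq_int z : zq (Z_of_int z) = z%:~R.
Proof. by rewrite /zq Z_of_intK. Qed.

HB.lock Definition phi (a j : nat) : rat := a`!%:R / (j + a)`!%:R.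

Lemma phi_gt0 a j : 0 < phi a j.
Proof. by rewrite phi.unlock divr_gt0 ?ltr0n ?fact_gt0. Qed.

Lemma phiS a j : phi a j = (j.+1 + a)%:R * phi a j.+1.
Proof.
rewrite phi.unlock addSn factS natrM invfM [RHS]mulrCA [X in _ = _ * X]mulrA.
by rewrite divff ?mul1r // pnatr_eq0.
Qed.

Lemma phi0 a : phi a 0 = 1.
Proof. by rewrite phi.unlock divff // pnatr_eq0 -lt0n fact_gt0. Qed.

Lemma split_coefF n a k e G H j : splits n a k e G H -> (j <= n)%N ->
  \sum_(i < j.+1) G`_i * H`_(j - i) = e j * phi a j.
Proof. by case=> _ FE _ _ _ jn; rewrite -coefM -FE coef_nform jn phi.unlock. Qed.

Lemma split_H_eq0 n a k e G H j : splits n a k e G H -> (n - k < j)%N -> H`_j = 0.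
Proof. by case=> _ _ _ _ sH jn; rewrite nth_default // sH. Qed.

Lemma sum_coef_trunc k (G H : {poly rat}) j : size G = k.+1 -> (k <= j)%N ->
  \sum_(i < j.+1) G`_i * H`_(j - i) = \sum_(i < k.+1) G`_i * H`_(j - i).
Proof.
move=> sG kj; rewrite -!(big_mkord predT (fun i => G`_i * H`_(j - i))).
rewrite (@big_cat_nat _ _ _ k.+1) //=.
rewrite [X in _ + X]big_nat_cond [X in _ + X]big1 ?addr0 // => i /andP[/andP[ki _] _].
by rewrite nth_default ?mul0r // sG.
Qed.

Definition cong (l x y : Z) : Prop := exists k, x = Z.add y (Z.mul k l).

Lemma cong_refl l x : cong l x x.
Proof. by exists Z0; lia. Qed.
Lemma cong_add l x y x' y' : cong l x x' -> cong l y y' -> cong l (Z.add x y) (Z.add x' y').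
Proof. by move=> [k ->] [k' ->]; exists (Z.add k k'); lia. Qed.
Lemma cong_sub l x y x' y' : cong l x x' -> cong l y y' -> cong l (Z.sub x y) (Z.sub x' y').
Proof. by move=> [k ->] [k' ->]; exists (Z.sub k k'); lia. Qed.
Lemma cong_mul l x y x' y' : cong l x x' -> cong l y y' -> cong l (Z.mul x y) (Z.mul x' y').
Proof.
by move=> [k ->] [k' ->]; exists (Z.add (Z.mul k y') (Z.add (Z.mul x' k') (Z.mul (Z.mul k k') l))); lia.
Qed.
Lemma cong_mod l x x' : cong l x x' -> cong l (Z.modulo x l) x'.
Proof.
move=> [k E]; case: (Z.eq_dec l Z0) => [l0|l0].
  by exists k; rewrite -E l0 Zmod_0_r.
by exists (Z.sub k (Z.div x l)); rewrite Z.mod_eq // E; ring.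
Qed.

Fixpoint Zrange (lo : Z) (len : nat) : seq Z :=
  if len is f.+1 then lo :: Zrange (Z.succ lo) f else [::].

Lemma Zrange_mem lo hi z : Z.leb lo z -> Z.leb z hi ->
  z \in Zrange lo (Z.to_nat (Z.sub (Z.succ hi) lo)).
Proof.
move nE : (Z.to_nat _) => n; elim: n lo nE => [|n IH] lo nE h1 h2; first by lia.
rewrite /= in_cons; case: (Z.eq_dec z lo) => [->|zlo]; first by rewrite eqxx.
by rewrite (IH (Z.succ lo)) ?orbT //; lia.
Qed.

Definition Zsym (B : Z) : seq Z := Zrange (Z.opp B) (Z.to_nat (Z.sub (Z.succ B) (Z.opp B))).

Lemma Zsym_mem B z : Z.leb (Z.abs z) B -> z \in Zsym B.
Proof. by move=> h; apply: Zrange_mem; lia. Qed.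

Section Quadratic.
Variables (n a : nat) (e : nat -> rat) (G H : {poly rat}) (m c s : rat).
Hypothesis S : splits n a 2 e G H.
Hypothesis es : forall j, (0 < j < n)%N -> e j = s.
Hypothesis m0 : m != 0.
Hypothesis G1 : G`_1 = c / m.
Hypothesis G2 : G`_2 = m^-1.

Let G0 : G`_0 = 1. Proof. by case: S => _ _ []. Qed.
Let H0 : H`_0 = 1. Proof. by case: S => _ _ []. Qed.
Let sG : size G = 3%N. Proof. by case: S. Qed.

Lemma quad_rec j : (j.+2 <= n)%N ->
  e j.+2 * phi a j.+2 = H`_j.+2 + c / m * H`_j.+1 + m^-1 * H`_j.
Proof.
move=> jn; rewrite -(split_coefF S) // (sum_coef_trunc _ sG) //.
by rewrite !big_ord_recl big_ord0 /= /bump /= !subSS !subn0 G0 G1 G2 mul1r addr0 addrA.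
Qed.

Lemma quad_rec1 : (1 <= n)%N -> e 1%N * phi a 1 = H`_1 + c / m.
Proof.
move=> n1; rewrite -(split_coefF S) // !big_ord_recl big_ord0 /= /bump /=.
by rewrite G0 G1 H0 mul1r mulr1 addr0.
Qed.

(** The normalisation clears all denominators: for integral [m], [c], [s] these numbers are
    integers, start from 1 and obey the integral recurrence of [XqSS]. *)
Definition Xq (j : nat) : rat := H`_j * m ^+ j / phi a j.

Lemma Xq0 : Xq 0 = 1.
Proof. by rewrite /Xq H0 phi0 expr0; apply/eqP. Qed.

Lemma Xq1 : (1 < n)%N -> Xq 1 = s * m - c * (1 + a)%:R.
Proof.
move=> n1; have := quad_rec1 (ltnW n1); rewrite es // => E.
have p1 := gt_eqF (phi_gt0 a 1).
have := phiS a 0; rewrite phi0 => E1.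
have -> : Xq 1 = (H`_1 + c / m) * m / phi a 1 - c / phi a 1.
  by rewrite /Xq expr1 mulrDl divfK // mulrDl addrK.
rewrite -E mulrAC mulfK ?p1 //; congr (_ - _ * _).
by apply: (@mulIf _ (phi a 1)); rewrite ?p1 // mulVf ?p1.
Qed.

Lemma XqSS j : (j.+2 < n)%N -> Xq j.+2 =
  s * m ^+ j.+2 - c * (j.+2 + a)%:R * Xq j.+1 - m * (j.+2 + a)%:R * (j.+1 + a)%:R * Xq j.
Proof.
move=> jn; have := quad_rec (ltnW jn); rewrite es // => E.
have -> : Xq j = H`_j * m ^+ j / ((j.+1 + a)%:R * ((j.+2 + a)%:R * phi a j.+2)).
  by rewrite -!phiS.
have -> : Xq j.+1 = H`_j.+1 * m ^+ j.+1 / ((j.+2 + a)%:R * phi a j.+2).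
  by rewrite -!phiS.
have p2 : phi a j.+2 != 0 by rewrite gt_eqF ?phi_gt0.
have q1 : (j.+1 + a)%:R != 0 :> rat by rewrite pnatr_eq0.
have q2 : (j.+2 + a)%:R != 0 :> rat by rewrite pnatr_eq0.
have -> : s = (H`_j.+2 + c / m * H`_j.+1 + m^-1 * H`_j) / phi a j.+2 by rewrite -E mulfK.
rewrite /Xq !exprS; move: p2 q1 q2.
move: (phi a j.+2) (j.+1 + a)%:R (j.+2 + a)%:R => p A B p2 q1 q2; field.
by rewrite m0 p2 q1 q2.
Qed.

Lemma Xq_penult : (2 < n)%N -> Xq n.-1 = 0.
Proof. by move=> n2; rewrite /Xq (split_H_eq0 S) ?mul0r //; lia. Qed.

(** Comparison in degree [n], where only [H_(n-2) / m] survives. The sign [e n] is not tied to [s],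
    so only absolute values can be compared. *)
Lemma Xq_antepenult : (2 < n)%N ->
  `|m ^+ n| = `|m * (n + a)%:R * (n.-1 + a)%:R * Xq n.-2|.
Proof.
move=> n2; have [N nE] : exists N, n = N.+2 by exists n.-2; lia.
have := @quad_rec N; rewrite -nE leqnn => /(_ isT).
have nN : (n.-1 = N.+1)%N by rewrite nE.
have h1 : H`_n = 0 by apply: (split_H_eq0 S); lia.
have h2 : H`_N.+1 = 0 by apply: (split_H_eq0 S); lia.
rewrite h1 h2 mulr0 !add0r nN /= => E.
have he : `|e n| = 1 by case: S => [[]].
have p0 := gt_eqF (phi_gt0 a n).
have q1 : (N.+1 + a)%:R != 0 :> rat by rewrite pnatr_eq0.
have q2 : (n + a)%:R != 0 :> rat by rewrite pnatr_eq0 nE.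
rewrite /Xq (_ : H`_N = m * (e n * phi a n)); last by rewrite E mulrA divff ?mul1r.
rewrite (phiS a N) (phiS a N.+1) -nE.
have -> : m * (n + a)%:R * (N.+1 + a)%:R *
    (m * (e n * phi a n) * m ^+ N / ((N.+1 + a)%:R * ((n + a)%:R * phi a n))) =
    e n * m ^+ n.
  rewrite (_ : m ^+ n = m * (m * m ^+ N)); last by rewrite nE !exprS.
  move: p0 q1 q2.
  move: (phi a n) (N.+1 + a)%:R (n + a)%:R => p A B /negbT p0 q1 q2; field.
  by rewrite p0 q1 q2.
by rewrite [RHS]normrM he mul1r.
Qed.


(** One factor [m] is cancelled and the absolute value traded for a square, which gives an identity
    that can be reduced modulo a prime. *)
Lemma Xq_antepenult_sqr : (2 < n)%N ->
  (m ^+ n.-1) ^+ 2 = ((n + a)%:R * (n.-1 + a)%:R * Xq n.-2) ^+ 2.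
Proof.
move=> n2; rewrite -[LHS]real_normK ?num_real // -[RHS]real_normK ?num_real //.
congr (_ ^+ 2); apply: (@mulfI _ `|m|); first by rewrite normr_eq0.
have E : m * m ^+ n.-1 = m ^+ n by rewrite -exprS prednK //; apply: leq_trans n2.
rewrite -!normrM E ![m * _]mulrA.
exact: Xq_antepenult.
Qed.
End Quadratic.

(* [W2 j] holds the integers [X_j, X_{j-1}] of the recurrence. *)
Fixpoint W2 (a m c s : Z) (j : nat) : Z * Z :=
  if j is j'.+1 then
    let: (x1, x2) := W2 a m c s j' in
    let ja := Z.add (Z.of_nat j) a in
    (Z.sub (Z.sub (Z.mul s (Z.pow m (Z.of_nat j))) (Z.mul (Z.mul c ja) x1))
           (Z.mul (Z.mul (Z.mul m ja) (Z.pred ja)) x2), x1)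
  else (Zpos xH, Z0).

Lemma W2S1 a m c s j : (W2 a m c s j.+1).1 =
  Z.sub (Z.sub (Z.mul s (Z.pow m (Z.of_nat j.+1)))
               (Z.mul (Z.mul c (Z.add (Z.of_nat j.+1) a)) (W2 a m c s j).1))
     (Z.mul (Z.mul (Z.mul m (Z.add (Z.of_nat j.+1) a)) (Z.pred (Z.add (Z.of_nat j.+1) a)))
        (W2 a m c s j).2).
Proof. by rewrite [LHS]/=; case: (W2 a m c s j). Qed.

Lemma W2S2 a m c s j : (W2 a m c s j.+1).2 = (W2 a m c s j).1.
Proof. by rewrite [LHS]/=; case: (W2 a m c s j). Qed.

Lemma Zpow_succ m i : Z.pow m (Z.of_nat i.+1) = Z.mul m (Z.pow m (Z.of_nat i)).
Proof. by rewrite Nat2Z.inj_succ; apply: Z.pow_succ_r; apply: Zle_0_nat. Qed.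

Lemma zq_pow m j : zq (Z.pow m (Z.of_nat j)) = zq m ^+ j.
Proof.
elim: j => [//|j IH]; by rewrite exprS -IH -zqM Zpow_succ.
Qed.

Lemma W2_Xq n a e G H (m c s : Z) j : splits n a 2 e G H ->
  (forall j, (0 < j < n)%N -> e j = zq s) -> zq m != 0 ->
  G`_1 = zq c / zq m -> G`_2 = (zq m)^-1 -> (j < n)%N ->
  zq (W2 (Z.of_nat a) m c s j).1 = Xq a H (zq m) j /\
  zq (W2 (Z.of_nat a) m c s j).2 = (if j is i.+1 then Xq a H (zq m) i else 0).
Proof.
move=> S es m0 G1 G2; elim: j => [|j IH] jn; first by rewrite (Xq0 _ S).
have [h1 h2] := IH (ltnW jn); rewrite W2S1 W2S2; split=> //.
have jaE : Z.add (Z.of_nat j.+1) (Z.of_nat a) = Z.of_nat (j.+1 + a) by lia.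
have Ejap : zq (Z.pred (Z.of_nat (j.+1 + a))) = (j + a)%:R by rewrite -zq_nat; congr zq; lia.
rewrite jaE !zqB !zqM zq_pow zq_nat Ejap h1 h2.
case: j {IH h1 h2 jaE Ejap} jn => [|j] jn.
  by rewrite mulr0 subr0 expr1 (Xq0 _ S) mulr1 (Xq1 S es m0 G1) //; lia.
by rewrite (XqSS S es m0 G1 G2).
Qed.

Lemma W2_end n a e G H (m c s : Z) : splits n a 2 e G H ->
  (forall j, (0 < j < n)%N -> e j = zq s) -> zq m != 0 ->
  G`_1 = zq c / zq m -> G`_2 = (zq m)^-1 -> (2 < n)%N ->
  let: (x1, x2) := W2 (Z.of_nat a) m c s n.-1 in
  x1 = Z0 /\ Z.pow (Z.pow m (Z.of_nat n.-1)) 2 =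
    Z.pow (Z.mul (Z.mul (Z.of_nat (n + a)) (Z.of_nat (n.-1 + a))) x2) 2.
Proof.
move=> S es m0 G1 G2 n2; have n1 : (n.-1 < n)%N by lia.
have := W2_Xq S es m0 G1 G2 n1.
have := Xq_antepenult_sqr S m0 G1 G2 n2; have := Xq_penult S m0 n2.
case: (W2 _ _ _ _ _) => x1 x2; rewrite [(_, _).1]/= [(_, _).2]/= => -> h2 [/eqP].
rewrite -[0]/(zq Z0) zq_eq => /Z.eqb_eq -> E; split=> //.
apply/Z.eqb_eq; rewrite -zq_eq; apply/eqP.
rewrite (zq_pow _ 2) (zq_pow _ 2) zq_pow !zqM !zq_nat E h2.
by case: n n2 {n1 S es E h2 G1 G2} => [//|[//|n]].
Qed.

(** * Scanning the quadratic recurrence, exactly and modulo a prime *)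

Fixpoint scan2 (fuel : nat) (a l m c s j mj x1 x2 : Z) : bool :=
  if fuel is f.+1 then
    let mj' := Z.mul mj m in
    let ja := Z.add j a in
    if Z.leb l ja then true else
    let x := Z.sub (Z.sub (Z.mul s mj') (Z.mul (Z.mul c ja) x1))
                   (Z.mul (Z.mul (Z.mul m ja) (Z.pred ja)) x2) in
    if (if Z.ltb j 3 then true else
        if Z.eqb x 0 then
          ~~ Z.eqb (Z.mul mj' mj') (Z.pow (Z.mul (Z.mul (Z.succ ja) ja) x1) 2)
        else true)
    then scan2 f a l m c s (Z.succ j) mj' x x1 else false
  else false.

(** Here [j] stands for [n - 1], so the end conditions are [X_j = 0] and the identity of
    [Xq_antepenult_sqr]. The scan uses exact integers, covers the indices with [j + a < l] and
    returns [true] only on reaching [l]. *)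
Lemma scan2P f a l m c s i j :
  scan2 f a l m c s (Z.of_nat i.+1) (Z.pow m (Z.of_nat i)) (W2 a m c s i).1 (W2 a m c s i).2 ->
  (i < j)%N -> (2 < j)%N -> Z.lt (Z.add (Z.of_nat j) a) l ->
  (W2 a m c s j).1 = Z0 ->
  Z.pow (Z.pow m (Z.of_nat j)) 2 =
    Z.pow (Z.mul (Z.mul (Z.add (Z.of_nat j.+1) a) (Z.add (Z.of_nat j) a)) (W2 a m c s j).2) 2 ->
  False.
Proof.
elim: f i => [//|f IH] i; rewrite /scan2 -/scan2; cbv zeta.
case: (Z.leb_spec l (Z.add (Z.of_nat i.+1) a)) => h; first by move=> _ h1 _ h2; lia.
have mE : Z.mul (Z.pow m (Z.of_nat i)) m = Z.pow m (Z.of_nat i.+1).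
  by rewrite Zpow_succ; apply: Z.mul_comm.
rewrite mE -W2S1.
case: ifP => // cond hs ij j2 jl w1 w2.
have [jE|ji] := eqVneq j i.+1; last first.
  apply: (IH i.+1 _ _ j2 jl w1 w2); last by clear -ij ji; lia.
  by rewrite W2S2 [in X in scan2 _ _ _ _ _ _ X]Nat2Z.inj_succ.
move: cond; case: Z.ltb_spec => [h3|_]; first by clear -jE j2 h3; lia.
rewrite -jE w1 Z.eqb_refl => /negP; apply; apply/Z.eqb_eq.
rewrite -Z.pow_2_r w2 jE W2S2.
by congr (Z.pow (Z.mul (Z.mul _ _) _) 2); lia.
Qed.

(** The scan after a restart at an index [r] with [l %| r + a]. There [X_r] is [s * m ^ r] modulo
    [l]; the variables hold [X_(r+i) / m ^ r], and [r + i + a] reduces to [i]. This sequence does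
    not depend on [r], so one run over [i < l] serves every [n] beyond a restart. *)
Fixpoint scanm (fuel : nat) (l m c s i mi y1 y2 : Z) : bool :=
  if fuel is f.+1 then
    let mi' := Z.modulo (Z.mul mi m) l in
    let y := Z.modulo (Z.sub (Z.mul s mi')
      (Z.mul i (Z.add (Z.mul c y1) (Z.mul m (Z.mul (Z.pred i) y2))))) l in
    if (if Z.eqb y 0 then
          ~~ Z.eqb (Z.modulo (Z.sub (Z.mul mi' mi') (Z.pow (Z.mul (Z.mul (Z.succ i) i) y1) 2)) l) 0
        else true)
    then scanm f l m c s (Z.succ i) mi' y y1 else false
  else true.

Lemma cong_sym l x y : cong l x y -> cong l y x.
Proof. by case=> k ->; exists (Z.opp k); lia. Qed.

Lemma cong_trans l x y z : cong l x y -> cong l y z -> cong l x z.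
Proof. by move=> [k ->] [k' ->]; exists (Z.add k k'); lia. Qed.

Lemma cong_eq0 l x : cong l x Z0 -> Z.modulo x l = Z0.
Proof. by case=> k ->; rewrite Z.add_0_l Z_mod_mult. Qed.

Lemma cong_cancel l u x : Z.gcd u l = Zpos xH -> cong l (Z.mul u x) Z0 -> cong l x Z0.
Proof.
move=> ul [k E]; have dv : Z.divide l (Z.mul u x) by exists k; lia.
have ul' : Z.gcd l u = Zpos xH by rewrite Z.gcd_comm.
by have [y ->] := Z.gauss l u x dv ul'; exists y; lia.
Qed.

Lemma gcd_pow m l i : Z.gcd m l = Zpos xH -> Z.gcd (Z.pow m (Z.of_nat i)) l = Zpos xH.
Proof.
move=> ml; elim: i => [|i IH]; first by rewrite Z.gcd_1_l.
rewrite Zpow_succ.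
by apply/Zgcd_1_rel_prime/rel_prime_sym/rel_prime_mult; apply/rel_prime_sym/Zgcd_1_rel_prime.
Qed.

(** The congruence for [y2] carries the factor [i] because at [i = 0] the value preceding the
    restart is arbitrary; the recurrence multiplies it by [i]. At the end the unit [m ^ r] is
    cancelled. *)
Lemma scanmP f a l m c s r i j mi y1 y2 : Z.gcd m l = Zpos xH ->
  cong l (Z.add (Z.of_nat r) a) Z0 ->
  cong l mi (Z.pow m (Z.of_nat i)) ->
  cong l (W2 a m c s (r + i)).1 (Z.mul (Z.pow m (Z.of_nat r)) y1) ->
  cong l (Z.mul (Z.of_nat i) (W2 a m c s (r + i)).2)
         (Z.mul (Z.of_nat i) (Z.mul (Z.pow m (Z.of_nat r)) y2)) ->
  scanm f l m c s (Z.of_nat i.+1) mi y1 y2 ->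
  (r + i < j <= r + i + f)%N ->
  (W2 a m c s j).1 = Z0 ->
  Z.pow (Z.pow m (Z.of_nat j)) 2 =
    Z.pow (Z.mul (Z.mul (Z.add (Z.of_nat j.+1) a) (Z.add (Z.of_nat j) a)) (W2 a m c s j).2) 2 ->
  False.
Proof.
move=> ml ra; elim: f i mi y1 y2 => [|f IH] i mi y1 y2 miE E1 E2; first by clear; lia.
rewrite /scanm -/scanm; cbv zeta; set mi' := Z.modulo (Z.mul mi m) l.
set z := Z.sub _ _; case: ifP => // cond hs hj w1 w2.
set mu := Z.pow m (Z.of_nat r) in E1 E2.
have mu1 : Z.gcd mu l = Zpos xH by apply: gcd_pow.
have mE : cong l mi' (Z.pow m (Z.of_nat i.+1)).
  apply: cong_mod; rewrite Zpow_succ.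
  by rewrite Z.mul_comm; apply: cong_mul => //; apply: cong_refl.
have jaE : cong l (Z.add (Z.of_nat (r + i).+1) a) (Z.of_nat i.+1).
  by case: ra => k E; exists k; clear -E; lia.
have ja1E : cong l (Z.pred (Z.add (Z.of_nat (r + i).+1) a)) (Z.of_nat i).
  by case: ra => k E; exists k; clear -E; lia.
have powE : Z.pow m (Z.of_nat (r + i).+1) = Z.mul mu (Z.pow m (Z.of_nat i.+1)).
  by rewrite /mu -Z.pow_add_r; [congr Z.pow| |]; clear; lia.
have EW : cong l (W2 a m c s (r + i).+1).1 (Z.mul mu z).
  rewrite W2S1 powE /z.
  set w1' := (W2 _ _ _ _ (r + i)).1 in E1 *; set w2' := (W2 _ _ _ _ (r + i)).2 in E2 *.
  have -> : Z.mul mu (Z.sub (Z.mul s mi')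
     (Z.mul (Z.of_nat i.+1) (Z.add (Z.mul c y1) (Z.mul m (Z.mul (Z.pred (Z.of_nat i.+1)) y2))))) =
    Z.sub (Z.sub (Z.mul s (Z.mul mu mi')) (Z.mul (Z.mul c (Z.of_nat i.+1)) (Z.mul mu y1)))
     (Z.mul (Z.mul m (Z.of_nat i.+1)) (Z.mul (Z.of_nat i) (Z.mul mu y2))).
    by rewrite (_ : Z.pred (Z.of_nat i.+1) = Z.of_nat i); [ring|clear; lia].
  have Ew2 : cong l (Z.mul (Z.pred (Z.add (Z.of_nat (r + i).+1) a)) w2')
      (Z.mul (Z.of_nat i) (Z.mul mu y2)).
    by apply: cong_trans E2; apply: cong_mul => //; apply: cong_refl.
  rewrite -(Z.mul_assoc (Z.mul m _)) -/w2'.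
  apply: cong_sub; first apply: cong_sub.
  - apply: cong_mul; first exact: cong_refl.
    by apply: cong_mul; [apply: cong_refl|apply: cong_sym].
  - by apply: cong_mul => //; apply: cong_mul => //; apply: cong_refl.
  - by apply: cong_mul => //; apply: cong_mul => //; apply: cong_refl.
have [jE|ji] := eqVneq j (r + i).+1; last first.
  apply: (IH i.+1 _ _ _ mE _ _ _ _ w1 w2); rewrite ?addnS.
  - apply: cong_trans EW _; apply: cong_mul; first exact: cong_refl.
    by apply: cong_sym; apply: cong_mod; apply: cong_refl.
  - rewrite W2S2; apply: cong_mul; [exact: cong_refl|exact: E1].
  - by rewrite [in X in scanm _ _ _ _ _ X]Nat2Z.inj_succ.
  - by clear -hj ji; lia.
move: cond; rewrite jE in w1 w2; rewrite w1 in EW.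
rewrite (cong_eq0 (cong_cancel mu1 (cong_sym EW))) Z.eqb_refl => /negP; apply; apply/Z.eqb_eq.
apply: cong_eq0; apply: (cong_cancel mu1); apply: (cong_cancel mu1).
have -> : Z.mul mu (Z.mul mu (Z.sub (Z.mul mi' mi')
    (Z.pow (Z.mul (Z.mul (Z.succ (Z.of_nat i.+1)) (Z.of_nat i.+1)) y1) 2))) =
  Z.sub (Z.mul (Z.mul mu mi') (Z.mul mu mi'))
   (Z.mul (Z.mul (Z.mul (Z.succ (Z.of_nat i.+1)) (Z.of_nat i.+1)) (Z.mul mu y1))
      (Z.mul (Z.mul (Z.succ (Z.of_nat i.+1)) (Z.of_nat i.+1)) (Z.mul mu y1))) by ring.
have hm : cong l (Z.mul mu mi') (Z.pow m (Z.of_nat (r + i).+1)).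
  by rewrite powE; apply: cong_mul => //; apply: cong_refl.
apply: (@cong_trans _ _ (Z.sub (Z.pow (Z.pow m (Z.of_nat (r + i).+1)) 2) (Z.pow (Z.mul (Z.mul (Z.add (Z.of_nat (r + i).+2) a) (Z.add (Z.of_nat (r + i).+1) a)) (W2 a m c s (r + i).+1).2) 2))); last first.
  by rewrite w2 Z.sub_diag; apply: cong_refl.
have hw : cong l (Z.mul (Z.mul (Z.succ (Z.of_nat i.+1)) (Z.of_nat i.+1)) (Z.mul mu y1))
  (Z.mul (Z.mul (Z.add (Z.of_nat (r + i).+2) a) (Z.add (Z.of_nat (r + i).+1) a)) (W2 a m c s (r + i).+1).2).
  rewrite W2S2; apply: cong_mul; last exact: cong_sym.
  apply: cong_mul; last exact: cong_sym.
  by case: ra => k E; exists (Z.opp k); clear -E; lia.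
by rewrite !Z.pow_2_r; apply: cong_sub; apply: cong_mul.
Qed.

Fixpoint quad_kill (ls : seq Z) (a m c s : Z) : bool :=
  if ls is l :: ls' then
    if Z.eqb (Z.gcd m l) 1 then
      if Z.ltb (Z.succ a) l then
        if scan2 (Z.to_nat l) a l m c s 1 1 1 0 then
          if scanm (Z.to_nat l).-1 l m c s 1 1 s 0 then true
          else quad_kill ls' a m c s
        else quad_kill ls' a m c s
      else quad_kill ls' a m c s
    else quad_kill ls' a m c s
  else false.

Lemma quad_killP ls n a e G H (m c s : Z) : splits n a 2 e G H ->
  (forall j, (0 < j < n)%N -> e j = zq s) -> zq m != 0 -> Z.abs s = Zpos xH ->
  G`_1 = zq c / zq m -> G`_2 = (zq m)^-1 -> (3 < n)%N ->
  ~~ quad_kill ls (Z.of_nat a) m c s.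
Proof.
move=> S es m0 s1 G1 G2 n3; elim: ls => [//|l ls IH] /=.
case: (Z.eqb_spec (Z.gcd m l) 1) => // ml.
case: (Z.ltb_spec (Z.succ (Z.of_nat a)) l) => // al.
case sc: (scan2 _ _ _ _ _ _ _ _ _ _) => //; case sm: (scanm _ _ _ _ _ _ _ _ _) => //.
have := W2_end S es m0 G1 G2 (ltnW n3).
rewrite [W2 _ _ _ _ _]surjective_pairing => -[w1 w2].
have n1 : (2 < n.-1)%N by clear -n3; lia.
rewrite (_ : Z.of_nat (n + a) = Z.add (Z.of_nat n.-1.+1) (Z.of_nat a)) in w2; last by clear -n3; lia.
rewrite Nat2Z.inj_add in w2.
case: (Z.ltb_spec (Z.add (Z.of_nat n.-1) (Z.of_nat a)) l) => nl.
  by have := scan2P (i := 0) sc (ltnW (ltnW n1)) n1 nl w1 w2.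
(* [t] is the distance from [n - 1] back to the last index [j] with [l %| j + a]. *)
pose t := Z.to_nat (Z.modulo (Z.add (Z.of_nat n.-1) (Z.of_nat a)) l).
have [t0 tl] : Z.le 0 (Z.of_nat t) /\ Z.lt (Z.of_nat t) l.
  by have := Z.mod_pos_bound (Z.add (Z.of_nat n.-1) (Z.of_nat a)) l; rewrite /t; clear -al; lia.
have [q qE] : exists q, Z.add (Z.of_nat n.-1) (Z.of_nat a) = Z.add (Z.of_nat t) (Z.mul q l).
  exists (Z.div (Z.add (Z.of_nat n.-1) (Z.of_nat a)) l).
  have := Z.div_mod (Z.add (Z.of_nat n.-1) (Z.of_nat a)) l.
  by have := Z.mod_pos_bound (Z.add (Z.of_nat n.-1) (Z.of_nat a)) l; rewrite /t; clear -al; lia.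
have q1 : Z.le 1 q by clear -qE tl nl al; nia.
have tn : (t < n.-1)%N by clear -qE q1 al; nia.
have [r rE] : exists r, n.-1 = (r.+1 + t)%N by exists (n.-1 - t.+1)%N; clear -tn; lia.
have ra : cong l (Z.add (Z.of_nat r.+1) (Z.of_nat a)) Z0.
  by exists q; clear -rE qE; lia.
have EW : cong l (W2 (Z.of_nat a) m c s (r.+1 + 0)).1 (Z.mul (Z.pow m (Z.of_nat r.+1)) s).
  rewrite addn0 W2S1; case: ra => k ->.
  exists (Z.opp (Z.add (Z.mul (Z.mul c k) (W2 (Z.of_nat a) m c s r).1)
    (Z.mul (Z.mul (Z.mul m k) (Z.pred (Z.mul k l))) (W2 (Z.of_nat a) m c s r).2))).
  by rewrite !Z.add_0_l; ring.
(* If [n - 1] is itself a restart, then [X_(n-1)] is [s] times a power of [m], a unit modulo [l],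
   and cannot vanish. *)
case: (posnP t) => [t00|tpos].
  move: EW; rewrite addn0 (_ : r.+1 = n.-1); last by rewrite rE t00 addn0.
  rewrite w1 => /cong_sym/(cong_cancel (gcd_pow _ ml))/cong_eq0 E.
  have : Z.divide l 1.
    rewrite -s1; apply/Z.divide_abs_r/Z.mod_divide => //; clear -al; lia.
  by move=> /Z.divide_1_r_nonneg; clear -al; lia.
exfalso; refine (scanmP (i := 0) (mi := Zpos xH) (y2 := Z0) ml ra _ EW _ sm _ w1 w2).
- exact: cong_refl.
- exact: cong_refl.
- by clear -rE tpos tl t0; lia.
Qed.

(* Columns: [a], bounds for the denominators of the two nonconstant coefficients of a quadratic
   factor, and the certificates for these bounds. *)
Definition quad_tables : seq (nat * nat * nat * seq (nat * (nat * nat * nat * nat)) * seq (nat * (nat * nat * nat * nat))) := [::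
  (1, 2, 12,
   [:: (2, (1, 0, 1, 0)); (3, (2, 0, 1, 0))],
   [:: (2, (1, 0, 1, 0)); (3, (2, 0, 1, 0))]);
  (2, 6, 12,
   [:: (2, (1, 0, 1, 0)); (3, (1, 0, 1, 1))],
   [:: (2, (1, 0, 1, 0)); (3, (2, 1, 1, 0))]);
  (3, 4, 120,
   [:: (2, (1, 1, 1, 0)); (3, (2, 0, 1, 0)); (5, (2, 0, 1, 2))],
   [:: (2, (1, 1, 1, 0)); (3, (2, 0, 1, 0)); (5, (2, 0, 1, 2))]);
  (4, 10, 60,
   [:: (2, (1, 0, 1, 0)); (3, (3, 0, 2, 3)); (5, (1, 0, 1, 1))],
   [:: (2, (1, 0, 1, 0)); (3, (2, 1, 1, 0)); (5, (2, 1, 1, 1))]);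
  (5, 6, 84,
   [:: (2, (2, 0, 3, 2)); (3, (1, 0, 1, 2)); (5, (2, 0, 1, 0)); (7, (2, 0, 1, 2))],
   [:: (2, (3, 0, 4, 3)); (3, (3, 1, 2, 4)); (5, (3, 0, 1, 0)); (7, (2, 0, 1, 2))]);
  (6, 14, 168,
   [:: (2, (2, 0, 3, 2)); (3, (3, 0, 2, 3)); (5, (2, 0, 1, 1)); (7, (1, 0, 1, 1))],
   [:: (2, (1, 1, 1, 0)); (3, (2, 1, 1, 0)); (5, (3, 0, 1, 3)); (7, (2, 1, 1, 1))]);
  (7, 24, 144,
   [:: (2, (1, 2, 1, 0)); (3, (1, 0, 1, 2)); (5, (2, 0, 1, 2)); (7, (2, 0, 1, 0))],
   [:: (2, (1, 2, 1, 0)); (3, (1, 0, 1, 2)); (5, (3, 0, 1, 6)); (7, (3, 0, 1, 0))]);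
  (8, 18, 180,
   [:: (2, (1, 0, 1, 0)); (3, (1, 1, 1, 1)); (5, (2, 0, 1, 3)); (7, (2, 0, 1, 1))],
   [:: (2, (1, 0, 1, 0)); (3, (2, 3, 1, 0)); (5, (2, 0, 1, 3)); (7, (3, 0, 1, 1))]);
  (9, 10, 660,
   [:: (2, (2, 0, 3, 2)); (3, (2, 0, 1, 0)); (5, (1, 0, 1, 2)); (7, (2, 0, 1, 1)); (11, (2, 0, 1, 2))],
   [:: (2, (3, 0, 4, 3)); (3, (2, 0, 1, 0)); (5, (2, 1, 1, 2)); (7, (3, 0, 1, 2)); (11, (2, 0, 1, 2))]);
  (10, 22, 132,
   [:: (2, (2, 0, 3, 2)); (3, (3, 0, 2, 3)); (5, (2, 0, 1, 1)); (7, (2, 0, 1, 2)); (11, (1, 0, 1, 1))],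
   [:: (2, (3, 0, 4, 3)); (3, (2, 1, 1, 0)); (5, (3, 0, 1, 3)); (7, (3, 0, 1, 3)); (11, (2, 1, 1, 1))]);
  (11, 12, 312,
   [:: (2, (1, 0, 2, 2)); (3, (1, 0, 1, 2)); (5, (2, 0, 1, 2)); (7, (2, 0, 1, 2)); (11, (2, 0, 1, 0)); (13, (2, 0, 1, 2))],
   [:: (2, (2, 1, 3, 3)); (3, (3, 1, 2, 4)); (5, (3, 0, 1, 6)); (7, (3, 0, 1, 4)); (11, (3, 0, 1, 0)); (13, (2, 0, 1, 2))]);
  (12, 26, 1092,
   [:: (2, (2, 0, 3, 2)); (3, (3, 0, 2, 3)); (5, (2, 0, 1, 3)); (7, (2, 0, 1, 3)); (11, (2, 0, 1, 1)); (13, (1, 0, 1, 1))],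
   [:: (2, (3, 0, 4, 3)); (3, (2, 1, 1, 0)); (5, (3, 0, 1, 9)); (7, (2, 0, 1, 3)); (11, (3, 0, 1, 1)); (13, (2, 1, 1, 1))])]%N.

(* Conditionals rather than boolean connectives: [vm_compute] is strict. *)
Definition quad_check (a C1 C2 : nat) : bool :=
  let u := Z.of_nat (a.+1 * a.+2) in
  let v := Z.of_nat (2 * a + 3) in
  let aZ := Z.of_nat a in
  let Z1 := Z.of_nat C1 in
  let Z2 := Z.of_nat C2 in
  let kill := quad_kill (map Z.of_nat [:: 17; 19; 23; 29; 31; 37]%N) aZ in
  all (fun D => if Z.eqb (Z.modulo Z2 D) 0 then
    if Z.eqb (Z.modulo ((Z.pow 2 10)) D) 0 then true else
    let B := Z.div (Z.add (Z.mul D (Z.mul v v)) (Z.mul u u)) (Z.mul u v) in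
    all (fun c => if Z.eqb (Z.modulo (Z.mul Z1 c) D) 0 then
      [&& kill D c 1, kill D c (-1), kill (Z.opp D) c 1 & kill (Z.opp D) c (-1)]
      else true) (Zsym B)
    else true)
  (Zrange 1 C2).

Lemma quad_tables_ok :
  all (fun t => let: (a, C1, C2, t1, t2) := t in
    [&& tabcheck 2 a 1 C1 t1, tabcheck 2 a 2 C2 t2 & quad_check a C1 C2]) quad_tables.
Proof. vm_cast_no_check (erefl true). Qed.

Lemma zq_dvd (x y z : Z) : zq x = zq y * zq z -> zq y != 0 -> Z.modulo x y = Z0.
Proof.
move=> E y0.
have xE : x = Z.mul y z by apply/eqP; rewrite -[_ == _]zq_eq zqM E.
have y0' : y <> Z0 by move=> y00; move: y0; rewrite y00.
by rewrite xE Z.mul_comm Z.mod_mul.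
Qed.

(** [G = 1 + (c x + x^2) / m] with integers [m] and [c]. The denominator bounds make [m] divide [C2]
    and [C1 * c], and [split2_bound] confines [c]: this leaves finitely many pairs for each [a],
    whatever [n] is. *)
Lemma split_quad_false n a e G H (s : bool) : splits n a 2 e G H ->
  (1 <= a <= 12)%N -> (3 < n)%N -> (forall j, (0 < j < n)%N -> e j = (-1) ^+ s) -> False.
Proof.
move=> S /andP[a1 a12] n3 es.
have [[[C1 C2] t1] [t2 tin]] : exists C12t t2,
   (a, C12t.1.1, C12t.1.2, C12t.2, t2) \in quad_tables.
  move: a1 a12; case: a {S} => [//|a] _ al.
  have /mapP [t tin ->] : a.+1 \in [seq t.1.1.1.1 | t <- quad_tables].
    by move: al; do 12?[case: a => [|a] //].
  by case: t tin => [[[[x1 x2] x3] x4] x5] tin; exists (x2, x3, x4), x5.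
have := allP quad_tables_ok _ tin; rewrite /= => /and3P[tab1 tab2 /allP chk].
have [A EA] := split_denom S a1 tab1; have [D ED] := split_denom S a1 tab2.
have [m Em] := split_coprime_lead_int S 0; have [c Ec] := split_coprime_lead_int S 1.
have G0 : G`_0 = 1 by case: S => _ _ [].
have G2 := split_lead_neq0 S.
rewrite G0 mul1r in Em.
have m0 : m%:~R != 0 :> rat by rewrite -Em invr_eq0.
have EG2 : G`_2 = m%:~R^-1 by rewrite -Em invrK.
have EG1 : G`_1 = c%:~R / m%:~R by rewrite -Ec EG2 invrK mulfK.
have dvd2 : C2%:R = m%:~R * D%:~R :> rat by rewrite -ED EG2 mulrCA divff ?mulr1.
have dvd1 : C1%:R * c%:~R = m%:~R * A%:~R :> rat.
  by rewrite -EA EG1; field.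
have bnd := split2_bound S.
pose M := `|m|%N.
have M0 : (0 < M)%N by rewrite absz_gt0 -(intr_eq0 rat).
have EM : `|m%:~R| = M%:R :> rat by rewrite -intr_norm -abszE.
have bnd' : `|c%:~R| * ((a.+1 * a.+2)%:R * (2 * a + 3)%:R) <=
     M%:R * ((2 * a + 3)%:R * (2 * a + 3)%:R) + (a.+1 * a.+2)%:R * (a.+1 * a.+2)%:R :> rat.
  have u0 : 0 < (a.+1 * a.+2)%:R :> rat by rewrite ltr0n.
  have v0 : 0 < (2 * a + 3)%:R :> rat by rewrite ltr0n addn_gt0 orbT.
  have Mq0 : 0 < M%:R :> rat by rewrite ltr0n.
  move: bnd; rewrite /rho EG1 EG2 normrM !normfV EM invf_div.
  move: u0 v0 Mq0; move: (a.+1 * a.+2)%:R (2 * a + 3)%:R M%:R => u v q u0 v0 q0.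
  rewrite -(ler_pM2r (mulr_gt0 q0 (mulr_gt0 u0 v0))).
  have -> : `|c%:~R| / q * (q * (u * v)) = `|c%:~R| * (u * v).
    by field; rewrite gt_eqF.
  have -> // : (v / u + u / v * q^-1) * (q * (u * v)) = q * (v * v) + u * u.
  by field; rewrite (gt_eqF u0) (gt_eqF v0) (gt_eqF q0).
pose u := Z.of_nat (a.+1 * a.+2); pose v := Z.of_nat (2 * a + 3).
have C20 : (0 < C2)%N by case/andP: tab2.
have EMZ : zq (Z.of_nat M) != 0 by rewrite zq_nat pnatr_eq0 -lt0n.
have mM : m = M%:Z \/ m = - M%:Z by rewrite /M; clear; lia.
have dv2 : Z.modulo (Z.of_nat C2) (Z.of_nat M) = Z0.
  apply: (@zq_dvd _ _ (Z_of_int (if m == M%:Z then D else - D))) => //.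
  rewrite !zq_nat zq_int dvd2; case: eqP => [{1}->//|]; case: mM => // -> _.
  by rewrite !intrN mulrN mulNr.
have dv1 : Z.modulo (Z.mul (Z.of_nat C1) (Z_of_int c)) (Z.of_nat M) = Z0.
  apply: (@zq_dvd _ _ (Z_of_int (if m == M%:Z then A else - A))) => //.
  rewrite zqM !zq_nat !zq_int dvd1; case: eqP => [{1}->//|]; case: mM => // -> _.
  by rewrite !intrN mulrN mulNr.
have Min : Z.of_nat M \in Zrange 1 C2.
  rewrite (_ : C2 = Z.to_nat (Z.sub (Z.succ (Z.of_nat C2)) 1)); last by clear; lia.
  apply: Zrange_mem; first by clear -M0; lia.
  have := Z.mod_divide (Z.of_nat C2) (Z.of_nat M); case; first by clear -M0; lia.
  by move=> /(_ dv2) /Z.divide_pos_le; clear -C20; lia.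
(* This allows [quad_check] to skip powers of 2: one of [n + a], [n + a - 1] is odd and above 1, and
   by [split_top] its prime factor divides [m]. *)
have npow : Z.modulo (Z.pow 2 10) (Z.of_nat M) <> Z0.
  move=> /(Z.mod_divide _ _ _)[|q qE]; first by clear -M0; lia.
  have M2 : (M %| 2 ^ 10)%N.
    by apply/dvdnP; exists (Z.to_nat q); clear -qE M0; nia.
  have [l l2 lodd] : exists2 l, (l < 2)%N & odd (n + a - l).
    case nodd : (odd (n + a)); first by exists 0%N; rewrite ?subn0.
    by exists 1%N => //; rewrite oddB ?nodd //; clear -n3; lia.
  have big : (1 < n + a - l)%N by clear -n3 l2; lia.
  have pp := pdiv_prime big; have pd := pdiv_dvd (n + a - l).
  set p := pdiv _ in pp pd.
  have : vq p G`_2 < 0.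
    apply: (@split_top _ _ _ _ _ _ S p (n - l)%N) => //.
      by clear -n3 l2; lia.
    by rewrite (_ : n - l + a = n + a - l)%N //; clear -n3 l2; lia.
  have EV : vq p m%:~R = vq p M%:R.
    by case: mM => ->; rewrite ?intrN ?vqN -pmulrn.
  rewrite EG2 vqV // oppr_lt0 EV vq_nat ltz_nat logn_gt0 mem_primes => /and3P[_ _ pM].
  have : (p %| 2 ^ 10)%N by apply: dvdn_trans pM M2.
  rewrite Euclid_dvdX // andbT dvdn_prime2 // => /eqP p2.
  by move: lodd; rewrite -[odd _]negbK -dvdn2 -p2 pd.
have := chk _ Min; rewrite dv2 Z.eqb_refl -/u -/v.
case: Z.eqb_spec => [//|_] /allP chk2.
have cB : Z.leb (Z.abs (Z_of_int c)) (Z.div (Z.add (Z.mul (Z.of_nat M) (Z.mul v v)) (Z.mul u u)) (Z.mul u v)).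
  have uv0 : Z.lt Z0 (Z.mul u v) by rewrite /u /v; clear; nia.
  have : Z.leb (Z.mul (Z.abs (Z_of_int c)) (Z.mul u v))
          (Z.add (Z.mul (Z.of_nat M) (Z.mul v v)) (Z.mul u u)).
    by rewrite -zq_le zqD !zqM zq_abs zq_int !zq_nat.
  move=> /Z.leb_le h; apply/Z.leb_le/Z.div_le_lower_bound => //.
  by rewrite Z.mul_comm.
have := chk2 _ (Zsym_mem cB); cbv zeta.
rewrite dv1 Z.eqb_refl.
have scan mz sz : m = int_of_Z mz -> zq sz = (-1) ^+ s -> Z.abs sz = Zpos xH ->
    ~~ quad_kill (map Z.of_nat [:: 17; 19; 23; 29; 31; 37]%N) (Z.of_nat a) mz (Z_of_int c) sz.
  move=> Emz Esz s1; have zm : zq mz = m%:~R by rewrite Emz.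
  apply: (quad_killP _ S) => //; rewrite ?zm ?zq_int //.
  by move=> j jn; rewrite Esz es.
have m1 : m = M%:Z -> m = int_of_Z (Z.of_nat M) by move=> ->; clear; lia.
have m2 : m = - M%:Z -> m = int_of_Z (Z.opp (Z.of_nat M)) by move=> ->; clear; lia.
move=> /and4P[k1 k2 k3 k4].
case: (s) scan => scan; case: mM => [/m1|/m2] Em'.
- by have := scan _ (Zneg xH) Em' erefl erefl; rewrite k2.
- by have := scan _ (Zneg xH) Em' erefl erefl; rewrite k4.
- by have := scan _ (Zpos xH) Em' erefl erefl; rewrite k1.
- by have := scan _ (Zpos xH) Em' erefl erefl; rewrite k3.
Qed.

(** * Cubic factors *)

Section Cubic.
Variables (n a : nat) (e : nat -> rat) (G H : {poly rat}) (m c d s : rat).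
Hypothesis S : splits n a 3 e G H.
Hypothesis es : forall j, (0 < j < n)%N -> e j = s.
Hypothesis m0 : m != 0.
Hypothesis G1 : G`_1 = c / m.
Hypothesis G2 : G`_2 = d / m.
Hypothesis G3 : G`_3 = m^-1.

Let G0 : G`_0 = 1. Proof. by case: S => _ _ []. Qed.
Let H0 : H`_0 = 1. Proof. by case: S => _ _ []. Qed.
Let sG : size G = 4%N. Proof. by case: S. Qed.

Definition coef_shift (i j : nat) : rat := if (j < i)%N then 0 else H`_(j - i).

Lemma cubic_rec j : (j <= n)%N -> e j * phi a j =
  H`_j + c / m * coef_shift 1 j + d / m * coef_shift 2 j + m^-1 * coef_shift 3 j.
Proof.
move=> jn; have [_ FE _ _ _] := S.
have -> : e j * phi a j = (G * H)`_j by rewrite -FE coef_nform jn phi.unlock.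
have -> : G = 1 + (c / m) *: 'X^1 + (d / m) *: 'X^2 + m^-1 *: 'X^3.
  apply/polyP => i; rewrite !coefE.
  case: i => [|[|[|[|i]]]]; rewrite /= ?G0 ?G1 ?G2 ?G3 ?mulr1 ?mulr0 ?addr0 ?add0r //.
  by rewrite nth_default // sG.
by rewrite !mulrDl mul1r -!scalerAl !coefD !coefZ !coefXnM.
Qed.

Definition Xc (j : nat) : rat := H`_j * m ^+ j / phi a j.

Lemma Xc0 : Xc 0 = 1.
Proof. by rewrite /Xc H0 phi0 expr0; apply/eqP. Qed.

Lemma Xc_rec j : (0 < j < n)%N ->
  Xc j = s * m ^+ j - (j + a)%:R * (c * Xc j.-1 +
    m * (j.-1 + a)%:R * (d * (if (j < 2)%N then 0 else Xc j.-2) +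
    m * (j.-2 + a)%:R * (if (j < 3)%N then 0 else Xc (j - 3)))).
Proof.
move=> /andP[j0 jn]; have := cubic_rec (ltnW jn); rewrite es ?j0 // => E.
have p0 := gt_eqF (phi_gt0 a j).
have -> : s = (s * phi a j) / phi a j by rewrite mulfK ?p0.
rewrite E /Xc /coef_shift.
case: j {E jn} j0 p0 => [//|[|[|j]]] _ p0.
- rewrite /= subnn (phiS a 0) expr1 H0 expr0; move: p0 => /negbT p0.
  move: (phi a 1) p0 => p p0.
  have q0 : (1 + a)%:R != 0 :> rat by rewrite pnatr_eq0.
  by move: (1 + a)%:R q0 => q q0; field; rewrite p0 q0 m0.
- rewrite /= (phiS a 0) (phiS a 1) expr1 H0 expr0; move: p0 => /negbT p0.
  move: (phi a 2) p0 => p p0.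
  have q0 : (1 + a)%:R != 0 :> rat by rewrite pnatr_eq0.
  have q1 : (2 + a)%:R != 0 :> rat by rewrite pnatr_eq0.
  by move: (1 + a)%:R (2 + a)%:R q0 q1 => q r q0 q1; field; rewrite p0 q0 q1 m0.
rewrite /= !subSS !subn0 (phiS a j) (phiS a j.+1) (phiS a j.+2) !exprS.
move: p0 => /negbT p0; move: (phi a j.+3) p0 => p p0.
have q0 : (j.+1 + a)%:R != 0 :> rat by rewrite pnatr_eq0.
have q1 : (j.+2 + a)%:R != 0 :> rat by rewrite pnatr_eq0.
have q2 : (j.+3 + a)%:R != 0 :> rat by rewrite pnatr_eq0.
move: (j.+1 + a)%:R (j.+2 + a)%:R (j.+3 + a)%:R q0 q1 q2 => q r t q0 q1 q2.
by field; rewrite p0 q0 q1 q2 m0.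
Qed.
End Cubic.

(** The scan is run up to [n - 1], where the last two values must vanish because the cofactor has
    degree [n - 3]. Here [n] is given, so no periodicity is involved. *)
Fixpoint scan3 (steps : nat) (l a m c d s j mj x1 x2 x3 : Z) : Z * Z :=
  if steps is f.+1 then
    let mj' := Z.modulo (Z.mul mj m) l in
    let ja := Z.add j a in
    let x := Z.modulo (Z.sub (Z.mul s mj') (Z.mul ja (Z.add (Z.mul c x1)
        (Z.mul (Z.mul m (Z.sub ja 1)) (Z.add (Z.mul d x2)
        (Z.mul (Z.mul m (Z.sub ja 2)) x3)))))) l in
    scan3 f l a m c d s (Z.succ j) mj' x x1 x2
  else (x1, x2).

(* Modulo [l] the recurrence forgets its past when it crosses an index [j] with
   [l %| j + a]; hence the scan may start just before such an index, with
   arbitrary initial values. *)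
Lemma scan3P n a e G H (l m c d s : Z) i0 mj x0 : splits n a 3 e G H ->
  (forall j, (0 < j < n)%N -> e j = zq s) -> zq m != 0 ->
  G`_1 = zq c / zq m -> G`_2 = zq d / zq m -> G`_3 = (zq m)^-1 -> (i0.+3 < n)%N ->
  cong l mj (Z.pow m (Z.of_nat i0)) ->
  i0 = 0%N /\ x0 = Zpos xH \/ cong l (Z.of_nat (i0.+1 + a)) Z0 ->
  let: (x1, x2) := scan3 (n.-1 - i0) l (Z.of_nat a) m c d s (Z.of_nat i0.+1) mj x0 0 0 in
  Z.modulo x1 l = Z0 /\ Z.modulo x2 l = Z0.
Proof.
move=> S es m0 G1 G2 G3 i0n mjE start.
pose X := Xc a H (zq m).
pose Y i k := if (i < k)%N then 0 else X (i - k)%N.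
have XY i : (0 < i < n)%N -> X i = zq s * zq m ^+ i - (i + a)%:R * (zq c * Y i 1%N +
    zq m * (i.-1 + a)%:R * (zq d * Y i 2 + zq m * (i.-2 + a)%:R * Y i 3)).
  move=> hi; rewrite /X (Xc_rec S es m0 G1 G2 G3 hi) /Y /X.
  by case: (i) hi => [|[|i']] //= _; rewrite ?subn1 ?subn2.
have Xint i : (i < n)%N -> exists y, zq y = X i.
  elim/ltn_ind: i => i IH iln; case: (posnP i) => [->|ipos].
    by exists (Zpos xH); rewrite /X (Xc0 _ S).
  have Yint k : (0 < k)%N -> exists y, zq y = Y i k.
    move=> k0; rewrite /Y; case: ltnP => ik; first by exists Z0.
    by apply: IH; lia.
  have [y1 e1] := Yint 1%N isT; have [y2 e2] := Yint 2 isT; have [y3 e3] := Yint 3 isT.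
  exists (Z.sub (Z.mul s (Z.pow m (Z.of_nat i))) (Z.mul (Z.of_nat (i + a)) (Z.add (Z.mul c y1)
        (Z.mul (Z.mul m (Z.of_nat (i.-1 + a))) (Z.add (Z.mul d y2)
        (Z.mul (Z.mul m (Z.of_nat (i.-2 + a))) y3)))))).
  have zqX k : zq (Z.pow m (Z.of_nat k)) = zq m ^+ k.
    elim: k => [|k IHk]; first by rewrite expr0.
    by rewrite Nat2Z.inj_succ Z.pow_succ_r ?zqM ?IHk ?exprS //; lia.
  by rewrite XY ?ipos // zqB !(zqM, zqD) zqX !zq_nat e1 e2 e3.
(* The starting values need to be right only after multiplication by the coefficients [ja], [jb],
   [jc] with which they enter; if [l] divides [i0 + 1 + a], then [ja] kills them whatever they
   are. *)
suff main f i x1 x2 x3 mi y1 y2 y3 : (i0 <= i)%N -> (i + f < n)%N ->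
    cong l mi (Z.pow m (Z.of_nat i)) ->
    zq y1 = X i -> zq y2 = Y i 1%N -> zq y3 = Y i 2 ->
    let ja := Z.of_nat (i.+1 + a) in
    let jb := Z.sub ja 1 in let jc := Z.sub ja 2 in
    cong l (Z.mul ja x1) (Z.mul ja y1) ->
    cong l (Z.mul ja (Z.mul jb x2)) (Z.mul ja (Z.mul jb y2)) ->
    cong l (Z.mul ja (Z.mul jb (Z.mul jc x3))) (Z.mul ja (Z.mul jb (Z.mul jc y3))) ->
    ((i0 < i)%N -> cong l x1 y1) -> ((i0.+1 < i)%N -> cong l x2 y2) ->
    let: (z1, z2) := scan3 f l (Z.of_nat a) m c d s (Z.of_nat i.+1) mi x1 x2 x3 in
    (exists2 y, zq y = X (i + f)%N & (i0 < i + f)%N -> cong l z1 y) /\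
    (exists2 y, zq y = Y (i + f)%N 1%N & (i0.+1 < i + f)%N -> cong l z2 y).
  have cz y z : cong l z y -> zq y = 0 -> Z.modulo z l = Z0.
    move=> [k ->] /eqP; rewrite -[0]/(zq Z0) zq_eq => /Z.eqb_eq ->.
    by rewrite Z.add_0_l Z_mod_mult.
  have [y1 e1] : exists y, zq y = X i0 by apply: Xint; lia.
  have [y2 e2] : exists y, zq y = Y i0 1%N.
    by rewrite /Y; case: ltnP => h; [exists Z0|apply: Xint; lia].
  have [y3 e3] : exists y, zq y = Y i0 2%N.
    by rewrite /Y; case: ltnP => h; [exists Z0|apply: Xint; lia].
  have := main (n.-1 - i0)%N i0 x0 Z0 Z0 mj y1 y2 y3 (leqnn _).
  have kill x y : cong l (Z.of_nat (i0.+1 + a)) Z0 ->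
      cong l (Z.mul (Z.of_nat (i0.+1 + a)) x) (Z.mul (Z.of_nat (i0.+1 + a)) y).
    by move=> [k ->]; exists (Z.mul k (Z.sub x y)); ring.
  case: (scan3 _ _ _ _ _ _ _ _ _ _ _ _) => z1 z2; case.
  - by lia.
  - by [].
  - by [].
  - by [].
  - by [].
  - case: start => [[i00 ->]|/kill //].
    have -> : y1 = Zpos xH; last exact: cong_refl.
    by apply/eqP; rewrite -[_ == _]zq_eq e1 i00 /X (Xc0 _ S).
  - case: start => [[i00 _]|/kill //].
    have -> : y2 = Z0; last exact: cong_refl.
    by apply/eqP; rewrite -[_ == _]zq_eq e2 i00.
  - case: start => [[i00 _]|/kill //].
    have -> : y3 = Z0; last exact: cong_refl.
    by apply/eqP; rewrite -[_ == _]zq_eq e3 i00.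
  - by rewrite ltnn.
  - by rewrite ltnNge leqnSn.
  have -> : (i0 + (n.-1 - i0) = n.-1)%N by lia.
  move=> [w1 f1 k1] [w2 f2 k2]; split.
    apply: cz (k1 _) _; first by lia.
    by rewrite f1 /X /Xc (split_H_eq0 S) ?mul0r //; lia.
  apply: cz (k2 _) _; first by lia.
  rewrite f2 /Y; case: ifP => // _.
  by rewrite /X /Xc (split_H_eq0 S) ?mul0r //; lia.
elim: f i x1 x2 x3 mi y1 y2 y3 => [|f IH] i x1 x2 x3 mi y1 y2 y3 i0i ifn mE e1 e2 e3 ja jb jc.
  by move=> _ _ _ k1 k2; rewrite addn0 /=; split; [exists y1|exists y2].
move=> h1 h2 h3 k1 k2; rewrite /scan3 -/scan3; cbv zeta.
have [jaE jbE jcE] : [/\ ja = Z.of_nat (i.+1 + a), jb = Z.sub ja 1 & jc = Z.sub ja 2] by [].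
clearbody jc jb ja.
have -> : Z.succ (Z.of_nat i.+1) = Z.of_nat i.+2 by lia.
have -> : Z.add (Z.of_nat i.+1) (Z.of_nat a) = ja by lia.
set x := Z.modulo (Z.sub _ _) l.
have [y ey] : exists y, zq y = X i.+1 by apply: Xint; lia.
have xy : cong l x y.
  have -> : y = Z.sub (Z.mul s (Z.mul (Z.pow m (Z.of_nat i)) m)) (Z.add (Z.mul c (Z.mul ja y1))
        (Z.add (Z.mul (Z.mul m d) (Z.mul ja (Z.mul jb y2)))
        (Z.mul (Z.mul m m) (Z.mul ja (Z.mul jb (Z.mul jc y3)))))).
    have zqX k : zq (Z.pow m (Z.of_nat k)) = zq m ^+ k.
      elim: k => [|k IHk]; first by rewrite expr0.
      by rewrite Nat2Z.inj_succ Z.pow_succ_r ?zqM ?IHk ?exprS //; lia.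
    have zja : zq ja = (i.+1 + a)%:R by rewrite jaE zq_nat.
    have zjb : zq jb = (i + a)%:R by rewrite -zq_nat; congr zq; lia.
    have zjc : zq jc * zq y3 = (i.-1 + a)%:R * zq y3.
      rewrite e3 /Y; case: ltnP => i2; first by rewrite !mulr0.
      by congr (_ * _); rewrite -zq_nat; congr zq; lia.
    apply/eqP; rewrite -[_ == _]zq_eq ey XY; last by lia.
    rewrite !(zqB, zqM, zqD) zqX zja zjb zjc /= e1 e2 e3.
    have -> : Y i.+1 1%N = X i by rewrite /Y /= subn1.
    have -> : Y i.+1 2%N = Y i 1%N by rewrite /Y ltnS; case: ifP => // _; congr X; lia.
    have -> : Y i.+1 3%N = Y i 2%N by rewrite /Y ltnS; case: ifP => // _; congr X; lia.
    by rewrite exprS; apply/eqP; ring.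
  have -> : x = Z.modulo (Z.sub (Z.mul s (Z.modulo (Z.mul mi m) l)) (Z.add (Z.mul c (Z.mul ja x1))
        (Z.add (Z.mul (Z.mul m d) (Z.mul ja (Z.mul jb x2)))
        (Z.mul (Z.mul m m) (Z.mul ja (Z.mul jb (Z.mul jc x3))))))) l.
    by rewrite /x jbE jcE; congr Z.modulo; ring.
  apply/cong_mod/cong_sub.
    apply: cong_mul; first exact: cong_refl.
    by apply/cong_mod/cong_mul => //; apply: cong_refl.
  by apply: cong_add; [|apply: cong_add]; apply: cong_mul => //; apply: cong_refl.
have mE' : cong l (Z.modulo (Z.mul mi m) l) (Z.pow m (Z.of_nat i.+1)).
  rewrite Nat2Z.inj_succ Z.pow_succ_r; last lia.
  by rewrite Z.mul_comm; apply/cong_mod; rewrite Z.mul_comm (Z.mul_comm m); apply: cong_mul => //; apply: cong_refl.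
have mul_l u v w : cong l v w -> cong l (Z.mul u v) (Z.mul u w).
  by apply: cong_mul; apply: cong_refl.
have jaS : Z.sub (Z.of_nat (i.+2 + a)) 1 = ja by lia.
have jbS : Z.sub (Z.of_nat (i.+2 + a)) 2 = jb by lia.
have := IH i.+1 x x1 x2 (Z.modulo (Z.mul mi m) l) y y1 y2 (leqW i0i).
cbv zeta; rewrite addSnnS jaS jbS; apply => //.
- by rewrite e1 /Y /= subn1.
- exact: mul_l.
- exact: mul_l.
- exact: mul_l.
Qed.

(* Columns: [a], [n], primes dividing the denominator of the leading coefficient of a cubic
   factor, bounds for the denominators of its three nonconstant coefficients, and the
   certificates for these bounds. *)
Definition cubic_tables : seq (nat * nat * seq nat * nat * nat * nat * seq (nat * (nat * nat * nat * nat)) * seq (nat * (nat * nat * nat * nat)) * seq (nat * (nat * nat * nat * nat))) := [::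
  (2, 8, [:: 2; 3; 5], 6, 12, 360,
   [:: (2, (1, 0, 1, 0)); (3, (1, 0, 1, 1)); (5, (2, 0, 1, 1))],
   [:: (2, (1, 0, 1, 0)); (3, (2, 1, 1, 0)); (5, (3, 0, 1, 3))],
   [:: (2, (1, 0, 1, 0)); (3, (2, 1, 1, 0)); (5, (2, 0, 1, 1))]);
  (4, 46, [:: 2; 3; 5; 7], 10, 60, 840,
   [:: (2, (1, 0, 1, 0)); (3, (3, 0, 2, 3)); (5, (1, 0, 1, 1)); (7, (2, 0, 1, 2))],
   [:: (2, (1, 0, 1, 0)); (3, (2, 1, 1, 0)); (5, (2, 1, 1, 1)); (7, (3, 0, 1, 3))],
   [:: (2, (1, 0, 1, 0)); (3, (5, 0, 3, 5)); (5, (3, 2, 1, 1)); (7, (2, 0, 1, 2))]);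
  (12, 38, [:: 2; 3; 5; 7], 26, 1092, 10920,
   [:: (2, (2, 0, 3, 2)); (3, (3, 0, 2, 3)); (5, (2, 0, 1, 3)); (7, (2, 0, 1, 3)); (11, (2, 0, 1, 1)); (13, (1, 0, 1, 1))],
   [:: (2, (3, 0, 4, 3)); (3, (2, 1, 1, 0)); (5, (3, 0, 1, 9)); (7, (2, 0, 1, 3)); (11, (3, 0, 1, 1)); (13, (2, 1, 1, 1))],
   [:: (2, (4, 0, 5, 4)); (3, (5, 0, 3, 5)); (5, (2, 0, 1, 3)); (7, (2, 0, 1, 3)); (11, (4, 0, 1, 1)); (13, (3, 2, 1, 1))])]%N.

Fixpoint cubic_scan (n a : nat) (ls : seq (nat * nat * Z)) (m c d s : Z) : bool :=
  if ls is (l, i0, mj) :: ls' then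
    let lZ := Z.of_nat l in
    let: (x1, x2) := scan3 (n.-1 - i0) lZ (Z.of_nat a) m c d s (Z.of_nat i0.+1) mj 1 0 0 in
    if Z.eqb (Z.modulo x1 lZ) 0 then
      if Z.eqb (Z.modulo x2 lZ) 0 then cubic_scan n a ls' m c d s else true
    else true
  else false.

Definition cubic_starts (ls : seq (nat * nat)) (m : Z) : seq (nat * nat * Z) :=
  [seq (li, Z.modulo (Z.pow m (Z.of_nat li.2)) (Z.of_nat li.1)) | li <- ls].

Definition cubic_check (a n : nat) (ls : seq (nat * nat)) (req : seq nat) (C1 C2 C3 : nat) : bool :=
  let u := Z.of_nat (a.+1 * a.+2) in
  let v := Z.of_nat (2 * a + 3) in
  let Z1 := Z.of_nat C1 in
  let Z2 := Z.of_nat C2 in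
  let Z3 := Z.of_nat C3 in
  let reqZ := map Z.of_nat req in
  all (fun M =>
    if Z.eqb (Z.modulo Z3 M) 0 then
    if Z.leb (Z.mul u (Z.mul u u)) (Z.mul M (Z.mul v (Z.mul v v))) then
    if all (fun p => Z.eqb (Z.modulo M p) 0) reqZ then
      let cs := [seq c <- Zsym (Z.div (Z.mul 3 (Z.mul M v)) u) |
                  Z.eqb (Z.modulo (Z.mul Z1 c) M) 0] in
      let ds := [seq d <- Zsym (Z.div (Z.mul 3 (Z.mul M (Z.mul v v))) (Z.mul u u)) |
                  Z.eqb (Z.modulo (Z.mul Z2 d) M) 0] in
      let lp := cubic_starts ls M in
      let ln := cubic_starts ls (Z.opp M) in
      all (fun c => all (fun d =>
        [&& cubic_scan n a lp M c d 1, cubic_scan n a lp M c d (-1),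
            cubic_scan n a ln (Z.opp M) c d 1 & cubic_scan n a ln (Z.opp M) c d (-1)]) ds) cs
    else true else true else true)
  (Zrange 1 C3).

(** [i0 = l - a - 1] places the restart at the next index, the first with [l %| j + a]. The entry
    10007 scans from the true initial value [X_0 = 1]. *)
Definition cubic_restarts (n a : nat) : seq (nat * nat) :=
  rcons [seq (l, (l - a.+1)%N) | l <- [:: 47; 43; 41; 37; 7]%N & (a < l < n + a - 2)%N] (10007, 0)%N.

Lemma cubic_tables_ok :
  all (fun t => let: (a, n, req, C1, C2, C3, t1, t2, t3) := t in
    [&& tabcheck 3 a 1 C1 t1, tabcheck 3 a 2 C2 t2, tabcheck 3 a 3 C3 t3 &
        cubic_check a n (cubic_restarts n a) req C1 C2 C3]) cubic_tables.
Proof. vm_cast_no_check (erefl true). Qed.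

Lemma cubic_scanP n a e G H (ls : seq (nat * nat)) (m c d s : Z) :
  splits n a 3 e G H ->
  (forall j, (0 < j < n)%N -> e j = zq s) -> zq m != 0 ->
  G`_1 = zq c / zq m -> G`_2 = zq d / zq m -> G`_3 = (zq m)^-1 ->
  all (fun li => (li.2.+3 < n)%N && ((li.2 == 0%N) || (li.1 == li.2.+1 + a)%N)) ls ->
  ~~ cubic_scan n a (cubic_starts ls m) m c d s.
Proof.
move=> S es m0 G1 G2 G3; elim: ls => [//|[l i0] ls IH] /= /andP[/andP[i0n hl] /IH h].
apply/negP.
have := scan3P S es m0 G1 G2 G3 i0n
  (cong_mod (cong_refl (Z.of_nat l) (Z.pow m (Z.of_nat i0)))).
move=> /(_ (Zpos xH)); set sc := scan3 _ _ _ _ _ _ _ _ _ _ _ _.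
case: sc => x1 x2; case.
  case/orP: hl => /eqP hl; first by left.
  by right; exists (Zpos xH); lia.
by move=> -> ->; apply/negP.
Qed.

Lemma split_cubic_table i n a req C1 C2 C3 t1 t2 t3 e G H (s : bool) :
  (i < size cubic_tables)%N ->
  nth (0, 0, [::], 0, 0, 0, [::], [::], [::])%N cubic_tables i =
    (a, n, req, C1, C2, C3, t1, t2, t3) ->
  all (fun p => prime p && has (fun l => p %| n + a - l)%N (iota 0 3)) req ->
  (0 < a)%N -> (3 < n)%N ->
  splits n a 3 e G H -> (forall j, (0 < j < n)%N -> e j = (-1) ^+ s) -> False.
Proof.
move=> isz nthi reqs a0 n3 S es.
have := all_nthP (0, 0, [::], 0, 0, 0, [::], [::], [::])%N cubic_tables_ok i isz.
rewrite nthi => /and4P[tab1 tab2 tab3]; rewrite /cubic_check.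
set u := Z.of_nat (a.+1 * a.+2); set v := Z.of_nat (2 * a + 3) => /allP chk.
have [A EA] := split_denom S a0 tab1; have [B EB] := split_denom S a0 tab2.
have [D ED] := split_denom S a0 tab3.
have [m Em] := split_coprime_lead_int S 0; have [c Ec] := split_coprime_lead_int S 1.
have [d Ed] := split_coprime_lead_int S 2.
have G0 : G`_0 = 1 by case: S => _ _ [].
have G3 := split_lead_neq0 S.
rewrite G0 mul1r in Em.
have m0 : m%:~R != 0 :> rat by rewrite -Em invr_eq0.
have EG3 : G`_3 = m%:~R^-1 by rewrite -Em invrK.
have EG1 : G`_1 = c%:~R / m%:~R by rewrite -Ec EG3 invrK mulfK.
have EG2 : G`_2 = d%:~R / m%:~R by rewrite -Ed EG3 invrK mulfK.
have dvd3 : C3%:R = m%:~R * D%:~R :> rat by rewrite -ED EG3 mulrCA divff ?mulr1.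
have dvd1 : C1%:R * c%:~R = m%:~R * A%:~R :> rat by rewrite -EA EG1; field.
have dvd2 : C2%:R * d%:~R = m%:~R * B%:~R :> rat by rewrite -EB EG2; field.
pose M := `|m|%N.
have M0 : (0 < M)%N by rewrite absz_gt0 -(intr_eq0 rat).
have EM : `|m%:~R| = M%:R :> rat by rewrite -intr_norm -abszE.
have mM : m = M%:Z \/ m = - M%:Z by rewrite /M; clear; lia.
have EMZ : zq (Z.of_nat M) != 0 by rewrite zq_nat pnatr_eq0 -lt0n.
have dvdM (x : Z) (w : int) : zq x = m%:~R * w%:~R -> Z.modulo x (Z.of_nat M) = Z0.
  move=> E; apply: (@zq_dvd _ _ (Z_of_int (if m == M%:Z then w else - w))) => //.
  rewrite E zq_nat zq_int; case: eqP => [{1}->//|]; case: mM => // -> _.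
  by rewrite !intrN mulrN mulNr.
have uq : zq u = (a.+1 * a.+2)%:R by rewrite /u zq_nat.
have vqE : zq v = (2 * a + 3)%:R by rewrite /v zq_nat.
have u0 : 0 < zq u by rewrite uq ltr0n.
have v0 : 0 < zq v by rewrite vqE ltr0n addn_gt0 orbT.
have Mq0 : 0 < M%:R :> rat by rewrite ltr0n.
have rhoV : (rho a)^-1 = zq v / zq u by rewrite /rho uq vqE invf_div.
have uZ : Z.lt Z0 u by rewrite /u; clear; nia.
have [b1 b2 b3] := split3_bound S.
rewrite rhoV EG1 EG2 EG3 normfV !normrM !normfV EM in b1 b2 b3.
have [un0 Mn0] : zq u != 0 /\ M%:R != 0 :> rat by rewrite !gt_eqF.
have B1 : Z.leb (Z.mul (Z.abs (Z_of_int c)) u) (Z.mul 3 (Z.mul (Z.of_nat M) v)).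
  rewrite -zq_le !zqM zq_abs zq_int zq_nat (zq_nat 3).
  move: b1; rewrite -(ler_pM2r (mulr_gt0 Mq0 u0)).
  move: un0 Mn0; move: (zq u) (zq v) `|_| M%:R => x y z w un0 Mn0.
  have -> : z / w * (w * x) = z * x by field.
  by have -> : 3%:R * (y / x) * (w * x) = 3%:R * (w * y) by field.
have B2 : Z.leb (Z.mul (Z.abs (Z_of_int d)) (Z.mul u u)) (Z.mul 3 (Z.mul (Z.of_nat M) (Z.mul v v))).
  rewrite -zq_le !zqM zq_abs zq_int zq_nat (zq_nat 3).
  move: b2; rewrite -(ler_pM2r (mulr_gt0 Mq0 (mulr_gt0 u0 u0))).
  move: un0 Mn0; move: (zq u) (zq v) `|_| M%:R => x y z w un0 Mn0.
  have -> : z / w * (w * (x * x)) = z * (x * x) by field.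
  by have -> : 3%:R * (y / x) ^+ 2 * (w * (x * x)) = 3%:R * (w * (y * y)) by field.
(* The bound on [G_3] is a lower bound for the integer [m]: [|m| >= rho a ^ 3]. *)
have B3 : Z.leb (Z.mul u (Z.mul u u)) (Z.mul (Z.of_nat M) (Z.mul v (Z.mul v v))).
  rewrite -zq_le !zqM zq_nat.
  move: b3; rewrite -(ler_pM2r (mulr_gt0 Mq0 (mulr_gt0 u0 (mulr_gt0 u0 u0)))).
  move: un0 Mn0; move: (zq u) (zq v) M%:R => x y w un0 Mn0.
  have -> : w^-1 * (w * (x * (x * x))) = x * (x * x) by field.
  by have -> : (y / x) ^+ 3 * (w * (x * (x * x))) = w * (y * (y * y)) by field.
have C30 : (0 < C3)%N by case/andP: tab3.
have dv3 : Z.modulo (Z.of_nat C3) (Z.of_nat M) = Z0.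
  by apply: (dvdM _ D); rewrite zq_nat dvd3.
have Min : Z.of_nat M \in Zrange 1 C3.
  rewrite (_ : C3 = Z.to_nat (Z.sub (Z.succ (Z.of_nat C3)) 1)); last by clear; lia.
  apply: Zrange_mem; first by clear -M0; lia.
  have := Z.mod_divide (Z.of_nat C3) (Z.of_nat M); case; first by clear -M0; lia.
  by move=> /(_ dv3) /Z.divide_pos_le; clear -C30; lia.
(* Each prime of [req] divides one of the three top integers, hence [m], by [split_top]. *)
have reqM : all (fun p => Z.eqb (Z.modulo (Z.of_nat M) p) 0) (map Z.of_nat req).
  rewrite all_map; apply: sub_all reqs => p /andP[pp /hasP [l]]; rewrite mem_iota => /andP[_ l3] pl.
  have n3' : (2 < n)%N by apply: ltnW.
  have : vq p G`_3 < 0.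
    apply: (@split_top _ _ _ _ _ _ S p (n - l)%N) => //.
      by clear -n3' l3; lia.
    by rewrite (_ : n - l + a = n + a - l)%N //; clear -n3' l3; lia.
  have EV : vq p m%:~R = vq p M%:R.
    by case: mM => ->; rewrite ?intrN ?vqN -pmulrn.
  rewrite EG3 vqV // oppr_lt0 EV.
  rewrite vq_nat ltz_nat logn_gt0 mem_primes => /and3P[_ _ /dvdnP[q ->]] /=.
  by rewrite Nat2Z.inj_mul Z_mod_mult.
have := chk _ Min; cbv zeta; rewrite dv3 Z.eqb_refl B3 reqM => /allP chk1.
have cin : Z_of_int c \in [seq c <- Zsym (Z.div (Z.mul 3 (Z.mul (Z.of_nat M) v)) u) |
                  Z.eqb (Z.modulo (Z.mul (Z.of_nat C1) c) (Z.of_nat M)) 0].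
  rewrite mem_filter; apply/andP; split.
    by apply/Z.eqb_eq/(dvdM _ A); rewrite zqM zq_nat zq_int dvd1.
  apply/Zsym_mem/Z.leb_le/Z.div_le_lower_bound => //.
  by rewrite Z.mul_comm; apply/Z.leb_le.
have din : Z_of_int d \in [seq d <- Zsym (Z.div (Z.mul 3 (Z.mul (Z.of_nat M) (Z.mul v v))) (Z.mul u u)) |
                  Z.eqb (Z.modulo (Z.mul (Z.of_nat C2) d) (Z.of_nat M)) 0].
  rewrite mem_filter; apply/andP; split.
    by apply/Z.eqb_eq/(dvdM _ B); rewrite zqM zq_nat zq_int dvd2.
  apply/Zsym_mem/Z.leb_le/Z.div_le_lower_bound; first exact: Z.mul_pos_pos.
  by rewrite Z.mul_comm; apply/Z.leb_le.
have /allP chk2 := chk1 _ cin; have {chk1 chk2} := chk2 _ din.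
have starts : all (fun li => (li.2.+3 < n)%N && ((li.2 == 0%N) || (li.1 == li.2.+1 + a)%N))
    (cubic_restarts n a).
  rewrite /cubic_restarts all_rcons; apply/andP; split; first by rewrite /= n3.
  apply/allP => _ /mapP [l + ->].
  by rewrite mem_filter => /andP[h _] /=; clear -h; lia.
have scan mz sz : m = int_of_Z mz -> zq sz = (-1) ^+ s ->
    ~~ cubic_scan n a (cubic_starts (cubic_restarts n a) mz) mz (Z_of_int c) (Z_of_int d) sz.
  move=> Emz Esz; have zm : zq mz = m%:~R by rewrite Emz.
  apply: (cubic_scanP S) => //; rewrite ?zm ?zq_int //.
  by move=> j jn; rewrite Esz es.
have m1 : m = M%:Z -> m = int_of_Z (Z.of_nat M) by move=> ->; clear; lia.
have m2 : m = - M%:Z -> m = int_of_Z (Z.opp (Z.of_nat M)) by move=> ->; clear; lia.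
move=> /and4P[k1 k2 k3 k4].
case: (s) scan => scan; case: mM => [/m1|/m2] Em'.
- by have := scan _ (Zneg xH) Em' erefl; rewrite k2.
- by have := scan _ (Zneg xH) Em' erefl; rewrite k4.
- by have := scan _ (Zpos xH) Em' erefl; rewrite k1.
- by have := scan _ (Zpos xH) Em' erefl; rewrite k3.
Qed.

Lemma split_cubic_false n a e G H (s : bool) : splits n a 3 e G H ->
  (forall j, (0 < j < n)%N -> e j = (-1) ^+ s) ->
  (a, n) \in [:: (2, 8); (4, 46); (12, 38)]%N -> False.
Proof.
move=> S es; rewrite !inE => /or3P[] /eqP [Ea En]; subst a n.
- exact: (@split_cubic_table 0 _ _ _ _ _ _ _ _ _ _ _ _ _ isT erefl isT isT isT S es).
- exact: (@split_cubic_table 1 _ _ _ _ _ _ _ _ _ _ _ _ _ isT erefl isT isT isT S es).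
- exact: (@split_cubic_table 2 _ _ _ _ _ _ _ _ _ _ _ _ _ isT erefl isT isT isT S es).
Qed.

(** * Windows of consecutive smooth numbers *)

Lemma zmod_dvdn a b : (0 < a)%N -> Z.modulo (Z.of_nat b) (Z.of_nat a) = Z0 <-> (a %| b)%N.
Proof.
move=> a0; have az : Z.of_nat a <> Z0 by clear -a0; lia.
split=> [/(Z.mod_divide _ _ az)[q qE]|/dvdnP[q ->]]; last by rewrite Nat2Z.inj_mul Z_mod_mult.
by apply/dvdnP; exists (Z.to_nat q); clear -qE a0; nia.
Qed.

Lemma Zpow_nat p x : Z.of_nat (p ^ x) = Z.pow (Z.of_nat p) (Z.of_nat x).
Proof. by elim: x => [//|x IH]; rewrite Zpow_succ -IH expnS Nat2Z.inj_mul. Qed.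

(** [u] runs through the powers of [p] modulo [T = M * r], and the final [u = 1] certifies that the
    number of steps is a period. Whenever [M] divides [p ^ i + sg], some [r > 1] must divide it too;
    thus [r = 1] claims that [M] never does. *)
Fixpoint ordscan (fuel : nat) (p M r sg T u : Z) : bool :=
  if fuel is f.+1 then
    if (if Z.eqb (Z.modulo (Z.add u sg) M) 0 then
          if Z.ltb 1 r then Z.eqb (Z.modulo (Z.add u sg) r) 0 else false
        else true)
    then ordscan f p M r sg T (Z.modulo (Z.mul u p) T) else false
  else Z.eqb u 1.

Lemma cong_mull M r x y : cong (Z.mul M r) x y -> cong M x y.
Proof. by case=> k ->; exists (Z.mul k r); ring. Qed.

Lemma cong_mulr M r x y : cong (Z.mul M r) x y -> cong r x y.
Proof. by case=> k ->; exists (Z.mul k M); ring. Qed.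

Lemma mod_cong0 l x : l <> Z0 -> Z.modulo x l = Z0 -> cong l x Z0.
Proof. by move=> l0 /(Z.mod_divide _ _ l0)[k ->]; exists k; ring. Qed.

Lemma ordscanP f p M r sg k u : M <> Z0 -> r <> Z0 ->
  ordscan f p M r sg (Z.mul M r) u -> cong (Z.mul M r) u (Z.pow p (Z.of_nat k)) ->
  (forall i, (i < f)%N -> cong M (Z.add (Z.pow p (Z.of_nat (k + i))) sg) Z0 ->
    Z.lt 1 r /\ cong r (Z.add (Z.pow p (Z.of_nat (k + i))) sg) Z0) /\
  cong (Z.mul M r) (Z.pow p (Z.of_nat (k + f))) 1.
Proof.
move=> M0 r0; elim: f k u => [|f IH] k u; rewrite /ordscan -/ordscan.
  by move=> /Z.eqb_eq ->; rewrite addn0; split=> //; apply: cong_sym.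
case: ifP => // cond hs uE.
have uE' : cong (Z.mul M r) (Z.modulo (Z.mul u p) (Z.mul M r)) (Z.pow p (Z.of_nat k.+1)).
  by apply: cong_mod; rewrite Zpow_succ (Z.mul_comm p); apply: cong_mul => //; apply: cong_refl.
have [h1 h2] := IH _ _ hs uE'; rewrite addnS; split=> // -[_|i]; last first.
  by rewrite ltnS addnS => /h1.
rewrite addn0 => cM; move: cond.
have uM : cong M (Z.add u sg) Z0.
  by apply: cong_trans cM; apply: cong_add; [apply: cong_mull uE|apply: cong_refl].
rewrite (cong_eq0 uM) Z.eqb_refl; case: Z.ltb_spec => // r1 /Z.eqb_eq ur; split=> //.
apply: cong_trans (mod_cong0 r0 ur).
by apply: cong_add; [apply/cong_sym/(cong_mulr uE)|apply: cong_refl].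
Qed.

(* If [q ^ Y] divided [p ^ x + sg], then so would [r], as the scan shows over one
   period of [p] modulo [q ^ Y * r]. *)
Lemma ordscan_pow f p M r sg x : M <> Z0 -> r <> Z0 -> (0 < f)%N ->
  ordscan f p M r sg (Z.mul M r) 1 ->
  cong M (Z.add (Z.pow p (Z.of_nat x)) sg) Z0 ->
  Z.lt 1 r /\ cong r (Z.add (Z.pow p (Z.of_nat x)) sg) Z0.
Proof.
move=> M0 r0 f0 hs.
have [h1 h2] := ordscanP (k := 0) M0 r0 hs (cong_refl _ _); rewrite add0n in h2.
have per t i : cong (Z.mul M r) (Z.pow p (Z.of_nat (f * t + i))) (Z.pow p (Z.of_nat i)).
  elim: t => [|t IH]; first by rewrite muln0; apply: cong_refl.
  rewrite mulnS -addnA Nat2Z.inj_add Z.pow_add_r; [|exact: Zle_0_nat|exact: Zle_0_nat].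
  apply: cong_trans (IH); rewrite -[X in cong _ _ X]Z.mul_1_l.
  by apply: cong_mul => //; apply: cong_refl.
rewrite (divn_eq x f) mulnC; set i := (x %% f)%N; set t := (x %/ f)%N => xM.
have := h1 i (ltn_pmod _ f0); rewrite add0n => h3.
case: h3 => [|r1 ri].
  apply: cong_trans xM; apply: cong_sym.
  by apply: cong_add; [apply: cong_mull (per t i)|apply: cong_refl].
split=> //; apply: cong_trans ri.
by apply: cong_add; [apply: cong_mulr (per t i)|apply: cong_refl].
Qed.

Definition smooth19 (A : nat) := forall q, prime q -> (q %| A)%N -> (q <= 19)%N.

Fixpoint sqmod (fuel : nat) (A u : Z) : Z :=
  if fuel is f.+1 then sqmod f A (Z.modulo (Z.mul u u) A) else u.

(** Five squarings decide whether [A] divides [P ^ 32]. For [A < 2 ^ 32] all exponents in [A] are at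
    most 31, so this tests, without factoring, whether every prime factor of [A] divides [P]. *)
Definition smoothZ (P A : Z) : bool := Z.eqb (sqmod 5 A (Z.modulo P A)) 0.

Lemma sqmodP f A u x j : cong A u (Z.pow x (Z.of_nat j)) ->
  cong A (sqmod f A u) (Z.pow x (Z.of_nat (j * 2 ^ f))).
Proof.
elim: f j u => [|f IH] j u uE /=; first by rewrite expn0 muln1.
rewrite expnS mulnA; apply: IH; apply: cong_mod.
rewrite (_ : (j * 2)%N = (j + j)%N); last by rewrite muln2 addnn.
rewrite Nat2Z.inj_add Z.pow_add_r; [|exact: Zle_0_nat|exact: Zle_0_nat].
exact: cong_mul.
Qed.

Lemma smoothZP P A : (0 < P)%N -> (0 < A)%N -> Z.lt (Z.of_nat A) (Z.pow 2 32) ->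
  (forall q, prime q -> (q %| A)%N -> (q %| P)%N) -> smoothZ (Z.of_nat P) (Z.of_nat A).
Proof.
move=> P0 A0 A32 AP; apply/Z.eqb_eq.
have Az : Z.of_nat A <> Z0 by clear -A0; lia.
have h : cong (Z.of_nat A) (Z.modulo (Z.of_nat P) (Z.of_nat A)) (Z.pow (Z.of_nat P) (Z.of_nat 1)).
  by apply: cong_mod; rewrite Z.pow_1_r; apply: cong_refl.
have := sqmodP 5 h; set s := sqmod _ _ _; rewrite mul1n -Zpow_nat => sE.
have : cong (Z.of_nat A) s Z0.
  apply: (cong_trans sE); apply: mod_cong0 => //; apply/(zmod_dvdn _ A0).
  apply: dvdn_of_logn => //; first by rewrite expn_gt0 P0.
  move=> q pq; case: (posnP (logn q A)) => [->//|]; rewrite logn_gt0 mem_primes => /and3P[_ _ qA].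
  apply: (@leq_trans 32); last first.
    by rewrite lognX -{1}[32%N]muln1 leq_mul2l logn_gt0 mem_primes pq P0 AP.
  have h1 : (2 ^ logn q A <= A)%N.
    apply: leq_trans (_ : q ^ logn q A <= A)%N; last by apply/dvdn_leq/pfactor_dvdnn.
    by rewrite leq_exp2r ?prime_gt1 //; rewrite logn_gt0 mem_primes pq A0.
  rewrite leqNgt; apply/negP => big.
  have : (2 ^ 32 <= 2 ^ logn q A)%N by rewrite leq_exp2l // ltnW.
  move=> /leq_trans/(_ h1); rewrite leqNgt => /negP; apply.
  have E : Z.of_nat (2 ^ 32) = Z.pow 2 32 by rewrite Zpow_nat.
  by move: A32; rewrite -E; move: (2 ^ 32)%N => y; clear; lia.
have sA : Z.le 0 s /\ Z.lt s (Z.of_nat A).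
  by apply: Z.mod_pos_bound; clear -A0; lia.
move=> [k kE]; have k0 : k = Z0 by clear -kE sA A0; nia.
by rewrite kE k0.
Qed.

Definition zrow (q Y L : nat) (r : Z) := (q, Y, L, r).
Definition zcase (p : nat) (plus : bool) (W : Z) (rows : seq (nat * nat * nat * Z)) :=
  (p, plus, W, rows).

(* The columns of a row are [q], [Y], the order of [p] modulo [q ^ Y] and a prime
   factor [r > 19] of the first [p ^ i +- 1] divisible by [q ^ Y] ([r = 1] if there is none). *)
Definition ord_table := [::
  zcase 2 false 69615 [:: zrow 3 3 18 73; zrow 5 2 20 31; zrow 7 2 21 127; zrow 11 1 10 31; zrow 13 2 156 53; zrow 17 2 136 137; zrow 19 1 18 73];
  zcase 2 true 6235515 [:: zrow 3 4 54 87211; zrow 5 2 20 41; zrow 7 1 3 1; zrow 11 2 110 683; zrow 13 2 156 53; zrow 17 2 136 354689; zrow 19 2 342 571];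
  zcase 3 false 880880 [:: zrow 2 5 8 41; zrow 5 2 20 61; zrow 7 2 42 43; zrow 11 3 55 23; zrow 13 2 39 313; zrow 17 1 16 41; zrow 19 1 18 37];
  zcase 3 true 140 [:: zrow 2 3 2 1; zrow 5 2 20 1181; zrow 7 2 42 43; zrow 11 1 5 1; zrow 13 1 3 1; zrow 17 1 16 193; zrow 19 1 18 37];
  zcase 5 false 624 [:: zrow 2 5 8 313; zrow 3 2 6 31; zrow 7 1 6 31; zrow 11 1 5 71; zrow 13 2 52 53; zrow 17 1 16 313; zrow 19 1 9 31];
  zcase 5 true 1638 [:: zrow 2 2 1 1; zrow 3 3 18 5167; zrow 7 2 42 29; zrow 11 1 5 1; zrow 13 2 52 53; zrow 17 1 16 11489; zrow 19 1 9 1];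
  zcase 7 false 136800 [:: zrow 2 6 8 1201; zrow 3 3 9 37; zrow 5 3 20 191; zrow 11 1 10 191; zrow 13 1 12 43; zrow 17 1 16 1201; zrow 19 2 57 419];
  zcase 7 true 200 [:: zrow 2 4 2 1; zrow 3 1 1 1; zrow 5 3 20 281; zrow 11 1 10 191; zrow 13 1 12 181; zrow 17 1 16 169553; zrow 19 1 3 1];
  zcase 11 false 15960 [:: zrow 2 4 4 61; zrow 3 2 6 37; zrow 5 2 5 3221; zrow 7 2 21 43; zrow 13 1 12 37; zrow 17 1 16 61; zrow 19 2 57 9052693406816244798830758398634455607137532680609093871];
  zcase 11 true 12 [:: zrow 2 3 2 1; zrow 3 2 6 37; zrow 5 1 1 1; zrow 7 1 3 1; zrow 13 1 12 61; zrow 17 1 16 6304673; zrow 19 1 3 1];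
  zcase 13 false 28560 [:: zrow 2 5 8 14281; zrow 3 2 3 61; zrow 5 2 20 421; zrow 7 2 14 29; zrow 11 1 10 2411; zrow 17 2 68 103; zrow 19 1 18 61];
  zcase 13 true 1190 [:: zrow 2 2 1 1; zrow 3 1 1 1; zrow 5 2 20 421; zrow 7 2 14 29; zrow 11 1 10 2411; zrow 17 2 68 1021; zrow 19 1 18 157];
  zcase 17 false 288 [:: zrow 2 6 4 29; zrow 3 3 6 307; zrow 5 1 4 29; zrow 7 1 6 307; zrow 11 1 10 71; zrow 13 1 6 307; zrow 19 1 9 307];
  zcase 17 true 4914 [:: zrow 2 2 1 1; zrow 3 4 18 1423; zrow 5 1 4 29; zrow 7 2 42 2008603230217126951591; zrow 11 1 10 71; zrow 13 2 78 53; zrow 19 1 9 1];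
  zcase 19 false 360 [:: zrow 2 4 4 181; zrow 3 3 3 127; zrow 5 2 10 151; zrow 7 1 6 127; zrow 11 1 10 151; zrow 13 1 12 127; zrow 17 1 8 181];
  zcase 19 true 6860 [:: zrow 2 3 2 1; zrow 3 1 1 1; zrow 5 2 10 2251; zrow 7 4 42 43; zrow 11 1 10 2251; zrow 13 1 12 181; zrow 17 1 8 3833]].

Definition row_ok (p : nat) (sg W : Z) (row : nat * nat * nat * Z) : bool :=
  let: (q, Y, L, r) := row in
  let M := Z.pow (Z.of_nat q) (Z.of_nat Y) in
  [&& (0 < L)%N, (0 < Y)%N, Z.leb 1 r, Z.eqb (Z.gcd r 9699690) 1,
      Z.eqb (Z.modulo W (Z.pow (Z.of_nat q) (Z.of_nat Y.-1))) 0 &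
      ordscan L (Z.of_nat p) M r sg (Z.mul M r) 1].

(** 28561 is [13 ^ 4], and [13 ^ 4 - 1] is 19-smooth; no larger power of [p] up to [W + 1] has a
    19-smooth neighbour on the side of [sg]. The constant 9699690 is the product of the primes up to
    19, and exponents below 25 suffice since [W + 1 < 2 ^ 25]. *)
Definition bound_ok (p : nat) (sg W : Z) : bool :=
  all (fun x => let u := Z.pow (Z.of_nat p) (Z.of_nat x) in
    if Z.leb u 28561 then true else
    if Z.leb u (Z.add W 1) then ~~ smoothZ 9699690 (Z.add u sg) else true) (iota 0 25).

Definition primes19 : seq nat := [:: 2; 3; 5; 7; 11; 13; 17; 19]%N.

Lemma ord_table_ok : all (fun t => let: (p, plus, W, rows) := t in
  let sg := if plus then Zpos xH else Zneg xH in
  [&& map (fun row => row.1.1.1) rows == [seq q <- primes19 | q != p],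
      Z.ltb 0 W, Z.ltb (Z.add W 1) (Z.pow 2 25), all (row_ok p sg W) rows & bound_ok p sg W]) ord_table.
Proof. vm_cast_no_check (erefl true). Qed.

Lemma primes19P q : prime q -> (q <= 19)%N -> q \in primes19.
Proof. by move=> pq q19; move: q q19 pq; do 20?[case=> //]. Qed.

Lemma smooth19_dvd A q : smooth19 A -> prime q -> (q %| A)%N ->
  (q %| Z.to_nat 9699690)%N.
Proof.
move=> sA pq qA; have := primes19P pq (sA _ pq qA); rewrite /primes19 !inE.
have q0 := prime_gt0 pq.
move=> h; apply/(zmod_dvdn _ q0); rewrite Z2Nat.id //.
by move: h; do 7?[case/orP=> [/eqP->|] //]; move=> /eqP ->.
Qed.

Lemma smoothZ19 A : smooth19 A -> (0 < A)%N -> Z.lt (Z.of_nat A) (Z.pow 2 32) ->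
  smoothZ 9699690 (Z.of_nat A).
Proof.
move=> sA A0 A32; rewrite -[X in smoothZ X _]Z2Nat.id; last by [].

have P0 : (0 < Z.to_nat 9699690)%N by apply/ssrnat.ltP/(Pos2Nat.is_pos 9699690).
by apply: (smoothZP P0 A0 A32) => q; apply: smooth19_dvd.
Qed.

Lemma gcd_smooth19 r A : Z.lt 1 r -> Z.gcd r 9699690 = Zpos xH -> (0 < A)%N -> smooth19 A ->
  ~ cong r (Z.of_nat A) Z0.
Proof.
move=> r1 rg A0 sA [k kE].
have n1 : (1 < Z.to_nat r)%N by clear -r1; lia.
have pp := pdiv_prime n1; have pr := pdiv_dvd (Z.to_nat r); set p := pdiv _ in pp pr.
have rA : (Z.to_nat r %| A)%N.
  by apply/dvdnP; exists (Z.to_nat k); clear -kE r1 A0; nia.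
have pP := smooth19_dvd sA pp (dvdn_trans pr rA).
have : Z.divide (Z.of_nat p) 1.
  rewrite -rg; apply: Z.gcd_greatest.
    have /dvdnP[q qE] := pr; exists (Z.of_nat q); clear -qE r1; lia.
  have /dvdnP[q qE] := pP; exists (Z.of_nat q).
  by rewrite -Nat2Z.inj_mul -[(_ * _)%coq_nat]/(q * p)%N -qE Z2Nat.id.
move=> /Z.divide_1_r_nonneg; have := prime_gt1 pp; clear; lia.
Qed.

(** [A] is prime to [p], and the table bounds the exponent in [A] of each other prime [q]: the power
    [q ^ Y] either never divides [p ^ x +- 1] or brings in a factor [r] prime to all primes up to
    19. Hence [A] divides [W], and finitely many [x] remain. *)
Lemma near_smooth19 p x A (plus : bool) : prime p -> (p <= 19)%N -> (0 < A)%N -> smooth19 A ->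
  Z.of_nat A = Z.add (Z.of_nat (p ^ x)) (if plus then Zpos xH else Zneg xH) ->
  Z.leb (Z.of_nat (p ^ x)) 28561.
Proof.
move=> pp p19 A0 sA; set sg := (if _ then _ else _) => AE.
case: (posnP x) => [->//|x0].
have [W [rows tin]] : exists W rows, (p, plus, W, rows) \in ord_table.
  have /mapP [[[[p' plus'] W] rows] tin [-> ->]] : (p, plus) \in [seq t.1.1 | t <- ord_table].
    by have := primes19P pp p19; case: plus {sg AE}; rewrite /primes19 !inE;
      do 7?[case/orP=> [/eqP->|] //]; move=> /eqP ->.
  by exists W, rows.
have := allP ord_table_ok _ tin; rewrite -/sg => /and5P[/eqP cols W0 W25 /allP rok bok].
have pA : ~~ (p %| A)%N.
  apply/negP => pA; have px : (p %| p ^ x)%N by rewrite dvdn_exp.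
  have : (p %| 1)%N.
    case: plus @sg AE {tin bok rok} => /= AE.
      have AE' : A = (p ^ x + 1)%N by clear -AE; lia.
      by move: pA; rewrite AE' dvdn_addr.
    have AE' : (p ^ x = A + 1)%N by clear -AE; lia.
    by move: px; rewrite AE' dvdn_addr.
  by rewrite dvdn1 => /eqP p1; rewrite p1 in pp.
have Wnat : Z.of_nat (Z.to_nat W) = W by apply: Z2Nat.id; clear -W0; lia.
have AW : (A %| Z.to_nat W)%N.
  apply: dvdn_of_logn => //; first by clear -W0; lia.
  move=> q pq; case: (posnP (logn q A)) => [->//|].
  rewrite logn_gt0 mem_primes => /and3P[_ _ qA].
  have qp : q != p by apply: contraNneq pA => <-.
  have : q \in [seq row.1.1.1 | row <- rows].
    by rewrite cols mem_filter qp; apply: primes19P => //; apply: sA.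
  move=> /mapP[[[[q' Y] L] r] rin /= qE]; subst q'.
  have := rok _ rin => /andP[L0] /and5P[Y0 r1 /Z.eqb_eq rg /Z.eqb_eq qW scan].
  have q0 := prime_gt0 pq.
  have YE : (Y = Y.-1.+1)%N by clear -Y0; lia.
  apply: (@leq_trans Y.-1); last first.
    rewrite -pfactor_dvdn //; last by clear -W0; lia.
    by apply/(zmod_dvdn _); rewrite ?expn_gt0 ?q0 // Wnat Zpow_nat.
  rewrite leqNgt; apply/negP; rewrite -YE -pfactor_dvdn //.
  move=> /zmod_dvdn; rewrite expn_gt0 q0 Zpow_nat => /(_ isT) qYA.
  have M0 : Z.pow (Z.of_nat q) (Z.of_nat Y) <> Z0.
    by rewrite -Zpow_nat; have := expn_gt0 q Y; rewrite q0 => h; clear -h; lia.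
  have r0 : r <> Z0 by clear -r1; lia.
  have [] := ordscan_pow (x := x) M0 r0 L0 scan.
    by rewrite -(Zpow_nat p) -AE; apply: mod_cong0.
  by rewrite -(Zpow_nat p) -AE => r1'; apply: gcd_smooth19.
have AW' : Z.le (Z.of_nat A) W.
  by have := dvdn_leq _ AW; clear -W0; lia.
have uW : Z.le (Z.of_nat (p ^ x)) (Z.add W 1).
  by move: AE AW'; rewrite /sg; clear; case: (plus); lia.
have x25 : x \in iota 0 25.
  rewrite mem_iota /= add0n ltnNge; apply/negP => hx.
  have h : (2 ^ 25 <= p ^ x)%N.
    apply: (@leq_trans (2 ^ x)%N); first by rewrite leq_exp2l.
    by rewrite leq_exp2r // prime_gt1.
  have E : Z.of_nat (2 ^ 25) = Z.pow 2 25 by rewrite Zpow_nat.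
  by move: h uW W25; rewrite -E; move: (2 ^ 25)%N (p ^ x)%N => y z; clear; lia.
have := allP bok _ x25; cbv zeta; rewrite -Zpow_nat.
case: ifP => // _; case: Z.leb_spec => [_|h]; last by move: h uW; clear; lia.
rewrite -AE => /negP[]; apply: smoothZ19 => //.
apply: Z.le_lt_trans AW' _; clear -W25.
have : Z.lt (Z.add W 1) (Z.pow 2 25) by apply/Z.ltb_lt.
by move=> h; apply: Z.lt_trans (_ : Z.lt W (Z.pow 2 25)) _; [lia|].
Qed.

(** Erdos's choice: [L q] will be the term where [q] has its largest exponent. In any other term
    [N - l] the power of [q] divides the distance from [l] to [L q], so it is below [k]. *)
Lemma argmax_window (f : nat -> nat -> nat) k : (0 < k)%N ->
  exists L : nat -> nat, forall q, (L q < k)%N /\ forall l, (l < k)%N -> (f q l <= f q (L q))%N.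
Proof.
case: k => [//|k] _.
exists (fun q => [arg max_(i > (ord0 : 'I_k.+1)) f q i] : nat) => q.
split=> // l lk; case: arg_maxnP => // i _ /(_ (Ordinal lk) isT); exact.
Qed.

(** Subtraction being truncated, the sum [(l - t) + (t - l)] is the distance between [l] and [t]. *)
Lemma dvdn_dist d N l t : (l <= N)%N -> (t <= N)%N -> (d %| N - l)%N -> (d %| N - t)%N ->
  (d %| (l - t) + (t - l))%N.
Proof.
move=> lN tN dl dt; case: (leqP l t) => lt.
  rewrite (eqP lt) add0n (_ : t - l = (N - l) - (N - t))%N; first exact: dvdn_sub.
  by clear -lN tN lt; lia.
rewrite (_ : t - l = 0)%N; last by clear -lt; lia.
rewrite addn0 (_ : l - t = (N - t) - (N - l))%N; first exact: dvdn_sub.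
by clear -lN tN lt; lia.
Qed.

Definition small_pairs : seq (nat * nat) := [:: (2, 3); (2, 5); (2, 7); (3, 5); (3, 7); (5, 7)]%N.

Definition two_small (k m : nat) : bool :=
  has (fun q => (q.2 < k) && (q.1 * q.2 %| m))%N small_pairs.

(* A term divisible by two primes below [k] is useless for the argument; there are at most
   [max_two_small k] of them. *)
Definition max_two_small (k : nat) : nat := nth 0%N [:: 0; 0; 0; 0; 1; 1; 3; 4; 7; 7]%N k.

Definition two_smallZ (k : nat) (m : Z) : bool :=
  has (fun q => if (q.2 < k)%N then Z.eqb (Z.modulo m (Z.of_nat (q.1 * q.2))) 0 else false) small_pairs.

(** Only the residue of [N] modulo [210 = 2 * 3 * 5 * 7] matters, since the primes below [k <= 9]
    are at most 7. *)
Lemma max_two_small_ok : all (fun k => all (fun r =>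
   count (fun l => two_smallZ k (Z.sub (Z.add r 210) (Z.of_nat l))) (iota 0 k) <= max_two_small k)%N
  (Zrange 0 210)) [:: 3; 4; 5; 6; 7; 8; 9]%N.
Proof. vm_cast_no_check (erefl true). Qed.

Lemma count_two_small k N : k \in [:: 3; 4; 5; 6; 7; 8; 9]%N -> (k <= N)%N ->
  (count (fun l => two_small k (N - l)) (iota 0 k) <= max_two_small k)%N.
Proof.
move=> kin kN; pose r := Z.modulo (Z.of_nat N) 210.
have r0 : Z.le 0 r /\ Z.lt r 210 by apply: Z.mod_pos_bound.
have rin : r \in Zrange 0 210.
  by apply: (@Zrange_mem 0 209); case: r0; clear; lia.
have := allP (allP max_two_small_ok _ kin) _ rin; apply: leq_trans.
apply/eq_leq/eq_in_count => l; rewrite mem_iota /= add0n => lk.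
apply: eq_in_has => q qin; case: (q.2 < k)%N => //=.
have q210 : (q.1 * q.2 %| 210)%N /\ (0 < q.1 * q.2)%N.
  by move: qin; rewrite !inE; do 5?[case/orP=> [/eqP->|] //]; move=> /eqP ->.
case: q210 => /dvdnP[w wE] d0; set d := (q.1 * q.2)%N in wE d0 *.
have rE : r = Z.sub (Z.of_nat N) (Z.mul 210 (Z.div (Z.of_nat N) 210)).
  by rewrite /r Z.mod_eq.
have wZ : Z.mul (Z.of_nat w) (Z.of_nat d) = 210 by clear -wE; lia.
have E : Z.sub (Z.add r 210) (Z.of_nat l) = Z.add (Z.of_nat (N - l))
   (Z.mul (Z.mul (Z.sub 1 (Z.div (Z.of_nat N) 210)) (Z.of_nat w)) (Z.of_nat d)).
  have -> : Z.of_nat (N - l) = Z.sub (Z.of_nat N) (Z.of_nat l) by clear -kN lk; lia.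
  by rewrite rE -Z.mul_assoc wZ; ring.
rewrite E Z_mod_plus_full.
by apply/idP/Z.eqb_spec => /zmod_dvdn; apply.
Qed.

Definition prime_powers19 : seq Z :=
  flatten [seq [seq u <- [seq Z.pow (Z.of_nat p) (Z.of_nat x) | x <- iota 0 15] | Z.leb u 28561]
          | p <- primes19].

(** The two outcomes of the pigeonhole: either [N - l] divides [840 = lcm(1, ..., 8)], so that
    [N <= 848], or [N - l = c * p ^ x] with [c < 9] and [p ^ x <= 28561]. *)
Definition window_cands : seq Z :=
  Zrange 1 848 ++ flatten [seq flatten [seq [seq Z.add (Z.mul c m) (Z.of_nat l) | l <- iota 0 9]
    | m <- prime_powers19] | c <- map Z.of_nat [:: 1; 2; 3; 4; 5; 6; 7; 8]%N].

Lemma mem_prime_powers19 p x : prime p -> (p <= 19)%N -> Z.leb (Z.of_nat (p ^ x)) 28561 ->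
  Z.of_nat (p ^ x) \in prime_powers19.
Proof.
move=> pp p19 px; apply/flattenP.
exists [seq u <- [seq Z.pow (Z.of_nat p) (Z.of_nat x) | x <- iota 0 15] | Z.leb u 28561].
  by apply/mapP; exists p => //; apply: primes19P.
rewrite mem_filter px; apply/mapP; exists x; last exact: Zpow_nat.
rewrite mem_iota /= add0n ltnNge; apply/negP => hx.
have h : (2 ^ 15 <= p ^ x)%N.
  apply: (@leq_trans (2 ^ x)%N); first by rewrite leq_exp2l.
  by case: x hx {px} => [|x] // _; rewrite leq_exp2r // prime_gt1.
have E : Z.of_nat (2 ^ 15) = Z.pow 2 15 by rewrite Zpow_nat.
have E2 : Z.lt 28561 (Z.pow 2 15) by [].
by move: h px E2; rewrite -E; move: (2 ^ 15)%N (p ^ x)%N => y z; clear; lia.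
Qed.

Lemma mem_window_cands c m l N : (0 < c < 9)%N -> (l < 9)%N -> Z.of_nat m \in prime_powers19 ->
  N = (c * m + l)%N -> Z.of_nat N \in window_cands.
Proof.
move=> /andP[c0 c8] l8 mP NE; rewrite mem_cat; apply/orP; right.
apply/flattenP; exists (flatten [seq [seq Z.add (Z.mul (Z.of_nat c) m) (Z.of_nat l) | l <- iota 0 9]
    | m <- prime_powers19]).
  apply/mapP; exists (Z.of_nat c) => //; apply/mapP; exists c => //.
  by move: c c0 c8 {NE}; do 9?[case=> //].
apply/flattenP; exists [seq Z.add (Z.mul (Z.of_nat c) (Z.of_nat m)) (Z.of_nat l) | l <- iota 0 9].
  by apply/mapP; exists (Z.of_nat m).
apply/mapP; exists l; first by rewrite mem_iota.
by rewrite NE Nat2Z.inj_add Nat2Z.inj_mul.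
Qed.

Section Window.
Variables (k N : nat) (P : seq nat).
Hypothesis kin : k \in [:: 3; 4; 5; 6; 7; 8; 9]%N.
Hypothesis kN : (2 * k <= N)%N.
Hypothesis Pprime : forall q, q \in P -> prime q /\ (q <= 19)%N.
Hypothesis Psmooth : forall l q, (l < k)%N -> prime q -> (q %| N - l)%N -> q \in P.
Hypothesis Psize : (size P + max_two_small k < 2 * k)%N.

(** If each term carried two primes, or one prime and in addition were [two_small], then [size P]
    plus the number of [two_small] terms would be at least [2 * k], against [Psize]. *)
Lemma window_sparse (L : nat -> nat) : (forall q, (L q < k)%N) ->
  exists2 l, (l < k)%N & count (fun q => L q == l) P = 0%N \/
    (count (fun q => L q == l) P = 1%N /\ ~~ two_small k (N - l)).
Proof.
move=> Lk.
have [/hasP[l]|/hasPn none] := boolP (has (fun l => (count (fun q => L q == l) P == 0%N) ||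
   ((count (fun q => L q == l) P == 1%N) && ~~ two_small k (N - l))) (iota 0 k)).
  rewrite mem_iota /= add0n => lk /orP[/eqP h|/andP[/eqP h1 h2]]; exists l => //.
    by left.
  by right.
have total : (\sum_(l <- iota 0 k) count (fun q => L q == l) P = size P)%N.
  transitivity (\sum_(l <- iota 0 k) \sum_(q <- P) (L q == l))%N.
    apply: eq_bigr => l _; rewrite -sum1_count [LHS]big_mkcond.
    by apply: eq_bigr => q _; case: ifP.
  rewrite exchange_big /= -sum1_size; apply: eq_bigr => q _.
  rewrite (bigD1_seq (L q)) ?iota_uniq ?mem_iota ?Lk //= eqxx big1 ?addn0 // => l.
  by rewrite eq_sym => /negbTE ->.
have low : (2 * k <= \sum_(l <- iota 0 k) (count (fun q => L q == l) P + two_small k (N - l)))%N.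
  rewrite -[k in (2 * k)%N](size_iota 0 k) -sum1_size big_distrr /=.
  rewrite !big_seq; apply: leq_sum => l /none; rewrite negb_or negb_and negbK.
  by case: (count _ P) => [|[|c]] //=; case: (two_small _ _).
rewrite big_split /= total -[X in (_ <= _ + X)%N]/(\sum_(l <- _) _)%N in low.
have E : (\sum_(l <- iota 0 k) two_small k (N - l) = count (fun l => two_small k (N - l)) (iota 0 k))%N.
  by rewrite -sum1_count [RHS]big_mkcond; apply: eq_bigr => l _; case: ifP.
have kN' : (k <= N)%N by move: kN; clear; lia.
have := count_two_small kin kN'; rewrite -E => b.
by move: low b Psize; clear; lia.
Qed.

Lemma window_mem_cands : Z.of_nat N \in window_cands.
Proof.
have k0 : (0 < k)%N by move: kin; rewrite !inE; case: (k).
have k8 : (k <= 9)%N by move: kin; rewrite !inE; do 6?[case/orP=> [/eqP->|] //]; move=> /eqP->.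
have [L HL] := argmax_window (fun q l => logn q (N - l)) k0.
have Lk q : (L q < k)%N by case: (HL q).
have Npos l : (l < k)%N -> (0 < N - l)%N by move=> lk; move: kN; clear -lk; lia.
have lN l : (l < k)%N -> (l <= N)%N by move=> lk; move: kN; clear -lk; lia.
have dist q l : prime q -> (l < k)%N -> (q ^ logn q (N - l) %| (l - L q) + (L q - l))%N.
  move=> pq lk; apply: (dvdn_dist (lN _ lk) (lN _ (Lk q))); first exact: pfactor_dvdnn.
  rewrite pfactor_dvdn ?Npos //; by case: (HL q) => _; apply.
have small q l : prime q -> (l < k)%N -> L q != l -> (q ^ logn q (N - l) < k)%N.
  move=> pq lk Ll; have := dvdn_leq _ (dist q l pq lk).
  by have := Lk q; move: Ll lk; clear; lia.
have primes_N l q : (l < k)%N -> (0 < logn q (N - l))%N -> prime q /\ q \in P.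
  move=> lk; rewrite logn_gt0 mem_primes => /and3P[pq _ qN]; split=> //.
  exact: Psmooth qN.
have [l lk [c0|[c1 nbad]]] := window_sparse Lk.
  (* No prime has its chosen term at [l], so all prime powers in [N - l] are below [k <= 9] and
     divide [lcm(1, ..., 8)]. *)
  have : (N - l %| 840)%N.
    apply: dvdn_of_logn => //; first exact: Npos.
    move=> q pq; case: (posnP (logn q (N - l))) => [->//|v0].
    have [_ qP] := primes_N l q lk v0.
    have Ll : L q != l.
      apply/eqP => Lq; have : (0 < count (fun q => L q == l) P)%N.
        by rewrite -has_count; apply/hasP; exists q; rewrite ?Lq.
      by rewrite c0.
    have := small q l pq lk Ll; move: v0; move: (logn q (N - l)) => v v0 qv.
    have qv8 : (q ^ v < 9)%N by apply: leq_trans qv k8.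
    rewrite -pfactor_dvdn //.
    have q8 : (q < 9)%N.
      by apply: leq_ltn_trans qv8; rewrite -{1}(expn1 q) leq_exp2l // prime_gt1.
    have v3 : (v < 4)%N.
      have : (2 ^ v < 2 ^ 4)%N by apply: leq_ltn_trans (leq_trans qv8 (isT : (9 <= 2 ^ 4)%N)); rewrite leq_exp2r // prime_gt1.
      by rewrite ltn_exp2l.
    clear -pq q8 v3 v0 qv8; move: v v3 v0 q qv8 q8 pq.
    by do 4?[case=> //]; move=> _ _; do 9?[case=> //].
  move=> /dvdn_leq -/(_ isT) N840.
  rewrite mem_cat; apply/orP; left; apply: (@Zrange_mem 1 848); first by move: (Npos _ lk); clear; lia.
  by move: N840 lk k8; clear; lia.
(* If [c] divides the distance from [l] to another term, then [l - c] or [l + c] is still in the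
   window, and the term there is [c * (p ^ x + 1)] or [c * (p ^ x - 1)]. Its cofactor is 19-smooth,
   so [near_smooth19] bounds [p ^ x]. *)
have fin c p x t : prime p -> (p <= 19)%N -> (0 < c)%N -> (N - l = c * p ^ x)%N ->
    t != l -> (t < k)%N -> (c %| (l - t) + (t - l))%N -> Z.of_nat N \in window_cands.
  move=> pp p19 c_gt0 AE tl tk /dvdn_leq cd.
  have {cd} cd : (c <= (l - t) + (t - l))%N by apply: cd; move: tl; clear; lia.
  have c8 : (0 < c < 9)%N by move: cd lk tk k8 c_gt0; clear; lia.
  have l8 : (l < 9)%N by apply: leq_trans lk k8.
  have NE : N = (c * p ^ x + l)%N by rewrite -AE subnK // lN.
  apply: (mem_window_cands c8 l8 _ NE); apply: mem_prime_powers19 => //.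
  have sm l' B : (l' < k)%N -> (N - l' = c * B)%N -> smooth19 B.
    move=> l'k BE q pq qB; case: (@Pprime q) => //; apply: (Psmooth l'k) => //.
    by rewrite BE dvdn_mull.
  set m := (p ^ x)%N in AE *.
  case: (ltnP t l) => tl'.
    have l'k : (l - c < k)%N by move: lk; clear; lia.
    have E : (N - (l - c) = c * m.+1)%N.
      by rewrite mulnS -AE; move: (lN _ lk) cd tl'; clear; lia.
    apply: (@near_smooth19 p x m.+1 true) => //; first exact: sm E.
    by rewrite /m; clear; lia.
  have l'k : (l + c < k)%N by move: cd tl' tk c_gt0; clear; lia.
  have E : (N - (l + c) = c * m.-1)%N.
    by rewrite -subn1 mulnBr muln1 -AE; move: (lN _ l'k); clear; lia.
  have m1 : (0 < m.-1)%N by have := Npos _ l'k; rewrite E muln_gt0 => /andP[].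
  apply: (@near_smooth19 p x m.-1 false) => //; first exact: sm E.
  by move: m1; rewrite /m; clear; lia.
have [q0 q0E] : exists q0, [seq q <- P | L q == l] = [:: q0].
  by move: c1; rewrite -size_filter; case: (filter _ _) => [|q0 [|? ?]] // _; exists q0.
have q0P : q0 \in P.
  by have := mem_head q0 [::]; rewrite -q0E mem_filter => /andP[].
have [q0p q019] := Pprime q0P.
have other q : (0 < logn q (N - l))%N -> q != q0 -> L q != l.
  move=> v0 qq0; have [_ qP] := primes_N l q lk v0; apply: contraNneq qq0 => Lq.
  have : q \in [seq q <- P | L q == l] by rewrite mem_filter Lq eqxx.
  by rewrite q0E inE.
have small7 q : (0 < logn q (N - l))%N -> q != q0 -> (q < k)%N /\ q \in [:: 2; 3; 5; 7]%N.
  move=> v0 qq0; have [pq qP] := primes_N l q lk v0.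
  have qk : (q < k)%N.
    apply: leq_ltn_trans (small q l pq lk (other q v0 qq0)).
    by rewrite -{1}(expn1 q) leq_exp2l // prime_gt1.
  split=> //; have q8 := leq_trans qk k8.
  by clear -q8 pq; move: q q8 pq; do 9?[case=> //].
have A0 := Npos l lk.
(* Besides [q0], at most one prime [q1] divides [N - l]: such primes are below [k], and two of them
   would make the term [two_small]. Then [c] is the power of [q1]. *)
have [/hasP[q1 _ /andP[v1 q10]]|/hasPn none] :=
  boolP (has (fun q => (0 < logn q (N - l))%N && (q != q0)) [:: 2; 3; 5; 7]%N).
  have [pq1 _] := primes_N l q1 lk v1.
  have [q1k q1in] := small7 q1 v1 q10.
  refine (fin _ _ (logn q0 (N - l)) _ q0p q019 _ _ (other q1 v1 q10) (Lk q1) (dist _ _ pq1 lk)).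
  - by rewrite expn_gt0 prime_gt0.
  - have cop : coprime (q1 ^ logn q1 (N - l)) (q0 ^ logn q0 (N - l)).
      by apply/coprimeXl/coprimeXr; rewrite prime_coprime // dvdn_prime2.
    apply/eqP; rewrite eqn_dvd Gauss_dvd // !pfactor_dvdnn !andbT.
    have c0 : (0 < q1 ^ logn q1 (N - l))%N by rewrite expn_gt0 prime_gt0.
    have c0' : (0 < q0 ^ logn q0 (N - l))%N by rewrite expn_gt0 prime_gt0.
    apply: dvdn_of_logn => //; first by rewrite muln_gt0 c0.
    move=> q pq; rewrite lognM // !lognX.
    have [->|qq1] := eqVneq q q1; first by rewrite (logn_prime _ pq1) eqxx muln1 leq_addr.
    have [->|qq0] := eqVneq q q0; first by rewrite (logn_prime _ q0p) eqxx muln1 leq_addl.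
    case: (posnP (logn q (N - l))) => [->//|v0]; exfalso.
    have [qk qin] := small7 q v0 qq0.
    have qA : (q %| N - l)%N by move: v0; rewrite logn_gt0 mem_primes => /and3P[].
    have q1A : (q1 %| N - l)%N by move: v1; rewrite logn_gt0 mem_primes => /and3P[].
    have qq1A : (q * q1 %| N - l)%N.
      by rewrite Gauss_dvd ?qA // prime_coprime // dvdn_prime2.
    move: nbad; apply/negP; rewrite negbK; apply/hasP.
    exists (minn q q1, maxn q q1); last first.
      by rewrite /= gtn_max qk q1k /=; case: (leqP q q1) => _; rewrite // mulnC.
    by move: qin q1in qq1; clear; rewrite !inE;
      do 3?[case/orP=> [/eqP->|]]; (try move=> /eqP->);
      do 3?[case/orP=> [/eqP->|]]; (try move=> /eqP->).
(* Now [N - l] is a power of [q0], and any other term of the window serves with [c = 1]. *)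
refine (fin 1%N _ (logn q0 (N - l)) (if l == 0 then 1 else 0)%N q0p q019 isT _ _ _ (dvd1n _)).
- rewrite mul1n; apply/eqP; rewrite eqn_dvd pfactor_dvdnn andbT.
  have x0 : (0 < q0 ^ logn q0 (N - l))%N by rewrite expn_gt0 prime_gt0.
  apply: dvdn_of_logn => //.
  move=> q pq; rewrite lognX.
  have [->|qq0] := eqVneq q q0; first by rewrite (logn_prime _ q0p) eqxx muln1.
  case: (posnP (logn q (N - l))) => [->//|v0]; exfalso.
  have [_ qin] := small7 q v0 qq0; have := none q qin; by rewrite v0 qq0.
- by case: (l) => [|?].
- by move: kin; case: (l) => [|?] /=; case: (k) => [|[|?]].
Qed.
End Window.

(* The [N] such that [N], [N - 1] and [N - 2] are all 19-smooth. *)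
Definition smooth_triples : seq nat := [:: 6; 7; 8; 9; 10; 11; 12; 13; 14; 15; 16; 17; 18;
  19; 20; 21; 22; 26; 27; 28; 34; 35; 36; 40; 50; 51; 52; 56; 57; 65; 66; 77; 78; 100; 121;
  154; 170; 171; 210; 325; 352; 442; 2432]%N.

Lemma smooth_triples_ok : all (fun n =>
  if Z.ltb n (Z.pow 2 32) then if Z.leb n 5 then true else
  if smoothZ 9699690 n then if smoothZ 9699690 (Z.sub n 1) then if smoothZ 9699690 (Z.sub n 2)
  then n \in map Z.of_nat smooth_triples else true else true else true else false) window_cands.
Proof. vm_cast_no_check (erefl true). Qed.

(** For [k = 3] and [a >= 10] there are six primes up to [k + a], one too many for the pigeonhole;
    [excluded] makes the necessary reduction. *)
Definition window_primes (a k : nat) : seq nat :=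
  [seq p <- primes19 | if (p <= k + a)%N then
     if (4 < a)%N then if (k < 6)%N then ~~ excluded a k p else true else true else false].

Definition window_exceptions : seq (nat * nat * nat) := [::
  (2, 3, 8); (3, 3, 7); (4, 3, 6); (4, 3, 12); (4, 3, 46); (11, 3, 17); (12, 3, 14);
  (12, 3, 15); (12, 3, 16); (12, 3, 38); (12, 3, 53);
  (9, 4, 18); (10, 4, 17); (10, 4, 18); (10, 4, 56); (11, 4, 16); (11, 4, 17); (12, 4, 15);
  (12, 4, 16); (9, 5, 19); (10, 5, 18); (11, 5, 17); (12, 5, 16); (12, 5, 40)]%N.

Lemma window_exceptions_ok : all (fun k => all (fun a =>
  let P := window_primes a k in
  let PZ := foldr Z.mul (Zpos xH) (map Z.of_nat P) in
  if (size P + max_two_small k < 2 * k)%N then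
    all (fun N => if (2 * k + a <= N)%N then
      if all (fun l => smoothZ PZ (Z.of_nat (N - l))) (iota 0 k)
      then (a, k, N - a)%N \in window_exceptions else true else true) smooth_triples
  else false) (iota 0 13)) [:: 3; 4; 5; 6; 7; 8; 9]%N.
Proof. vm_cast_no_check (erefl true). Qed.

(* A row [(a, k, n, (p, d, sigma, j1, j2))] names an edge from [j1] to [j2] of the Newton
   polygon at [p], of slope [sigma / d] with [k < d]. *)
Definition edge_table : seq (nat * nat * nat * (nat * nat * nat * nat * nat)) := [::
  (3, 3, 7, (5, 5, 1, 2, 7)); (4, 3, 6, (3, 5, 3, 0, 5)); (4, 3, 12, (5, 5, 1, 1, 11));
  (11, 3, 17, (3, 15, 8, 1, 16)); (12, 3, 14, (13, 13, 1, 1, 14));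
  (12, 3, 15, (13, 13, 1, 1, 14)); (12, 3, 16, (7, 7, 1, 2, 16));
  (12, 3, 53, (13, 13, 1, 1, 53)); (9, 4, 18, (5, 15, 4, 1, 16));
  (10, 4, 17, (5, 15, 4, 0, 15)); (10, 4, 18, (5, 15, 4, 0, 15));
  (10, 4, 56, (11, 11, 1, 1, 56)); (11, 4, 16, (5, 7, 2, 0, 14));
  (11, 4, 17, (5, 7, 2, 0, 14)); (12, 4, 15, (13, 13, 1, 1, 14));
  (12, 4, 16, (7, 7, 1, 2, 16)); (9, 5, 19, (5, 15, 4, 1, 16));
  (10, 5, 18, (7, 7, 1, 4, 18)); (11, 5, 17, (5, 7, 2, 0, 14));
  (12, 5, 16, (7, 7, 1, 2, 16)); (12, 5, 40, (13, 13, 1, 1, 40))]%N.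

Definition edge_ok (t : nat * nat * nat * (nat * nat * nat * nat * nat)) : bool :=
  let: (a, k, n, (p, d, sigma, j1, j2)) := t in
  [&& p \in primes19, (k < d)%N, coprime d sigma, (j1 <= n)%N, (j2 <= n)%N,
      (n + j1 < k + j2)%N,
      (d * lfact p (j2 + a) + sigma * j1 == d * lfact p (j1 + a) + sigma * j2)%N &
      all (fun j => d * lfact p (j + a) + sigma * j1 <= d * lfact p (j1 + a) + sigma * j)%N
        (iota 0 n.+1)].

Lemma edge_table_ok : all edge_ok edge_table.
Proof. vm_cast_no_check (erefl true). Qed.

Lemma edge_table_false a k n v e G H : (a, k, n, v) \in edge_table -> ~ splits n a k e G H.
Proof.
case: v => [[[[p d] s] j1] j2] /(allP edge_table_ok).
case/and5P => pp kd cop j1n /and4P[j2n lt /eqP eq2 /allP le] S.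
have p_prime : prime p by move: pp; rewrite !inE; do 7?[case/orP=> [/eqP->|] //]; move=> /eqP->.
move: lt; rewrite ltnNge => /negP; apply.
apply: (split_edge S p_prime kd cop j1n j2n); rewrite -!lfactE // => j jn.
by rewrite -lfactE; apply: le; rewrite mem_iota.
Qed.

Lemma split_window_false n a k e G H (s : bool) : splits n a k e G H -> (a <= 12)%N ->
  (3 <= k <= 9)%N -> (2 * k <= n)%N -> (forall j, (0 < j < n)%N -> e j = (-1) ^+ s) -> False.
Proof.
move=> S a12 k38 kn es.
have kin : k \in [:: 3; 4; 5; 6; 7; 8; 9]%N.
  by clear -k38; move: k k38; do 10?[case=> //].
have ain : a \in iota 0 13 by rewrite mem_iota.
have k0 : (0 < k)%N by case/andP: k38; clear; lia.
have := allP (allP window_exceptions_ok _ kin) _ ain; cbv zeta.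
set P := window_primes a k; case: ifP => // Psize /allP exc.
have Pprime q : q \in P -> prime q /\ (q <= 19)%N.
  rewrite mem_filter => /andP[_]; rewrite !inE.
  by do 7?[case/orP=> [/eqP->|] //]; move=> /eqP->.
have Psmooth l q : (l < k)%N -> prime q -> (q %| n + a - l)%N -> q \in P.
  move=> lk pq qN; have qka := split_prime_le S pq k0 lk qN.
  rewrite mem_filter qka (split_excluded S pq k0 lk qN) !if_same /=.
  (* [k + a] is at most 21, and neither 20 nor 21 is prime. *)
  have q21 : (q <= 21)%N by move: qka k38 a12; clear; lia.
  by apply: primes19P => //; move: q21 pq; rewrite leq_eqVlt => /predU1P[->//|]; rewrite ltnS leq_eqVlt => /predU1P[->|].
have kN : (2 * k <= n + a)%N by move: kn; clear; lia.
have := window_mem_cands kin kN Pprime Psmooth Psize.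
move=> /(allP smooth_triples_ok); case: Z.ltb_spec => // N32.
case: Z.leb_spec => [N5|_]; first by move: N5 kn k38; clear; lia.
have Npos l : (l < k)%N -> (0 < n + a - l)%N by move: kn k0; clear; lia.
have Nlt l : Z.lt (Z.of_nat (n + a - l)) (Z.pow 2 32).
  by apply: Z.le_lt_trans N32; clear; lia.
have Nsm l : (l < k)%N -> smoothZ 9699690 (Z.of_nat (n + a - l)).
  move=> lk; apply: smoothZ19 => //; last exact: Npos.
  by move=> q pq qN; case: (Pprime q (Psmooth l q lk pq qN)).
have NZ l : (l < k)%N -> Z.of_nat (n + a - l) = Z.sub (Z.of_nat (n + a)) (Z.of_nat l).
  by move=> lk; have := Npos l lk; clear; lia.
have [k1 k2] : (1 < k)%N /\ (2 < k)%N by move: k38; clear; lia.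
have := Nsm 0%N k0; rewrite subn0 => ->.
have := Nsm 1%N k1; rewrite NZ // => ->; have := Nsm 2%N k2; rewrite NZ // => ->.
move=> /mapP[N Nin /Nat2Z.inj NE].
have := exc N Nin; rewrite -NE addnK (_ : 2 * k + a <= n + a)%N; last by rewrite leq_add2r.
have -> : all (fun l => smoothZ (foldr Z.mul (Zpos xH) (map Z.of_nat P)) (Z.of_nat (n + a - l))) (iota 0 k).
  apply/allP => l; rewrite mem_iota /= add0n => lk.
  have -> : foldr Z.mul (Zpos xH) (map Z.of_nat P) = Z.of_nat (foldr muln 1%N P).
    by elim: (P) => [//|p P' /= ->]; rewrite Nat2Z.inj_mul.
  apply: smoothZP => //; [|exact: Npos|].
    have : all (fun p => 0 < p)%N P by apply/allP => q /Pprime[/prime_gt0].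
    by elim: (P) => [//|p P' IH] /= /andP[p0 /IH]; rewrite muln_gt0 p0.
  move=> q pq /(Psmooth l q lk pq); elim: (P) => [//|p P' IH]; rewrite inE /=.
  by case/orP => [/eqP->|/IH h]; [apply: dvdn_mulr|apply: dvdn_mull].
move=> xin.
have : ((a, k, n) \in [seq t.1 | t <- edge_table]) || ((k == 3)%N && ((a, n) \in [:: (2, 8); (4, 46); (12, 38)]%N)).
  by move: xin; rewrite !inE; do 23?[case/orP=> [/eqP[-> -> ->]|] //]; move=> /eqP[-> -> ->].
case/orP => [/mapP[[[[a' k'] n'] v] tin [aE kE nE]]|/andP[/eqP k3 an]].
  by move: tin; rewrite -aE -kE -nE => /edge_table_false /(_ S).
by rewrite k3 in S; apply: split_cubic_false S es an.
Qed.

Local Open Scope nat_scope.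

(** * Binomial coefficients with small prime factors *)

Lemma leq_exp2r_w m n k : m <= n -> m ^ k <= n ^ k.
Proof. by move=> mn; case: k => // k; rewrite leq_exp2r. Qed.

(** Bernoulli's inequality [(1 - 1 / (N + 1)) ^ (k + 1) >= 1 - (k + 1) / (N + 1)], cleared of
    denominators. *)
Lemma bernoulli_pred N k : N.+1 ^ k * (N - k) <= N ^ k.+1.
Proof.
elim: k => [|k IH]; first by rewrite mul1n subn0.
have h : N.+1 * (N - k.+1) <= N * (N - k).
  case: (leqP N k) => Nk; first by rewrite (_ : N - k.+1 = 0) ?muln0 //; lia.
  have -> : N - k = (N - k.+1).+1 by lia.
  rewrite mulSn mulnS addnC [X in _ <= X]addnC leq_add2l; lia.
rewrite expnSr -mulnA; apply: leq_trans (leq_mul (leqnn _) h) _.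
by rewrite mulnCA [X in _ <= X]expnS leq_mul2l IH orbT.
Qed.

(* The ratio [C(N, k) / N ^ k] is nondecreasing in [N], by Bernoulli's inequality. *)
Lemma bin_pow_mono k B N : B <= N -> 'C(B, k) * N ^ k <= 'C(N, k) * B ^ k.
Proof.
case: k => [|k]; first by rewrite !bin0.
move/subnK <-; elim: (N - B) => [|d IH]; first by rewrite add0n.
rewrite addSn; set M := d + B in IH *.
case: (posnP M) => [M0|Mpos].
  have -> : B = 0 by move: M0; rewrite /M; lia.
  by rewrite bin0n.
have step : 'C(M, k.+1) * M.+1 ^ k.+1 <= 'C(M.+1, k.+1) * M ^ k.+1.
  case: (ltnP M k.+1) => Mk; first by rewrite (bin_small Mk).
  have E := mul_bin_down M.+1 k.+1; rewrite /= subSS in E.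
  rewrite -(leq_pmul2l (_ : 0 < M - k)); last by rewrite subn_gt0.
  rewrite [X in _ <= X]mulnA -E.
  have := leq_mul (leqnn (M.+1 * 'C(M, k.+1))) (bernoulli_pred M k).
  by rewrite [M.+1 ^ k.+1]expnS; apply: leq_trans; apply/eq_leq; ring.
have M0 : 0 < M ^ k.+1 by rewrite expn_gt0 Mpos.
rewrite -(leq_pmul2r M0).
have := leq_mul IH (leqnn (M.+1 ^ k.+1)); have := leq_mul step (leqnn (B ^ k.+1)).
move=> h1 h2; have := leq_trans (_ : _ <= 'C(M, k.+1) * B ^ k.+1 * M.+1 ^ k.+1) (_ : _ <= _).
apply; first by apply: leq_trans h2; apply/eq_leq; ring.
by rewrite mulnAC; apply: leq_trans h1 _; apply/eq_leq; ring.
Qed.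

Lemma central_bin_ge k : 0 < k -> 4 ^ k <= 2 * k * 'C(2 * k, k).
Proof.
case: k => // k _; elim: k => [//|k IH].
have E1 := mul_bin_diag (2 * k.+2) k.+1; have E2 := mul_bin_down (2 * k.+1).+1 k.+1.
have e1 : (2 * k.+2).-1 = (2 * k.+1).+1 by lia.
have e2 : (2 * k.+1).+1 - k.+1 = k.+2 by lia.
rewrite e1 in E1; rewrite /= e2 in E2.
rewrite expnS; apply: leq_trans (leq_mul (leqnn 4) IH) _.
move: E1 E2; move: ('C(_, _)) ('C(_.+1, _)) ('C(2 * k.+2, _)) => x y z.
move=> E1 E2.
have -> : 2 * k.+2 * z = 4 * ((2 * k.+1).+1 * x).
  by rewrite E2 -[2 * k.+2 * z]mulnA -E1; ring.
by rewrite leq_mul2l leq_mul2r leqnSn !orbT.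
Qed.

(** The nondecreasing ratio [C(N, k) / N ^ k] is at least its value at [N = 2 k], where
    [central_bin_ge] applies. *)
Lemma bin_ge_pow k N : 0 < k -> 2 * k <= N -> (2 * N) ^ k <= 2 * k * k ^ k * 'C(N, k).
Proof.
move=> k0 kN; have h := bin_pow_mono k kN; have c := central_bin_ge k0.
have k2 : 0 < (2 * k) ^ k by rewrite expn_gt0 muln_gt0 k0.
rewrite -(leq_pmul2r k2).
have -> : (2 * N) ^ k * (2 * k) ^ k = k ^ k * (4 ^ k * N ^ k).
  by rewrite !expnMn (_ : 4 = 2 * 2) // expnMn; ring.
have := leq_mul c (leqnn (N ^ k)); rewrite -mulnA => /leq_trans/(_ (leq_mul (leqnn _) h)).
move=> /(leq_mul (leqnn (k ^ k)))/leq_trans; apply.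
by apply/eq_leq; ring.
Qed.

(** Passing from [N] to [N + 1 <= 3 k] multiplies [C(N, k)] by [(N + 1) / (N + 1 - k) >= 3 / 2]. *)
Lemma bin_ge_threehalves k m : 0 < k -> m <= k ->
  4 ^ k * 3 ^ m <= 2 * k * 2 ^ m * 'C(2 * k + m, k).
Proof.
move=> k0; elim: m => [|m IH] mk.
  by rewrite muln1 expn0 muln1 addn0 central_bin_ge.
have {IH} := IH (ltnW mk); rewrite addnS.
have := mul_bin_down (2 * k + m).+1 k; rewrite /=.
move: ('C(_, _)) ('C(_.+1, _)) => x y E h.
have hxy : 3 * x <= 2 * y.
  have w0 : 0 < (2 * k + m).+1 by [].
  rewrite -(leq_pmul2l w0) mulnCA E; have := leqnn ((2 * k + m).+1 - k); nia.
rewrite !expnS; apply: leq_trans (_ : 3 * (2 * k * 2 ^ m * x) <= _).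
  by apply: leq_trans (leq_mul (leqnn 3) h); apply/eq_leq; ring.
have h' := leq_mul (leqnn (2 * k * 2 ^ m)) hxy.
by apply: leq_trans (leq_trans _ h') _; apply/eq_leq; ring.
Qed.

(** * Chebyshev bounds and the prime factors of a binomial coefficient *)

Definition primes_upto (n : nat) : seq nat := [seq p <- iota 0 n.+1 | prime p].

Lemma mem_primes_upto n p : (p \in primes_upto n) = prime p && (p <= n).
Proof. by rewrite mem_filter mem_iota. Qed.

Lemma primes_upto_uniq n : uniq (primes_upto n).
Proof. by rewrite filter_uniq ?iota_uniq. Qed.

Lemma primes_upto_S n : primes_upto n.+1 =
  if prime n.+1 then rcons (primes_upto n) n.+1 else primes_upto n.
Proof.
rewrite /primes_upto -[n.+2]addn1 iotaD filter_cat add0n /=.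
by case: ifP; rewrite ?cats1 ?cats0.
Qed.

Lemma prime_even n : prime n -> ~~ odd n -> n = 2.
Proof.
by move=> pn; rewrite -dvdn2 dvdn_prime2 // => /eqP.
Qed.

Lemma size_primes_upto n : size (primes_upto n) <= n./2 + 1.
Proof.
elim/ltn_ind: n => n IH; case: n IH => [|[|[|[|n]]]] IH //.
have h := IH n.+2 (leqW (leqnn _)).
suff : size (primes_upto n.+4) <= size (primes_upto n.+2) + 1.
  by move=> g; apply: leq_trans g _; move: h; rewrite /= !addn1.
rewrite (primes_upto_S n.+3) (primes_upto_S n.+2).
case: ifP => p4; last by case: ifP => // _; rewrite ?size_rcons ?addn1 //; lia.
rewrite size_rcons; case: ifP => p3; last by rewrite addn1.
exfalso; case on: (odd n); last by have := prime_even p4; rewrite /= on; lia.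
by have := prime_even p3; rewrite /= on; lia.
Qed.

(** In Legendre's formula each [p ^ i] contributes a carry, which is 0 or 1, and 0 once
    [p ^ i > N]. *)
Lemma logn_bin_le p N k : prime p -> k <= N -> logn p 'C(N, k) <= trunc_log p N.
Proof.
move=> pp kN; have N0 : 0 < 'C(N, k) by rewrite bin_gt0.
have := congr1 (logn p) (bin_fact kN).
rewrite lognM ?muln_gt0 ?fact_gt0 // lognM ?fact_gt0 //.
have ext m : m <= N -> logn p m`! = \sum_(1 <= i < N.+1) m %/ p ^ i.
  move=> mN; rewrite logn_fact // [RHS](@big_cat_nat _ _ _ m.+1) //=.
  rewrite [X in _ = _ + X]big1_seq ?addn0 // => i; rewrite mem_index_iota => /andP[_ /andP[mi _]].
  by rewrite divn_small //; apply: ltn_trans mi (ltn_expl _ (prime_gt1 pp)).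
rewrite !ext ?leq_subr // -big_split /= => E.
set t := trunc_log p N.
have tN : t <= N.
  rewrite leqNgt; apply/negP => h; case: (posnP N) => [N00|N1].
    by move: h; rewrite /t N00 trunc_log0.
  have := trunc_logP (prime_gt1 pp) N1; rewrite leqNgt => /negP; apply.
  by apply: leq_trans (ltn_expl _ (prime_gt1 pp)) _; rewrite leq_exp2l ?prime_gt1 // ltnW.
suff : \sum_(1 <= i < N.+1) N %/ p ^ i <=
    t + \sum_(1 <= i < N.+1) (k %/ p ^ i + (N - k) %/ p ^ i).
  by rewrite -E leq_add2r.
rewrite !(@big_cat_nat _ _ _ t.+1 1 N.+1) //= addnA.
rewrite [X in _ + X <= _]big1_seq ?addn0; last first.
  move=> i; rewrite mem_index_iota => /andP[_ /andP[ti _]]; rewrite divn_small //.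
  apply: leq_trans (trunc_log_ltn N (prime_gt1 pp)) _.
  by rewrite leq_exp2l // prime_gt1.
apply: leq_trans (leq_addr _ _).
have tE : \sum_(1 <= i < t.+1) 1 = t by rewrite sum_nat_const_nat muln1 subn1.
rewrite -[X in _ <= X + _]tE -big_split /=; apply: leq_sum => i _.
have pi0 : 0 < p ^ i by rewrite expn_gt0 prime_gt0.
by rewrite -{1}(subnKC kN) divnD // [1 + _]addnC leq_add2l leq_b1.
Qed.

Lemma pfactor_bin_le p N k : prime p -> 0 < N -> k <= N -> p ^ logn p 'C(N, k) <= N.
Proof.
move=> pp N0 kN; apply: leq_trans (trunc_logP (prime_gt1 pp) N0).
by rewrite leq_exp2l ?prime_gt1 // logn_bin_le.
Qed.

Lemma logn_bin_le1 p N k : prime p -> k <= N -> N < p ^ 2 -> logn p 'C(N, k) <= 1.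
Proof.
move=> pp kN Np; apply: leq_trans (logn_bin_le pp kN) _.
rewrite leqNgt; apply/negP => h; case: (posnP N) => [N0|N0].
  by move: h; rewrite N0 trunc_log0.
have h2 : p ^ 2 <= p ^ trunc_log p N by rewrite (leq_exp2l _ _ (prime_gt1 pp)).
by have := leq_trans h2 (trunc_logP (prime_gt1 pp) N0); rewrite leqNgt Np.
Qed.

(** Here [N %/ p] is 2 and both [k %/ p] and [(N - k) %/ p] are 1, so the contributions cancel; as
    [p > 2], the quotients have no further factor [p] in their factorials. *)
Lemma logn_bin_mid p N k : prime p -> 2 < p -> N < 3 * p -> p <= k -> 2 * k <= N ->
  logn p 'C(N, k) = 0.
Proof.
move=> pp p2 Np pk kN; have kN' : k <= N by lia.
have small m : m < 3 * p -> logn p m`! = m %/ p.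
  move=> mp; rewrite logn_fact_div // (_ : logn p (m %/ p)`! = 0) ?addn0 //.
  have h : m %/ p < 3 by rewrite ltn_divLR ?prime_gt0.
  case: (posnP (m %/ p)) => [->|m0]; first by rewrite logn1.
  have := logn_fact_lt pp m0; move: h; clear -p2; move: (logn _ _) => v; nia.
have E := congr1 (logn p) (bin_fact kN').
rewrite lognM ?muln_gt0 ?fact_gt0 ?bin_gt0 // lognM ?fact_gt0 // in E.
rewrite !small in E; try lia.
have k1 : 1 <= k %/ p by rewrite divn_gt0 // prime_gt0.
have k2 : 1 <= (N - k) %/ p by rewrite divn_gt0 ?prime_gt0 //; lia.
have k3 : N %/ p < 3 by rewrite ltn_divLR ?prime_gt0.
lia.
Qed.

Definition primorial n := \prod_(p <- primes_upto n) p.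

Lemma dvdn_prod_primes (s : seq nat) m : uniq s -> all prime s -> all (fun p => p %| m) s ->
  \prod_(p <- s) p %| m.
Proof.
elim: s => [|p s IH] /=; first by rewrite big_nil.
move=> /andP[ps us] /andP[pp sp] /andP[pm sm].
have cop : coprime p (\prod_(q <- s) q).
  rewrite prime_coprime // big_seq; elim/big_rec: _ => [|q x qs IHx].
    by rewrite dvdn1; apply: contraTneq pp => ->.
  rewrite Euclid_dvdM // negb_or IHx andbT dvdn_prime2 ?(allP sp q qs) //.
  by apply: contraNneq ps => ->.
by rewrite big_cons Gauss_dvd // pm IH.
Qed.

Lemma odd_central_bin_le m : 'C(m.*2.+1, m) <= 4 ^ m.
Proof.
elim: m => [//|m IH]; rewrite doubleS expnS.
apply: leq_trans (leq_mul (leqnn 4) IH).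
have E1 := mul_bin_diag m.*2.+3 m; have E2 := mul_bin_down m.*2.+2 m.
rewrite /= in E1 E2; have e : m.*2.+2 - m = m.+2 by lia.
rewrite e in E2; move: E1 E2; move: ('C(m.*2.+3, m.+1)) ('C(m.*2.+2, m)) ('C(m.*2.+1, m)) => x y z E1 E2.
have m0 : 0 < m.+1 * m.+2 by [].
rewrite -(leq_pmul2l m0).
have -> : m.+1 * m.+2 * x = m.*2.+3 * (m.*2.+2 * z) by rewrite E2 mulnCA E1; ring.
have -> : m.*2.+3 * (m.*2.+2 * z) = m.*2.+3 * (2 * (m.+1 * z)) by rewrite -addnn; ring.
have -> : m.+1 * m.+2 * (4 * z) = (2 * m.+2) * (2 * (m.+1 * z)) by ring.
by rewrite leq_mul2r; apply/orP; right; lia.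
Qed.

(** A prime in [(m + 1, 2 m + 1]] divides [(2 m + 1)!] but neither [m!] nor [(m + 1)!], hence it
    divides the binomial coefficient. *)
Lemma primorial_double_le m : primorial m.*2.+1 <= primorial m.+1 * 'C(m.*2.+1, m).
Proof.
have mM : m <= m.*2.+1 by lia.
have split : primorial m.*2.+1 = primorial m.+1 * \prod_(p <- [seq p <- primes_upto m.*2.+1 | m.+1 < p]) p.
  rewrite /primorial (perm_big _ (_ : perm_eq _ ([seq p <- primes_upto m.*2.+1 | p <= m.+1] ++
     [seq p <- primes_upto m.*2.+1 | m.+1 < p]))) /=; last first.
    have -> : [seq p <- primes_upto m.*2.+1 | m.+1 < p] =
        filter (predC (fun p => p <= m.+1)) (primes_upto m.*2.+1).
      by apply: eq_filter => p; rewrite /= ltnNge.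
    by rewrite perm_sym; apply/permPl/perm_filterC.
  rewrite big_cat /=; congr (_ * _); apply: perm_big; apply: uniq_perm.
  - by rewrite filter_uniq // primes_upto_uniq.
  - exact: primes_upto_uniq.
  - move=> p; rewrite mem_filter !mem_primes_upto; case: (prime p); rewrite ?andbF //=.
    by case: leqP => // pm; apply: leq_trans pm _; lia.
rewrite split leq_mul2l; apply/orP; right.
apply: dvdn_leq; first by rewrite bin_gt0.
apply: dvdn_prod_primes.
- by rewrite filter_uniq // primes_upto_uniq.
- by apply/allP => p; rewrite mem_filter mem_primes_upto => /and3P[].
apply/allP => p; rewrite mem_filter mem_primes_upto => /and3P[mp pp p2].
have nf j : j <= m.+1 -> ~~ (p %| j`!).
  move=> jm; elim: j jm => [|j IHj] jm; first by rewrite dvdn1; apply: contraTneq pp => ->.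
  rewrite factS Euclid_dvdM // negb_or IHj ?andbT; last exact: ltnW.
  by rewrite gtnNdvd //; apply: leq_ltn_trans jm mp.
have : p %| (m.*2.+1)`! by rewrite dvdn_fact // prime_gt0.
rewrite -(bin_fact mM) !Euclid_dvdM //.
have e : m.*2.+1 - m = m.+1 by lia.
by rewrite e (negbTE (nf m (leqnSn _))) (negbTE (nf _ (leqnn _))) !orbF.
Qed.

Lemma primorial_le n : primorial n <= 4 ^ n.
Proof.
elim/ltn_ind: n => n IH; case: n IH => [|[|[|n]]] IH; try by rewrite /primorial unlock.
case on : (odd n).
  have -> : primorial n.+3 = primorial n.+2.
    rewrite /primorial primes_upto_S; case: ifP => // /prime_even.
    by rewrite /= on => /(_ isT).
  apply: leq_trans (IH n.+2 (leqnn _)) _; rewrite leq_exp2l //.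
have nE : n.+3 = (n./2.+1).*2.+1 by have := odd_double_half n; rewrite on; lia.
rewrite nE; apply: leq_trans (primorial_double_le _) _.
have lt : n./2.+2 < n.+3 by rewrite nE; lia.
apply: leq_trans (leq_mul (IH _ lt) (odd_central_bin_le _)) _.
by rewrite -expnD leq_exp2l //; lia.
Qed.

Lemma leq_prod_const (T : eqType) (s : seq T) (f : T -> nat) M :
  (forall x, x \in s -> f x <= M) -> \prod_(x <- s) f x <= M ^ size s.
Proof.
elim: s => [|x s IH] h; first by rewrite big_nil.
rewrite big_cons /= expnS leq_mul ?h ?mem_head // IH // => y ys.
by rewrite h // inE ys orbT.
Qed.

Lemma dvdn_prod_mem (T : eqType) (s : seq T) (f : T -> nat) x :
  x \in s -> f x %| \prod_(y <- s) f y.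
Proof.
elim: s => [//|y s IH]; rewrite inE big_cons => /predU1P[->|/IH h].
  exact: dvdn_mulr.
exact: dvdn_mull.
Qed.

Lemma prod_primes_gt0 (s : seq nat) : all prime s -> 0 < \prod_(p <- s) p.
Proof.
by move=> sp; rewrite big_seq prodn_cond_gt0 // => p /(allP sp)/prime_gt0.
Qed.

(** [S] holds the primes whose full power is estimated by [N], and [D] those of exponent at most 1,
    which contribute only themselves. *)
Lemma bin_le_gen N k (S D : seq nat) : 0 < N -> k <= N -> all prime S -> all prime D ->
  (forall q, prime q -> q %| 'C(N, k) -> q \in S \/ (q \in D /\ logn q 'C(N, k) <= 1)) ->
  'C(N, k) <= N ^ size S * \prod_(p <- D) p.
Proof.
move=> N0 kN Sp Dp h; have C0 : 0 < 'C(N, k) by rewrite bin_gt0.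
set A := \prod_(p <- S) p ^ logn p 'C(N, k).
have A0 : 0 < A.
  by rewrite /A big_seq prodn_cond_gt0 // => p /(allP Sp)/prime_gt0 p0; rewrite expn_gt0 p0.
have D0 := prod_primes_gt0 Dp.
apply: (@leq_trans (A * \prod_(p <- D) p)); last first.
  by rewrite leq_mul2r leq_prod_const ?orbT // => p /(allP Sp) pp; apply: pfactor_bin_le.
apply: dvdn_leq; first by rewrite muln_gt0 A0.
apply: dvdn_of_logn; rewrite ?muln_gt0 ?A0 // => q pq.
case: (posnP (logn q 'C(N, k))) => [->//|]; rewrite logn_gt0 mem_primes => /and3P[_ _ qC].
rewrite lognM //; case: (h q pq qC) => [qS|[qD le1]].
  apply: leq_trans (leq_addr _ _); rewrite -pfactor_dvdn //.
  exact: (dvdn_prod_mem (fun p => p ^ logn p 'C(N, k))).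
apply: leq_trans le1 (leq_trans _ (leq_addl _ _)).
rewrite logn_gt0 mem_primes pq D0 /=.
exact: (dvdn_prod_mem id).
Qed.

Lemma all_prime_primes_upto n : all prime (primes_upto n).
Proof. by apply/allP => p; rewrite mem_primes_upto => /andP[]. Qed.

Definition smooth_bin N k K := forall q, prime q -> q %| 'C(N, k) -> q <= K.

Lemma bin_le_pi N k K : 0 < N -> k <= N -> smooth_bin N k K ->
  'C(N, k) <= N ^ size (primes_upto K).
Proof.
move=> N0 kN sm; have := @bin_le_gen N k (primes_upto K) [::] N0 kN (all_prime_primes_upto K) isT.
rewrite big_nil muln1; apply => q pq qC; left.
by rewrite mem_primes_upto pq sm.
Qed.

Lemma bin_le_primorial N k K s : 0 < N -> k <= N -> N < s.+1 ^ 2 -> smooth_bin N k K ->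
  'C(N, k) <= N ^ size (primes_upto s) * primorial K.
Proof.
move=> N0 kN Ns sm; apply: bin_le_gen => //; try exact: all_prime_primes_upto.
move=> q pq qC; case: (leqP q s) => qs; [left|right]; rewrite !mem_primes_upto pq ?sm //.
by split=> //; apply: logn_bin_le1 => //; apply: leq_trans Ns _; rewrite leq_exp2r.
Qed.

(** Primes above [sqrt N] have exponent at most 1, those in [(N / 3, k]] do not occur beyond
    [sqrt N], and [(k, k + d]] holds at most [d] primes, each at most [k + d]. *)
Lemma bin_le_third N k d s : 0 < k -> 2 * k <= N -> 2 < s -> N < s.+1 ^ 2 ->
  smooth_bin N k (k + d) ->
  'C(N, k) <= N ^ size (primes_upto s) * (primorial (N %/ 3) * (k + d) ^ d).
Proof.
move=> k0 kN s2 Ns sm; have kN' : k <= N by lia.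
set D := [seq p <- iota k.+1 d | prime p].
apply: (@leq_trans (N ^ size (primes_upto s) * \prod_(p <- primes_upto (N %/ 3) ++ D) p)).
  apply: bin_le_gen; rewrite ?all_prime_primes_upto //; first by lia.
    by rewrite all_cat all_prime_primes_upto filter_all.
  move=> q pq qC; case: (leqP q s) => qs; [left|right]; first by rewrite mem_primes_upto pq.
  have le1 : logn q 'C(N, k) <= 1.
    by apply: logn_bin_le1 => //; apply: leq_trans Ns _; rewrite leq_exp2r.
  split=> //; rewrite mem_cat mem_primes_upto mem_filter mem_iota pq /=.
  have qK := sm q pq qC.
  case: (leqP q (N %/ 3)) => //= q3; case: (ltnP k q) => kq //=.
  have : 0 < logn q 'C(N, k) by rewrite logn_gt0 mem_primes pq bin_gt0 kN' qC.
  rewrite logn_bin_mid //; first by lia.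
  by move: q3; rewrite ltn_divLR // mulnC.
rewrite leq_mul2l big_cat /= leq_mul2l; apply/orP; right; apply/orP; right.
apply: (@leq_trans ((k + d) ^ size D)).
  by apply: leq_prod_const => p; rewrite mem_filter mem_iota; lia.
rewrite leq_pexp2l ?addn_gt0 ?k0 // size_filter.
by apply: leq_trans (count_size _ _) _; rewrite size_iota.
Qed.

Lemma smooth_window_bin N k K : k <= N -> (forall l q, l < k -> prime q -> q %| N - l -> q <= K) ->
  smooth_bin N k K.
Proof.
move=> kN h q pq qC; have : q %| N ^_ k by rewrite -bin_ffact dvdn_mulr.
rewrite ffact_prod; elim/big_rec: _ => [|i x _ IH].
  by rewrite dvdn1 => /eqP q1; rewrite q1 in pq.
by rewrite Euclid_dvdM // => /orP[/(h i q (ltn_ord i) pq)|/IH].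
Qed.

Lemma isqrt_ex N : exists s, s ^ 2 <= N < s.+1 ^ 2.
Proof.
elim: N => [|N [s /andP[h1 h2]]]; first by exists 0.
case: (ltnP N.+1 (s.+1 ^ 2)) => h; first by exists s; rewrite h (leqW h1).
by exists s.+1; rewrite h (leq_ltn_trans h2) // ltn_exp2r.
Qed.

(** By [bin_pow_mono] an inequality [C(N, k) <= N ^ w] with [w <= k] passes down from [N] to [B];
    refuting it at a single [B] rules out all [N >= B]. *)
Lemma bin_le_pi_mono N k K B : 0 < B -> B <= N -> k <= B -> size (primes_upto K) <= k ->
  smooth_bin N k K -> 'C(B, k) <= B ^ size (primes_upto K).
Proof.
move=> B0 BN kB pk sm; set w := size _ in pk *.
have N0 : 0 < N by apply: leq_trans BN.
have h1 := bin_le_pi N0 (leq_trans kB BN) sm; have h2 := bin_pow_mono k BN.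
have h3 : 'C(B, k) * N ^ (k - w) <= B ^ k.
  have Nw : 0 < N ^ w by rewrite expn_gt0 N0.
  rewrite -(leq_pmul2r Nw) -mulnA -expnD subnK //; apply: leq_trans h2 _.
  by rewrite mulnC leq_mul2l h1 orbT.
have Bw : 0 < B ^ (k - w) by rewrite expn_gt0 B0.
rewrite -(leq_pmul2r Bw) -expnD subnKC //; apply: leq_trans h3.
by rewrite leq_mul2l leq_exp2r_w ?orbT.
Qed.

Lemma primes_upto_split t K : t <= K ->
  size (primes_upto K) = size (primes_upto t) + size [seq p <- primes_upto K | t < p].
Proof.
move=> tK; rewrite -(count_predC (fun p => p <= t) (primes_upto K)) -!size_filter; congr (_ + _).
  apply: perm_size; apply: uniq_perm => [||p].
  - by rewrite filter_uniq // primes_upto_uniq.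
  - exact: primes_upto_uniq.
  rewrite mem_filter !mem_primes_upto; case: (prime p); rewrite ?andbF //=.
  by case: leqP => // pt; apply: leq_trans pt tK.
by congr size; apply: eq_filter => p; rewrite /= ltnNge.
Qed.

Lemma exp_large_primes_le t K :
  t.+1 ^ size [seq p <- primes_upto K | t < p] <= 4 ^ K.
Proof.
apply: leq_trans (primorial_le K); set D := filter _ _.
apply: (@leq_trans (\prod_(p <- D) p)).
  have : all (fun p => t < p) D by rewrite filter_all.
  elim: D => [|p D IH] /=; first by rewrite big_nil.
  by case/andP=> tp /IH h; rewrite big_cons expnS leq_mul.
apply: dvdn_leq; first exact: prod_primes_gt0 (all_prime_primes_upto K).
apply: dvdn_prod_primes.
- by rewrite filter_uniq // primes_upto_uniq.
- by apply/allP => p; rewrite mem_filter mem_primes_upto => /and3P[].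
apply/allP => p; rewrite mem_filter => /andP[_ pK].
exact: (dvdn_prod_mem id pK).
Qed.

Lemma sq_le_pow2 x : 15 <= x -> 64 * (x + 6) ^ 2 <= 2 ^ x.
Proof.
move=> h; rewrite -(subnKC h); elim: (x - 15) => [//|d IH].
have -> : 15 + d.+1 = (15 + d).+1 by lia.
rewrite expnS; apply: leq_trans (leq_mul (leqnn 2) IH); nia.
Qed.

(** * Erdos's estimate for [k >= 2 ^ 15] *)

Section Large.
Variables (N k b : nat).
Hypothesis b15 : 15 <= b.
Hypothesis kb : 2 ^ b <= k < 2 ^ b.+1.
Hypothesis sm : smooth_bin N k (k + 12).

(** [N <= 32 * k] gives [N <= 2 ^ u], and [64 * u ^ 2 <= k] keeps [u * sqrt N], the cost of the
    primes up to [sqrt N], under control. *)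
Let u := b + 6.
Let uk : 64 * u ^ 2 <= k.
Proof. by case/andP: kb => h _; apply: leq_trans (sq_le_pow2 b15) h. Qed.
Let u21 : 21 <= u. Proof. by rewrite /u; lia. Qed.
Let k2b : 2 * k <= 2 ^ b.+2.
Proof. by case/andP: kb => _ /ltnW h; rewrite expnS leq_mul2l. Qed.
Let kbig : 64 * 441 <= k.
Proof. by apply: leq_trans uk; rewrite leq_mul2l -mulnn; apply: (leq_mul u21 u21). Qed.

(** [C(N, k) >= 6 ^ k / (2 k)], while the primes above [sqrt N] contribute at most [4 ^ (k + 12)].
    Squaring and [36 > 2 ^ 5] turn this into [5 k] against [4 k] plus terms of size [u * sqrt N]. *)
Lemma large_ratio_small : 3 * k <= N -> N < 32 * k -> False.
Proof.
move=> N3 N32; have k0 : 0 < k by lia.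
have [s /andP[s1 s2]] := isqrt_ex N.
have h1 := bin_ge_pow k0 (leq_trans (leq_mul (isT : 2 <= 3) (leqnn k)) N3).
have h2 := bin_le_primorial (leq_trans k0 (leq_trans (leq_pmull _ (isT : 0 < 3)) N3))
  (leq_trans (leq_pmull _ (isT : 0 < 3)) N3) s2 sm.
have N2 : N <= 2 ^ u.
  by rewrite /u addnC expnD; case/andP: kb => _; rewrite expnS; lia.
have h3 : 'C(N, k) <= 2 ^ (u * (s./2 + 1) + 2 * (k + 12)).
  apply: leq_trans h2 _; rewrite expnD leq_mul //.
    apply: leq_trans (leq_exp2r_w _ N2) _; rewrite -expnM leq_exp2l // leq_mul2l.
    by rewrite size_primes_upto orbT.
  by apply: leq_trans (primorial_le _) _; rewrite (_ : 4 = 2 ^ 2) // -expnM.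
have h4 : 6 ^ k <= 2 ^ b.+2 * 2 ^ (u * (s./2 + 1) + 2 * (k + 12)).
  have kk : 0 < k ^ k by rewrite expn_gt0 k0.
  rewrite -(leq_pmul2r kk) -expnMn; apply: leq_trans (_ : (2 * N) ^ k <= _).
    by apply: leq_exp2r_w; lia.
  apply: leq_trans h1 _; rewrite mulnAC leq_mul2r; apply/orP; right.
  exact: leq_mul.
have h5 : 2 ^ (5 * k) <= 2 ^ (2 * (b.+2 + (u * (s./2 + 1) + 2 * (k + 12)))).
  apply: (@leq_trans (36 ^ k)); first by rewrite expnM leq_exp2r_w.
  rewrite -expnD in h4; rewrite mul2n -addnn expnD (_ : 36 = 6 * 6) // expnMn.
  exact: leq_mul.
move: h5; rewrite leq_exp2l //.
have := odd_double_half s; rewrite -muln2.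
move: (s./2) (odd s : nat) => w o sE h.
have E : u * (2 * w + 2) <= u * (s + 2) by rewrite leq_mul2l; lia.
have us : u * s <= k - 2 * k %/ 16.
  rewrite leqNgt; apply/negP => c.
  have c' : 7 * k <= 8 * (u * s) by lia.
  have := leq_mul c' c'; have := leq_mul uk (ltnW (leq_ltn_trans s1 N32)).
  by clear -kbig; nia.
have uu := leq_mul u21 (leqnn u).
have : k <= 2 * b.+2 + u * (s + 2) + 48 by lia.
rewrite mulnDr; have : 48 * u <= k by move: uk; rewrite -mulnn; lia.
by rewrite /u in us *; lia.
Qed.

(** Reduced to [N = 32 k], this compares [64 ^ k] with [2 k * (32 k) ^ pi(k + 12)]. For
    [t = sqrt (k + 12)] one has [(32 k) ^ 7 <= (t + 1) ^ 19], so the seventh power of the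
    contribution of the primes above [t] is at most [4 ^ (19 (k + 12)) = 2 ^ (38 (k + 12))], against
    [64 ^ (7 k) = 2 ^ (42 k)]. *)
Lemma large_ratio_big : 32 * k <= N -> False.
Proof.
move=> N32; have k0 : 0 < k by lia.
have B0 : 0 < 32 * k by lia.
have kB : k <= 32 * k by lia.
have pik : size (primes_upto (k + 12)) <= k.
  by apply: leq_trans (size_primes_upto _) _; have := odd_double_half (k + 12); lia.
have h1 := bin_le_pi_mono B0 N32 kB pik sm.
have h2 : 64 ^ k <= 2 * k * (32 * k) ^ size (primes_upto (k + 12)).
  have kk : 0 < k ^ k by rewrite expn_gt0 k0.
  have kB2 : 2 * k <= 32 * k by lia.
  rewrite -(leq_pmul2r kk) -expnMn (_ : 64 * k = 2 * (32 * k)); last by rewrite mulnA.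
  apply: leq_trans (bin_ge_pow k0 kB2) _; rewrite mulnAC leq_mul2r.
  by apply/orP; right; rewrite leq_mul.
have [t /andP[t1 t2]] := isqrt_ex (k + 12).
have tK : t <= k + 12 by apply: leq_trans t1; rewrite -mulnn; case: (t) => // t'; apply: leq_pmulr.
rewrite (primes_upto_split tK) expnD in h2.
have k32 : (32 * k) ^ 7 <= t.+1 ^ 19.
  rewrite (expnD t.+1 5 14) expnMn leq_mul //; last first.
    by rewrite (expnM t.+1 2 7) leq_exp2r_w // ltnW //; apply: leq_ltn_trans t2; apply: leq_addr.
  have e32 : 32 = 2 ^ 5 by [].
  rewrite e32 -(expnM 2 5 7) (expnM 2 7 5); apply: leq_exp2r_w.
  rewrite leqNgt; apply/negP => c; have {c} c : t.+1 <= 128 := ltnW c.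
  have := leq_mul c c; rewrite -mulnn in t2; move: t2 kbig; clear; lia.
set w := size (filter _ (primes_upto (k + 12))) in h2; have tw : t.+1 ^ w <= 4 ^ (k + 12) by apply: exp_large_primes_le.
have h3 : (32 * k) ^ (w * 7) <= 2 ^ (38 * (k + 12)).
  rewrite [w * 7]mulnC (expnM (32 * k) 7 w); apply: leq_trans (leq_exp2r_w w k32) _.
  rewrite -expnM [19 * w]mulnC (expnM t.+1 w 19); apply: leq_trans (leq_exp2r_w 19 tw) _.
  rewrite -expnM (_ : 4 = 2 ^ 2) // -expnM leq_exp2l //; clear; lia.
have B2 : 32 * k <= 2 ^ u.
  by rewrite /u addnC expnD; case/andP: kb => _; rewrite expnS; lia.
have h4 : 2 ^ (42 * k) <= 2 ^ (7 * b.+2 + (7 * (u * (t./2 + 1)) + 38 * (k + 12))).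
  have -> : 2 ^ (42 * k) = (64 ^ k) ^ 7.
    by rewrite (_ : 64 = 2 ^ 6) // -!expnM; congr (_ ^ _); lia.
  apply: leq_trans (leq_exp2r_w 7 h2) _.
  rewrite mulnA expnMn -(expnM (32 * k) w 7) expnMn.
  rewrite addnA (expnD 2 (7 * b.+2 + 7 * (u * (t./2 + 1)))) (expnD 2 (7 * b.+2)) leq_mul //.
  apply: leq_mul.
    by rewrite [7 * b.+2]mulnC (expnM 2 b.+2 7) leq_exp2r_w.
  rewrite [7 * (u * (t./2 + 1))]mulnC (expnM 2 _ 7) leq_exp2r_w //.
  apply: leq_trans (leq_exp2r_w _ B2) _; rewrite -expnM leq_exp2l // leq_mul2l.
  by rewrite size_primes_upto orbT.
move: h4; rewrite leq_exp2l //; clear w h2 tw h3 k32.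
have := odd_double_half t; rewrite -muln2.
move: (t./2) (odd t : nat) => w o tE h.
have E : u * (2 * w + 2) <= u * (t + 2) by rewrite leq_mul2l; lia.
have ut : u * t <= k %/ 4.
  rewrite leqNgt; apply/negP => c.
  have c' : k <= 4 * (u * t) by lia.
  have := leq_mul c' c'; have := leq_mul uk t1.
  by clear -kbig; nia.
have uu := leq_mul u21 (leqnn u).
have : 4 * k <= 7 * b.+2 + 456 + 4 * (u * (t + 2)) by lia.
rewrite mulnDr; have : 48 * u <= k by move: uk; rewrite -mulnn; lia.
by rewrite /u in ut *; lia.
Qed.

(** Write [N = 2 k + m] with [m <= k]. After cubing, the exponents of 2 are [6 k + 4 m], using
    [27 >= 2 ^ 4], against [2 N + 3 m = 4 k + 5 m] plus lower terms; the [2 N] comes from the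
    primorial of [N / 3]. *)
Lemma large_ratio_two : 2 * k <= N -> N < 3 * k -> False.
Proof.
move=> N2 N3; have k0 : 0 < k by lia.
have [s /andP[s1 s2]] := isqrt_ex N.
have [m mE] : exists m, N = 2 * k + m by exists (N - 2 * k); lia.
have mk : m <= k by lia.
have h1 := bin_ge_threehalves k0 mk; rewrite -mE in h1.
have s3 : 2 < s.
  rewrite ltnNge; apply/negP => c; have := leq_mul c c; move: s2; rewrite -mulnn; clear -c kbig N2; nia.
have h2 := bin_le_third k0 N2 s3 s2 sm.
have Nu : N <= 2 ^ u.
  by rewrite /u addnC expnD; case/andP: kb => _; rewrite expnS; lia.
have k12 : k + 12 <= 2 ^ b.+2 by apply: leq_trans k2b; lia.
have h3 : (2 ^ (6 * k) * 2 ^ (4 * m) <= 2 ^ (3 * b.+2 + 3 * m +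
    (3 * (u * (s./2 + 1)) + (2 * N + 36 * b.+2)))).
  apply: (@leq_trans ((4 ^ k * 3 ^ m) ^ 3)).
    rewrite expnMn leq_mul //.
      rewrite -expnM -(expnM 2 2 (k * 3)) leq_exp2l //; clear; lia.
    by rewrite (expnM 2 4 m) -(expnM 3 m 3) [m * 3]mulnC (expnM 3 3 m) leq_exp2r_w.
  apply: leq_trans (leq_exp2r_w 3 (leq_trans h1 (leq_mul (leqnn _) h2))) _.
  rewrite (expnMn (2 * k * 2 ^ m)) (expnMn (2 * k)) (expnMn (N ^ _)) (expnMn (primorial _)).
  rewrite (expnD 2 (3 * b.+2 + 3 * m)) (expnD 2 (3 * b.+2)) (expnD 2 (3 * (u * (s./2 + 1)))).
  rewrite (expnD 2 (2 * N)); apply: leq_mul; first apply: leq_mul.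
  - by rewrite [3 * b.+2]mulnC (expnM 2 b.+2 3) leq_exp2r_w.
  - by rewrite -expnM [3 * m]mulnC.
  apply: leq_mul.
    rewrite [3 * (u * (s./2 + 1))]mulnC (expnM 2 _ 3) leq_exp2r_w //.
    apply: leq_trans (leq_exp2r_w _ Nu) _; rewrite -expnM leq_exp2l // leq_mul2l.
    by rewrite size_primes_upto orbT.
  apply: leq_mul; last first.
    by rewrite -expnM [36 * b.+2]mulnC (expnM 2 b.+2 36) leq_exp2r_w.
  apply: leq_trans (leq_exp2r_w 3 (primorial_le _)) _.
  by rewrite -expnM (_ : 4 = 2 ^ 2) // -expnM leq_exp2l // leq_mul2l leq_trunc_div.
move: h3; rewrite -expnD leq_exp2l //; clear h1 h2.
have := odd_double_half s; rewrite -muln2.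
move: (s./2) (odd s : nat) => w o sE h.
have E : u * (2 * w + 2) <= u * (s + 2) by rewrite leq_mul2l; lia.
have us : u * s <= k %/ 4.
  rewrite leqNgt; apply/negP => c.
  have c' : k <= 4 * (u * s) by lia.
  have := leq_mul c' c'; have := leq_mul uk (ltnW (leq_ltn_trans s1 N3)).
  by clear -kbig; nia.
have uu := leq_mul u21 (leqnn u).
have : 2 * k <= 2 * (39 * b.+2) + 3 * (u * (s + 2)) by lia.
rewrite mulnDr; have : 1344 * u <= 64 * u ^ 2 by rewrite -mulnn; lia.
by move: uk us; rewrite /u; lia.
Qed.
End Large.

Lemma smooth_bin_large N k : 2 ^ 15 <= k -> 2 * k <= N -> ~ smooth_bin N k (k + 12).
Proof.
move=> k15 kN sm; have k0 : 0 < k by apply: leq_trans k15; rewrite expn_gt0.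
have kb : 2 ^ trunc_log 2 k <= k < 2 ^ (trunc_log 2 k).+1 by apply: trunc_log_bounds.
have b15 : 15 <= trunc_log 2 k by apply: trunc_log_max.
case: (ltnP N (3 * k)) => N3; first exact: (large_ratio_two b15 kb sm kN N3).
case: (ltnP N (32 * k)) => N32; first exact: (large_ratio_small b15 kb sm N3 N32).
exact: (large_ratio_big b15 kb sm N32).
Qed.

(** * The range [10 <= k < 2 ^ 15] *)

Fixpoint Zfact (n : nat) : Z := if n is m.+1 then Z.mul (Z.of_nat n) (Zfact m) else Zpos xH.

Lemma Zfact_nat n : Zfact n = Z.of_nat n`!.
Proof. by elim: n => [//|n IH]; rewrite factS Nat2Z.inj_mul -IH. Qed.

Lemma pow_le_bin_fact B k : k <= B -> (B - k).+1 ^ k <= 'C(B, k) * k`!.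
Proof.
move=> kB; rewrite bin_ffact ffact_prod -[k in _ ^ k](card_ord k) -prod_nat_const.
by apply: leq_prod => i _; have := ltn_ord i; lia.
Qed.

Definition bin_big (B k w : nat) : bool :=
  Z.ltb (Z.mul (Zfact k) (Z.pow (Z.of_nat B) (Z.of_nat w)))
        (Z.pow (Z.of_nat (B - k).+1) (Z.of_nat k)).

Lemma bin_bigP B k w : k <= B -> bin_big B k w -> B ^ w < 'C(B, k).
Proof.
move=> kB; rewrite /bin_big Zfact_nat -!Zpow_nat -Nat2Z.inj_mul => /Z.ltb_lt/Nat2Z.inj_lt/ssrnat.ltP h.
have := leq_trans h (pow_le_bin_fact kB).
by rewrite [X in X < _]mulnC ltn_mul2r => /andP[].
Qed.

Definition count_small (B k0 len : nat) : bool :=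
  all (fun k => let w := size (primes_upto (k + 12)) in
    if w <= k then bin_big B k w else false) (iota k0 len).

Lemma count_small_ok : count_small (64 * 100) 10 4 && count_small 256 14 67.
Proof. vm_cast_no_check (erefl true). Qed.

Lemma count_smallP B k0 len k N : count_small B k0 len -> k0 <= k < k0 + len ->
  0 < B -> k <= B -> smooth_bin N k (k + 12) -> N < B.
Proof.
move=> /allP h kin B0 kB sm; rewrite ltnNge; apply/negP => BN.
have := h k; rewrite mem_iota kin => /(_ isT); cbv zeta; case: ifP => // wk /(bin_bigP kB).
by rewrite ltnNge (bin_le_pi_mono B0 BN kB wk sm).
Qed.

(** Every prime passes, so counting the survivors bounds the number of primes from above; from
    [53 ^ 2] on it may overcount, which the blocks tolerate. *)
Definition sieve (ps : seq Z) (n : Z) : bool :=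
  all (fun p => if Z.eqb (Z.modulo n p) 0 then Z.eqb n p else true) ps.

Definition sieve_primes : seq nat := [:: 2; 3; 5; 7; 11; 13; 17; 19; 23; 29; 31; 37; 41; 43; 47].

Fixpoint sieve_count (ps : seq Z) (lo : Z) (len acc : nat) : nat :=
  if len is l.+1 then
    sieve_count ps (Z.succ lo) l (if sieve ps lo then acc.+1 else acc)
  else acc.

Lemma prime_sieve n : prime n -> sieve (map Z.of_nat sieve_primes) (Z.of_nat n).
Proof.
move=> pn; rewrite /sieve all_map; apply/allP => p pin /=.
have p1 : 1 < p by move: pin; rewrite !inE; do 14?[case/orP=> [/eqP->|] //]; move=> /eqP->.
case: Z.eqb_spec => // /zmod_dvdn; rewrite (ltnW p1) => /(_ isT).
rewrite dvdn_divisors ?prime_gt0 // => h; apply/Z.eqb_eq; congr Z.of_nat.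
move: h; rewrite -dvdn_divisors ?prime_gt0 // => /(prime_nt_dvdP pn) -> //.
by rewrite neq_ltn p1 orbT.
Qed.

Lemma size_primes_sieve n len acc : size (primes_upto n) <= acc ->
  size (primes_upto (n + len)) <=
    sieve_count (map Z.of_nat sieve_primes) (Z.of_nat n.+1) len acc.
Proof.
elim: len n acc => [|len IH] n acc h; first by rewrite addn0.
rewrite addnS -addSn; cbn [sieve_count]; rewrite -Nat2Z.inj_succ; apply: IH.
rewrite primes_upto_S; case: ifP => [/prime_sieve ->|_]; first by rewrite size_rcons.
by case: ifP => // _; apply: leqW.
Qed.

(* Each block is a length, a bound for the number of primes up to [k + 12] and an
   exponent [e] such that [4 * k <= 2 ^ e] on the block. *)
Definition mid_blocks : seq (nat * nat * nat) := [:: (10, 26, 9); (10, 29, 9); (24, 32, 9);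
  (20, 36, 10); (34, 42, 10); (50, 52, 10); (52, 61, 11); (90, 75, 11); (142, 99, 11);
  (194, 127, 12); (318, 174, 12); (450, 235, 13); (602, 315, 14); (1030, 444, 14);
  (1332, 620, 15); (1970, 886, 15); (2356, 1200, 16); (3216, 1642, 16); (4356, 2245, 16);
  (4634, 2882, 17); (5856, 3699, 17); (5941, 4522, 17)].

Fixpoint blocks_ok (k0 : Z) (w0 : nat) (bs : seq (nat * nat * nat)) : bool :=
  if bs is (len, w, e) :: bs' then
    let k1 := Z.add k0 (Z.of_nat len) in
    if sieve_count (map Z.of_nat sieve_primes) (Z.add k0 12) len w0 <= w then
      [&& Z.leb (Z.mul (Z.of_nat e) (Z.succ (Z.of_nat w))) (Z.mul 3 k0),
          Z.leb (Z.mul 4 (Z.pred k1)) (Z.pow 2 (Z.of_nat e)) & blocks_ok k1 w bs']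
    else false
  else Z.leb (Z.pow 2 15) k0.

Lemma mid_blocks_ok : (size (primes_upto 92) <= 24) && blocks_ok 81 24 mid_blocks.
Proof. vm_cast_no_check (erefl true). Qed.

Lemma primes_upto_mono m n : m <= n -> size (primes_upto m) <= size (primes_upto n).
Proof.
move=> /subnKC <-; elim: (n - m) => [|d IH]; first by rewrite addn0.
rewrite addnS primes_upto_S; apply: leq_trans IH _.
by case: ifP => // _; rewrite size_rcons.
Qed.

Lemma blocksP bs k0 w0 k : blocks_ok (Z.of_nat k0) w0 bs -> size (primes_upto (k0 + 11)) <= w0 ->
  k0 <= k -> k < 2 ^ 15 ->
  exists w e, [/\ size (primes_upto (k + 12)) <= w, e * w.+1 <= 3 * k & 4 * k <= 2 ^ e].
Proof.
elim: bs k0 w0 => [|[[len w] e] bs IH] k0 w0; cbn [blocks_ok].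
  move=> /Z.leb_le h _ kk k15; exfalso.
  have E : Z.of_nat (2 ^ 15) = Z.pow 2 15 by rewrite Zpow_nat.
  by move: h kk k15; rewrite -E; move: (2 ^ 15) => y; clear; lia.
cbv zeta; case: ifP => // cnt /and3P[/Z.leb_le h1 /Z.leb_le h2 h3] pw kk k15.
have E1 : Z.add (Z.of_nat k0) 12 = Z.of_nat (k0 + 11).+1 by clear; lia.
rewrite E1 in cnt; have pw' := leq_trans (size_primes_sieve len pw) cnt.
case: (ltnP k (k0 + len)) => kl.
  exists w, e; split.
  - by apply: leq_trans pw'; apply: primes_upto_mono; move: kl; clear; lia.
  - by move: h1 kk; clear; lia.
  apply/ssrnat.leP/Nat2Z.inj_le; rewrite Zpow_nat.
  by apply: Z.le_trans h2; move: kl; clear; lia.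
apply: (IH (k0 + len) w) => //; first by rewrite Nat2Z.inj_add.
by rewrite addnAC.
Qed.

Lemma mid_block_ex k : 81 <= k -> k < 2 ^ 15 ->
  exists w e, [/\ size (primes_upto (k + 12)) <= w, e * w.+1 <= 3 * k & 4 * k <= 2 ^ e].
Proof.
move=> k81 k15; have /andP[h1 h2] := mid_blocks_ok.
exact: (@blocksP mid_blocks 81 24 k h2 h1 k81 k15).
Qed.

(** At [N = 4 k] the lower bound is [8 ^ k / (2 k)], and the primes contribute at most
    [(4 k) ^ w <= 2 ^ (e * w)]. Since [2 k < 2 ^ e], this contradicts [e * (w + 1) <= 3 k]. *)
Lemma mid_top_lt N k : 81 <= k -> k < 2 ^ 15 -> smooth_bin N k (k + 12) -> N < 4 * k.
Proof.
move=> k81 k15 sm; rewrite ltnNge; apply/negP => N4.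
have [w [e [pw ew ke]]] := mid_block_ex k81 k15.
have k0 : 0 < k by apply: leq_trans k81.
have B0 : 0 < 4 * k by rewrite muln_gt0.
have wk : w.+1 <= k.
  have e4 : 3 <= e.
    rewrite ltnNge; apply/negP => c; have := leq_trans ke (leq_pexp2l (isT : 0 < 2) c).
    by move: k81; clear; lia.
  by have := leq_trans (leq_mul e4 (leqnn w.+1)) ew; rewrite leq_mul2l.
have pk := leq_trans pw (ltnW wk).
have := bin_le_pi_mono B0 N4 (leq_pmull k (isT : 0 < 4)) pk sm.
move=> h3; have kk : 0 < k ^ k by rewrite expn_gt0 k0.
have k24 : 2 * k <= 4 * k by rewrite leq_mul2r orbT.
have e8 : 8 * k = 2 * (4 * k) by rewrite mulnA.
have := bin_ge_pow k0 k24; rewrite -e8 expnMn => h4.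
have h5 : 8 ^ k <= 2 * k * (4 * k) ^ size (primes_upto (k + 12)).
  rewrite -(leq_pmul2r kk); apply: leq_trans h4 _.
  rewrite (mulnAC (2 * k)) leq_mul2r; apply/orP; right.
  by rewrite leq_mul2l h3 orbT.
clear sm h3 pk; move: (size _) pw h5 => p pw h5.
have : 2 ^ (3 * k) < 2 ^ (e * w.+1).
  rewrite (expnM 2 3 k) (_ : 2 ^ 3 = 8) //; apply: leq_ltn_trans h5 _.
  apply: (@leq_ltn_trans (2 * k * 2 ^ (e * w))).
    rewrite leq_mul2l; apply/orP; right.
    apply: leq_trans (leq_exp2r_w p ke) _.
    by rewrite -expnM (leq_exp2l _ _ (isT : 1 < 2)) leq_mul2l pw orbT.
  rewrite mulnS expnD ltn_mul2r expn_gt0 /=.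
  by apply: leq_trans ke; move: k0; clear; lia.
by rewrite ltn_exp2l // ltnNge ew.
Qed.

Definition primeZ (z : Z) : bool :=
  if Z.ltb z (Z.pow 402 2) then
    all (fun d => if Z.ltb d z then ~~ Z.eqb (Z.modulo z d) 0 else true) (Zrange 2 400)
  else false.

Lemma primeZP n : 1 < n -> primeZ (Z.of_nat n) -> prime n.
Proof.
move=> n1; rewrite /primeZ; case: Z.ltb_spec => // nl /allP h.
have n2 : n < 402 ^ 2.
  by apply/ssrnat.ltP/Nat2Z.inj_lt; rewrite Zpow_nat.
apply: contraT => /primePns[|[p [pp p2 pn]]]; first by rewrite ltnNge n1.
have p1 := prime_gt1 pp.
have pl : p < 402 by move: (leq_ltn_trans p2 n2); rewrite ltn_exp2r.
have pin : Z.of_nat p \in Zrange 2 400.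
  by apply: (@Zrange_mem 2 401); move: p1 pl; clear; lia.
have := h _ pin; rewrite (proj2 (zmod_dvdn n (ltnW p1)) pn) Z.eqb_refl.
case: Z.ltb_spec => // pn'; exfalso.
have : p < n.
  apply: leq_trans p2; rewrite -mulnn.
  by rewrite -[X in X < _]muln1 ltn_mul2l (ltnW p1).
by move: pn'; clear; lia.
Qed.

(* Consecutive primes [p < q] with a gap of at most 14 for [p < 256], at most [p / 4] beyond. *)
Fixpoint chain_ok (p : Z) (ps : seq Z) : bool :=
  if ps is q :: qs then
    [&& Z.leb 2 p, primeZ p, (if Z.ltb p 256 then Z.leb q (Z.add p 14)
        else Z.leb (Z.mul 4 (Z.sub q p)) p) & chain_ok q qs]
  else Z.leb (Z.pow 2 17) p.

Definition prime_chain : seq Z := map Z.of_N [::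
  29; 31; 37; 41; 43; 47; 53; 59; 61; 67; 71; 73; 79; 83; 89; 97; 101; 103; 107; 109; 113; 127;
  131; 137; 139; 149; 151; 157; 163; 167; 173; 179; 181; 191; 193; 197; 199; 211; 223; 227;
  229; 233; 239; 241; 251; 257; 317; 389; 479; 593; 739; 919; 1129; 1409; 1759; 2179; 2719;
  3391; 4231; 5281; 6599; 8243; 10303; 12853; 16063; 20071; 25087; 31357; 39191; 48973; 61211;
  76511; 95633; 119533; 149411]%num.

Lemma prime_chain_ok : chain_ok 23 prime_chain.
Proof. vm_cast_no_check (erefl true). Qed.

Lemma chainP ps p N : chain_ok (Z.of_nat p) ps -> p <= N -> N < 2 ^ 17 ->
  exists2 q, prime q & q <= N /\ (if q < 256 then N < q + 14 else 4 * (N - q) < q).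
Proof.
elim: ps p => [|q ps IH] p; cbn [chain_ok].
  move=> /Z.leb_le h pN N17; exfalso.
  have E : Z.of_nat (2 ^ 17) = Z.pow 2 17 by rewrite Zpow_nat.
  by move: h pN N17; rewrite -E; move: (2 ^ 17) => y; clear; lia.
move=> /and4P[/Z.leb_le p2 pp gap ok] pN N17.
have p1 : 1 < p by move: p2; clear; lia.
case: (Z.leb_spec q (Z.of_nat N)) => qN; last first.
  exists p; first exact: primeZP.
  split=> //; case: ltnP => p256; move: gap; case: Z.ltb_spec => h; move: h p256 qN pN; clear; lia.
have q0 : Z.le 0 q by case: (ps) ok => [|r rs]; cbn [chain_ok];
  [move=> /Z.leb_le|case/and4P=> /Z.leb_le]; clear; lia.
apply: (IH (Z.to_nat q)) => //; first by rewrite Z2Nat.id.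
by move: qN q0; clear; lia.
Qed.

(** Numbers that no window with [10 <= k <= 13] can contain. As [k + a <= 25] and 223092870 is the
    product of the primes up to 23, all terms must be 23-smooth; the primes from 11 to 23 are ruled
    out by [window_prime]. *)
Definition good (m : Z) : bool :=
  if has (Z.eqb m) (map Z.of_N [:: 11; 13; 17; 19; 23]%num) then true
  else ~~ smoothZ 223092870 m.

(** [run] counts the numbers since the last good one. Ten in a row never occur in the scanned range,
    so a window of length at least 10 meets a good number. *)
Fixpoint runs_ok (len : nat) (m : Z) (run : nat) : bool :=
  if len is l.+1 then
    if good m then runs_ok l (Z.succ m) 0
    else if run < 9 then runs_ok l (Z.succ m) run.+1 else false
  else true.

Lemma runs_ok_11 : runs_ok (64 * 100) 11 0.
Proof. vm_cast_no_check (erefl true). Qed.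

Lemma runsP len m run N : runs_ok len (Z.of_nat m) run -> m <= N < m + len ->
  (exists2 g, good (Z.of_nat g) & N < g + 10 /\ g <= N) \/ N < m + 9 - run.
Proof.
elim: len m run => [|len IH] m run; cbn [runs_ok]; first by move=> _; lia.
rewrite -Nat2Z.inj_succ.
have [->|mN] := eqVneq N m.
  case: ifP => gm; first by move=> _ _; left; exists m => //; lia.
  by case: ifP => // r9 _ _; right; move: r9; lia.
case: ifP => gm.
  move=> /IH h hN; case: h => [|[g gg gN]|h]; [lia|by left; exists g|].
  by left; exists m => //; move: hN h; lia.
case: ifP => // r9 /IH h hN; case: h => [|[g gg gN]|h]; [lia|by left; exists g|].
by right; lia.
Qed.

Lemma small_top_lt N k : 9 < k -> k < 14 -> smooth_bin N k (k + 12) -> N < 64 * 100.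
Proof.
move=> k9 k14 sm; have kin : 10 <= k < 10 + 4 by rewrite k9.
have kB : k <= 64 * 100 by move: k14; clear; lia.
have /andP[c _] := count_small_ok.
exact (count_smallP c kin (isT : 0 < 64 * 100) kB sm).
Qed.

Lemma small_top_lt' N k : 13 < k -> k < 81 -> smooth_bin N k (k + 12) -> N < 256.
Proof.
move=> k13 k81 sm; have kin : 14 <= k < 14 + 67 by rewrite k13.
have kB : k <= 256 by move: k81; clear; lia.
have /andP[_ c] := count_small_ok.
exact (count_smallP c kin (isT : 0 < 256) kB sm).
Qed.

Lemma good_not_smooth g K : good (Z.of_nat g) -> 0 < g -> g < 64 * 100 -> K <= 25 ->
  prime g \/ ~ (forall q, prime q -> q %| g -> q <= K).
Proof.
move=> gg g0 glt K25; move: gg; rewrite /good; case: ifP => [gin _|_ gs]; [left|right].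
  have {gin} : [|| g == 11, g == 13, g == 17, g == 19 | g == 23].
    by move: gin; rewrite /=; clear; lia.
  by do 4?[case/orP=> [/eqP->|] //]; move=> /eqP->.
move=> sm; move: gs; apply/negP; rewrite negbK.
have P0 : 0 < Z.to_nat 223092870 by apply/ssrnat.ltP/(Pos2Nat.is_pos 223092870).
have g32 : Z.lt (Z.of_nat g) (Z.pow 2 32).
  apply: (@Z.lt_le_trans _ (Z.mul 64 100)); last by [].
  by move: glt; clear; lia.
rewrite -[X in smoothZ X _]Z2Nat.id; last by [].
apply: (smoothZP P0 g0 g32) => q pq qg.
have q25 : q <= 25 by apply: leq_trans (sm q pq qg) K25.
have q0 := prime_gt0 pq; apply/(zmod_dvdn _ q0); rewrite Z2Nat.id; last by [].
by move: q25 pq {q0 qg}; clear; move: q; do 26?[case=> //].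
Qed.

(** A prime inside the window exceeds [N - k >= k + a]. *)
Lemma window_prime N k a q : a <= 12 -> 2 * k + a <= N ->
  (forall l q, l < k -> prime q -> q %| N - l -> q <= k + a) ->
  prime q -> q <= N -> N < q + k -> False.
Proof.
move=> a12 kN sm pq qN Nq; have := sm (N - q) q _ pq _; rewrite subKn // dvdnn.
by move=> h; have := h _ isT; move: kN Nq qN; clear -h; lia.
Qed.

Lemma window_not_smooth N k a : 9 < k -> a <= 12 -> 2 * k + a <= N ->
  ~ (forall l q, l < k -> prime q -> q %| N - l -> q <= k + a).
Proof.
move=> k9 a12 kN sm.
have kN2 : 2 * k <= N by apply: leq_trans kN; apply: leq_addr.
have kN1 : k <= N by apply: leq_trans kN2; apply: leq_pmull.
have smb : smooth_bin N k (k + 12).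
  apply: smooth_window_bin => // l q lk pq qN; apply: leq_trans (sm l q lk pq qN) _.
  by rewrite leq_add2l.
case: (ltnP k (2 ^ 15)) => k15; last exact: (smooth_bin_large k15 kN2 smb).
case: (ltnP k 14) => k14.
  have N6400 := small_top_lt k9 k14 smb.
  have Nin : 11 <= N < 11 + 64 * 100 by move: N6400 kN2 k9; clear; lia.
  (* The other alternative of [runsP] is [N < 20], against [N >= 2 * k >= 20]. *)
  have [[g gg [gN Ng]]|] := runsP (m := 11) runs_ok_11 Nin; last by move: kN2 k9; clear; lia.
  have g0 : 0 < g by move: gN kN2 k9; clear; lia.
  have K25 : k + a <= 25 by move: k14 a12; clear; lia.
  have l_lt : N - g < k by move: gN k9; clear; lia.
  have [pg|[]] := good_not_smooth gg g0 (leq_ltn_trans Ng N6400) K25.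
    by apply: (window_prime a12 kN sm pg Ng); move: gN k9; clear; lia.
  by move=> q pq qg; apply: (sm (N - g) q l_lt pq); rewrite subKn.
have N17 : N < 2 ^ 17 /\ (N < 256 \/ N < 4 * k).
  case: (ltnP k 81) => k81.
    have N256 := small_top_lt' k14 k81 smb.
    split; last by left.
    by apply: leq_trans N256 _; rewrite (leq_exp2l 8 17 (isT : 1 < 2)).
  have N4 := mid_top_lt k81 k15 smb; split; last by right.
  apply: leq_trans N4 _; rewrite (expnD 2 2 15) leq_mul2l; exact: ltnW.
case: N17 => N17 hN.
have N23 : 23 <= N by move: kN2 k14; clear; lia.
(* Below 256 the prime satisfies [N < q + 14 <= q + k]; beyond, [N - q < q / 4 <= N / 4 < k]. In
   both cases it lies in the window. *)
have [q pq [qN]] := chainP (p := 23) prime_chain_ok N23 N17.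
case: ltnP => q256 gap; apply: (window_prime a12 kN sm pq qN).
  by apply: leq_trans gap _; rewrite leq_add2l.
by case: hN gap q256 qN; clear; lia.
Qed.

Local Open Scope ring_scope.

(** * Reducible polynomials *)

Lemma split_false n a k e G H (s : bool) : splits n a k e G H -> (a <= 12)%N ->
  (1 < k)%N -> (2 * k <= n)%N -> (forall j, (0 < j < n)%N -> e j = (-1) ^+ s) -> False.
Proof.
move=> S a12 k2 kn es.
case: (ltnP 9 k) => k9.
  apply: (@window_not_smooth (n + a) k a k9 a12); first by rewrite leq_add2r.
  by move=> l q lk pq qN; apply: (split_prime_le S pq _ lk qN); apply: ltnW.
case: (ltnP 2 k) => k3.
  by apply: (split_window_false S a12 _ kn es); rewrite k3 k9.
have kE : k = 2%N by apply/eqP; rewrite eqn_leq k3 k2.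
rewrite kE in S kn; have n3 : (3 < n)%N by apply: leq_trans kn.
case: (posnP a) => [a0|a0]; last by apply: (split_quad_false S _ n3 es); rewrite a0.
(* For [a = 0] the bound [p <= k + a] would make both integers powers of 2, yet one of them is odd
   and greater than 1. *)
rewrite a0 in S; have [l l2 lodd] : exists2 l, (l < 2)%N & odd (n + 0 - l).
  rewrite addn0; case nodd : (odd n); first by exists 0%N; rewrite ?subn0.
  by exists 1%N => //; rewrite oddB ?nodd //; apply: leq_trans n3.
have big : (1 < n + 0 - l)%N by clear -n3 l2; lia.
have := split_prime_le S (pdiv_prime big) isT l2 (pdiv_dvd _).
rewrite leq_eqVlt ltnNge prime_gt1 ?pdiv_prime // orbF => /eqP p2.
by have := pdiv_dvd (n + 0 - l)%N; rewrite p2 addn0 dvdn2 lodd.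
Qed.

Theorem theorem5 (n a : nat) (c : nat -> int) :
  (1 <= n)%N -> (a <= 12)%N ->
  (c 0%N * c n = 1 \/ c 0%N * c n = -1) ->
  (forall j : nat, (1 <= j < n)%N -> c j = 1) ->
  irreducible_poly (schur_poly n a c) \/
  exists g h : {poly rat},
    size g = 2%N /\ size h = n /\ schur_poly n a c = g * h.
Proof.
move=> n1 a12 c0n cj; set f := schur_poly n a c.
have [c0 cn] : `|c 0%N| = 1 /\ `|c n| = 1.
  have : (`|c 0%N| * `|c n| == 1)%N by rewrite -abszM; case: c0n => ->.
  by rewrite muln_eq1 -!abszE => /andP[/eqP-> /eqP->].
have fE j : f`_j = if (j <= n)%N then (c j)%:~R / ((j + a)`!)%:R else 0.
  rewrite /f /schur_poly -(poly_def n.+1 (fun j => (c j)%:~R / ((j + a)`!)%:R)) coef_poly ltnS.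
  by [].
have cz j : (j == 0%N) || (j == n) -> (c j)%:~R != 0 :> rat.
  move=> h; rewrite intr_eq0 -normr_eq0; case/orP: h => /eqP->; first by rewrite c0.
  by rewrite cn.
have fct j : (j`!)%:R != 0 :> rat by rewrite pnatr_eq0 -lt0n fact_gt0.
have sf : size f = n.+1.
  apply/eqP; rewrite eqn_leq; apply/andP; split.
    by apply/leq_sizeP => j jn; rewrite fE leqNgt jn.
  rewrite ltnNge; apply/negP => /leq_sizeP/(_ n (leqnn n)); rewrite fE leqnn => /eqP.
  by rewrite mulf_eq0 invr_eq0 (negbTE (fct _)) orbF (negbTE (cz n _)) ?eqxx ?orbT.
have f0 : f != 0 by rewrite -size_poly_eq0 sf.
case: (classic (irreducible_poly f)) => [|red]; first by left.
right.
have [g [h [fgh sg sh]]] : exists g h : {poly rat}, [/\ f = g * h, (1 < size g)%N & (size g <= size h)%N].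
  have [q [sq qf qne]] : exists q : {poly rat}, [/\ size q != 1%N, q %| f & ~~ (q %= f)].
    apply: NNPP => none; apply: red; split; first by rewrite sf.
    move=> q sq qf; apply: contraT => qne; by case: none; exists q; split.
  have [r fE'] : exists r, f = r * q by apply/dvdpP; exact: qf.
  have /andP[r0 q0] : (r != 0) && (q != 0) by rewrite -negb_or -mulf_eq0 -fE'.
  have sq1 : (1 < size q)%N by rewrite ltn_neqAle eq_sym sq size_poly_gt0.
  have sr1 : (1 < size r)%N.
    rewrite ltn_neqAle size_poly_gt0 r0 andbT; apply: contra qne => /eqP sr.
    have [w wE] : exists w, r = w%:P by exists r`_0; apply/size1_polyC; rewrite -sr.
    have w0 : w != 0 by rewrite -polyC_eq0 -wE.
    by rewrite fE' wE mul_polyC eqp_sym eqp_scale.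
  case: (leqP (size q) (size r)) => h; first by exists q, r; rewrite mulrC.
  by exists r, q; split=> //; apply: ltnW.
have g0 : g != 0 by rewrite -size_poly_gt0 (ltn_trans _ sg).
have h0 : h != 0 by rewrite -size_poly_gt0 (leq_trans _ sh) // (ltn_trans _ sg).
have sgh : (size g + size h = n.+2)%N.
  have := size_mul g0 h0; rewrite -fgh sf; move: sg; case: (size g) => [//|m] _.
  by rewrite addSn /= => <-.
exists g, h; have [sg2|sg2] := eqVneq (size g) 2%N.
  by split=> //; split=> //; move: sgh; rewrite sg2; clear; lia.
exfalso; pose k := (size g).-1.
have g00 : g`_0 * h`_0 = (c 0%N)%:~R / (a`!)%:R by rewrite -coef0M -fgh fE leq0n add0n.
have gh0 : g`_0 * h`_0 != 0 by rewrite g00 mulf_neq0 ?invr_eq0 // cz.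
move: (gh0); rewrite mulf_eq0 negb_or => /andP[gz hz].
(* Dividing by the constant term multiplies the coefficients by [1 / c 0 = c 0], so all interior
   values equal [c 0]; the value 1 beyond [n] keeps [|e j| = 1] for every [j]. *)
pose e (j : nat) : rat := if j == 0%N then 1 else if j == n then (c 0%N * c n)%:~R
  else if (j < n)%N then (c 0%N)%:~R else 1.
have norm1 (z : int) : `|z| = 1 -> `|z%:~R| = 1 :> rat by move=> z1; rewrite -intr_norm z1.
have S : splits n a k e ((g`_0)^-1 *: g) ((h`_0)^-1 *: h).
  split.
  - split=> // [j|]; last by rewrite /k; move: sg sgh sh; move: (size g) (size h) => x y; clear; lia.
    rewrite /e; case: ifP => _; first exact: normr1.
    case: ifP => _; first by apply: norm1; case: c0n => ->.
    by case: ifP => _; [apply: norm1|apply: normr1].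
  - rewrite -scalerAl -scalerAr scalerA -fgh; apply/polyP => j.
    rewrite coef_nform coefZ fE; case: leqP => // jn; last by rewrite mulr0.
    rewrite -invfM g00 invf_div.
    have cc : (c 0%N)%:~R * (c 0%N)%:~R = 1 :> rat.
      by rewrite -intrM; move: c0; clear => c0; have -> : c 0%N * c 0%N = 1 by nia.
    have cinv : ((c 0%N)%:~R : rat)^-1 = (c 0%N)%:~R.
      by apply: (mulfI (cz 0%N _)); rewrite ?eqxx // divff ?cc // cz.
    rewrite cinv [RHS]mulrACA /e.
    set X := (if _ then _ else _).
    have -> : X = (c j)%:~R * (c 0%N)%:~R; last by ring.
    rewrite /X; have [->|j0] := eqVneq j 0%N; first by rewrite cc.
    have [->|jn'] := eqVneq j n; first by rewrite intrM mulrC.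
    have jlt : (j < n)%N by rewrite ltn_neqAle jn' jn.
    have cj1 : c j = 1 by apply: cj; rewrite lt0n j0.
    by rewrite jlt cj1 mul1r.
  - by rewrite !coefZ !mulVf.
  - by rewrite size_scale ?invr_eq0 // /k prednK // ltnW.
  - have sE : size h = (n - k).+1.
      by rewrite /k; move: sg sh sgh; move: (size g) (size h) => x y; clear; lia.
    by rewrite size_scale ?invr_eq0.
have es : exists s : bool, (c 0%N)%:~R = (-1) ^+ s :> rat.
  have : c 0%N = 1 \/ c 0%N = -1 by move: c0; clear; lia.
  by case=> ->; [exists false|exists true].
case: es => s sE; apply: (@split_false _ _ _ _ _ _ s S a12) => [||j /andP[j0 jn]].
- by rewrite /k; move: sg sg2; move: (size g) => x; clear; lia.
- by rewrite /k; move: sg sh sgh; move: (size g) (size h) => x y; clear; lia.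
by rewrite /e -sE jn; move: j0 jn; clear; case: j => // j _ jn; rewrite (ltn_eqF jn).
Qed.
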